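(* The FO model checking problem on circle graphs (given a circle graph $G$ and an FO sentence $\phi$, decide whether $G\models\phi$) is fixed-parameter tractable with respect to $|\phi|$ and the maximum size of an independent set in $G$.
   Context: A circle graph is the intersection graph of a finite set of chords of a circle (equivalently, a graph with an interval overlap representation, in which two intervals are adjacent iff they intersect and neither contains the other). Graphs may carry vertex labels; FO logic of graphs uses vertex quantification, equality, adjacency and label predicates. Fixed-parameter tractable means solvable in time $f(\text{parameters})\cdot n^{O(1)}$ for a computable $f$. *)

(* Defs.v *)
From HB Require Import structures.
From mathcomp Require Import all_boot all_order all_algebra.
From mathcomp Require Import reals.

Set Implicit Arguments.
Unset Strict Implicit.
Unset Printing Implicit Defensive.

(** * Computation model

    First-order recursive functional programs over binary trees (pure LISP
    without atoms; the language F of N. D. Jones, "Computability and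
    Complexity", with several function definitions), every evaluated
    expression node costing one time unit.  Trees are shared, never copied,
    so each operation is O(1) on a pointer machine; conversely a Turing
    machine is simulated with constant overhead per step (a tape is a pair of
    lists).  Running times thus agree with those of Turing machines and RAMs
    up to a polynomial, and so do polynomial time, computability and
    fixed-parameter tractability. *)

Inductive tree : Type := Leaf | Node of tree & tree.

Fixpoint tsize (t : tree) : nat :=
  if t is Node l r then (tsize l + tsize r).+1 else 1.

(* A function body has a single argument [EArg]; several arguments are passed
   packed in one tree.  [ECall j e] applies the j-th function. *)
Inductive exp : Type :=
| EArg
| ELeaf
| ENode of exp & exp
| EFst of exp
| ESnd of exp
| EIf of exp & exp & exp
| ECall of nat & exp.

(* The bodies of the functions 0, 1, ...; function 0 is the entry point. *)
Definition program : Type := seq exp.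

(* Projections of [Leaf] are [Leaf]. *)
Definition tfst (t : tree) : tree := if t is Node l _ then l else Leaf.
Definition tsnd (t : tree) : tree := if t is Node _ r then r else Leaf.

(* [eval P a e v t]: in program [P], with argument [a], the expression [e]
   evaluates to [v] in exactly [t] steps.  There is no derivation for a
   diverging evaluation.  Indices that are out of range denote the function
   that is constantly [Leaf]. *)
Inductive eval (P : program) : tree -> exp -> tree -> nat -> Prop :=
| ev_arg a : eval P a EArg a 1
| ev_leaf a : eval P a ELeaf Leaf 1
| ev_node a e1 e2 v1 v2 t1 t2 :
    eval P a e1 v1 t1 -> eval P a e2 v2 t2 ->
    eval P a (ENode e1 e2) (Node v1 v2) (t1 + t2).+1
| ev_fst a e v t : eval P a e v t -> eval P a (EFst e) (tfst v) t.+1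
| ev_snd a e v t : eval P a e v t -> eval P a (ESnd e) (tsnd v) t.+1
| ev_if_node a e0 e1 e2 l r v t0 t1 :
    eval P a e0 (Node l r) t0 -> eval P a e1 v t1 ->
    eval P a (EIf e0 e1 e2) v (t0 + t1).+1
| ev_if_leaf a e0 e1 e2 v t0 t2 :
    eval P a e0 Leaf t0 -> eval P a e2 v t2 ->
    eval P a (EIf e0 e1 e2) v (t0 + t2).+1
| ev_call a j e b v t1 t2 :
    eval P a e b t1 -> eval P b (nth ELeaf P j) v t2 ->
    eval P a (ECall j e) v (t1 + t2).+1.

Definition run (P : program) (input output : tree) (t : nat) : Prop :=
  eval P input (nth ELeaf P 0) output t.

Definition code_bool (b : bool) : tree := if b then Node Leaf Leaf else Leaf.
Definition code_nat (n : nat) : tree := iter n (Node Leaf) Leaf.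
Definition code_seq (T : Type) (code : T -> tree) (s : seq T) : tree :=
  foldr (fun x t => Node (code x) t) Leaf s.

Definition computable2 (f : nat -> nat -> nat) : Prop :=
  exists P : program, forall k l : nat,
    exists t, run P (Node (code_nat k) (code_nat l)) (code_nat (f k l)) t.

(* The decision problem [ans] on the instances satisfying the promise [dom],
   parameterized by [k1] and [k2], is fixed-parameter tractable.  The
   parameter values are not part of the input of the algorithm.  The input
   size [tsize (code x)] is always positive. *)
Definition fpt2 (I : Type) (code : I -> tree) (dom : I -> Prop)
    (ans : I -> bool) (k1 k2 : I -> nat) : Prop :=
  exists (P : program) (f : nat -> nat -> nat) (c : nat),
    computable2 f /\
    forall x : I, dom x ->
      exists t, run P (code x) (code_bool (ans x)) t /\
        t <= f (k1 x) (k2 x) * tsize (code x) ^ c.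

(** * Vertex-labelled graphs *)

(* Simple graphs on [{0, ..., n-1}] with label predicates [0, ..., L-1]; a
   vertex may carry any set of labels. *)
Record lgraph (L n : nat) : Type := LGraph {
  adj : rel 'I_n;
  adj_sym : symmetric adj;
  adj_irr : irreflexive adj;
  lab : 'I_L -> {set 'I_n} }.

Definition independent (n : nat) (e : rel 'I_n) (S : {set 'I_n}) : bool :=
  [forall u in S, forall v in S, ~~ e u v].

Definition independence_number (n : nat) (e : rel 'I_n) : nat :=
  \max_(S : {set 'I_n} | independent e S) #|S|.

Section Circle.
Import GRing.Theory Num.Theory.
Local Open Scope ring_scope.
Variable R : realType.

Definition on_unit_circle (p : 'rV[R]_2) : Prop :=
  p 0 0 ^+ 2 + p 0 1 ^+ 2 = 1.

Definition on_segment (p q x : 'rV[R]_2) : Prop :=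
  exists2 t : R, 0 <= t <= 1 & x = (1 - t) *: p + t *: q.

(* The chord of [v] joins [a v] to [b v]. *)
Definition circle_graph (n : nat) (e : rel 'I_n) : Prop :=
  exists a b : 'I_n -> 'rV[R]_2,
    (forall v, [/\ on_unit_circle (a v), on_unit_circle (b v) & a v <> b v]) /\
    (forall u v, u <> v ->
      (e u v <-> exists x, on_segment (a u) (b u) x /\ on_segment (a v) (b v) x)).

End Circle.

(** * First-order logic of labelled graphs *)

(* Formulas over [L] label predicates whose free variables are among [m] de
   Bruijn variables; a quantifier binds variable 0 of its body. *)
Inductive fo (L m : nat) : Type :=
| FOeq of 'I_m & 'I_m
| FOadj of 'I_m & 'I_m
| FOlab of 'I_L & 'I_m
| FOnot of fo L m
| FOand of fo L m & fo L m
| FOor of fo L m & fo L m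
| FOex of fo L m.+1
| FOall of fo L m.+1.

Definition sentence (L : nat) : Type := fo L 0.

(* Number of symbols of the formula. *)
Fixpoint fo_size (L m : nat) (phi : fo L m) : nat :=
  match phi with
  | FOeq _ _ | FOadj _ _ => 3
  | FOlab _ _ => 2
  | FOnot p => (fo_size p).+1
  | FOand p q | FOor p q => (fo_size p + fo_size q).+1
  | FOex p | FOall p => (fo_size p).+2
  end.

Fixpoint fo_sat (L n : nat) (G : lgraph L n) (m : nat) (phi : fo L m) :
    m.-tuple 'I_n -> bool :=
  match phi with
  | FOeq i j => fun r => tnth r i == tnth r j
  | FOadj i j => fun r => adj G (tnth r i) (tnth r j)
  | FOlab l i => fun r => tnth r i \in lab G l
  | FOnot p => fun r => ~~ fo_sat G p r
  | FOand p q => fun r => fo_sat G p r && fo_sat G q r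
  | FOor p q => fun r => fo_sat G p r || fo_sat G q r
  | FOex p => fun r => [exists v, fo_sat G p (cons_tuple v r)]
  | FOall p => fun r => [forall v, fo_sat G p (cons_tuple v r)]
  end.

Definition models (L n : nat) (G : lgraph L n) (phi : sentence L) : bool :=
  fo_sat G phi [tuple].

(** * The model checking problem *)

Record mc_instance : Type := MCInstance {
  mc_labels : nat;
  mc_order : nat;
  mc_graph : lgraph mc_labels mc_order;
  mc_sentence : sentence mc_labels }.

(* The adjacency matrix, followed by one bit vector per label. *)
Definition code_lgraph (L n : nat) (G : lgraph L n) : tree :=
  Node
    (code_seq (fun u => code_seq (fun v => code_bool (adj G u v)) (enum 'I_n))
       (enum 'I_n))
    (code_seq (fun l => code_seq (fun v => code_bool (v \in lab G l)) (enum 'I_n))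
       (enum 'I_L)).

Fixpoint code_fo (L m : nat) (phi : fo L m) : tree :=
  match phi with
  | FOeq i j => Node (code_nat 0) (Node (code_nat i) (code_nat j))
  | FOadj i j => Node (code_nat 1) (Node (code_nat i) (code_nat j))
  | FOlab l i => Node (code_nat 2) (Node (code_nat l) (code_nat i))
  | FOnot p => Node (code_nat 3) (code_fo p)
  | FOand p q => Node (code_nat 4) (Node (code_fo p) (code_fo q))
  | FOor p q => Node (code_nat 5) (Node (code_fo p) (code_fo q))
  | FOex p => Node (code_nat 6) (code_fo p)
  | FOall p => Node (code_nat 7) (code_fo p)
  end.

Definition code_mc (x : mc_instance) : tree :=
  Node (code_lgraph (mc_graph x)) (code_fo (mc_sentence x)).

(* Main.v *)
Require Import Defs.
From mathcomp Require Import all_boot all_order all_algebra.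
From mathcomp Require Import reals.
From mathcomp Require Import ring lra zify.
From Stdlib Require Import Classical FunctionalExtensionality.

(* No circle representation is ever computed.  Let I be a maximal independent set.
   In a chord diagram, the chords crossing a chord i of I are linearly ordered by
   their ends on one side of i, and the chords crossing i but not j are split into
   two cliques by the arc on which they end.  Guessing one bit per pair (i, j) of
   I determines the splitting; adjacency then forces parts of the linear orders,
   and, as in the theory of transitive orientations, every pair that stays
   undecided can be oriented arbitrarily.  The outcome is a partition of the
   vertices into sorts, whose number is bounded in terms of the independence
   number, and an orientation M of the edges such that M linearly orders each sort
   and is monotone with respect to these orders.  Orientations found for some guess
   are accepted if they have these properties, which can be checked directly.

   Given M, binary relations that are monotone for the orders of the sorts are
   closed under composition and under negation with converse, and an existential
   quantifier ranging over one sort asks for a point of a chain above some cuts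
   and below others.  By the Helly property of chains it can be replaced by
   compositions of pairs of literals.  So quantifiers are eliminated symbolically
   in time depending on the parameters only, and the resulting expressions are
   evaluated as Boolean matrices in polynomial time.

   Running times are obtained from a language of terms in which every term has a
   time bound computable by a term, and a polynomial one if its recursions are
   clipped to a shape given in advance. *)

(** A circle graph has many chord diagrams, so the orders of a diagram cannot be recovered from the
    graph. What adjacency does determine is which ordered pairs must be decided together. These
    bundles behave like the implication classes of comparability graphs: a triangle whose sides lie
    in different bundles can be carried along a whole bundle. Hence a bundle is transitive, and
    adding it to a closed transitive order creates no cycle. The diagram shows that no bundle
    contains its own reversal and that the pairs forced through the right guess are consistent. The
    orders finally obtained may still belong to no diagram, so monotonicity has to follow from the
    closure rules. Two vertices with the same neighbours in [I] may be nonadjacent, and an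
    orientation of the edges does not compare them. At a common neighbour such pairs form a partial
    order whose chains are independent sets; splitting by height leaves cliques. Whatever is
    computed without a polynomial bound must depend on the parameters only: guesses are therefore
    indexed by ranks in [I], and labels by ranks in the formula. *)

Set Implicit Arguments.
Unset Strict Implicit.
Unset Printing Implicit Defensive.

(** * Transitive orientations forced by adjacency *)

Section Orientation.
Variables (T : eqType) (e : rel T) (I : pred T).
Hypothesis e_sym : symmetric e.

(** All orders live on neighbourhoods of vertices of [I]: the pair [(u, v)] is compared at [i]. *)
Definition varrow (i u v : T) : bool := [&& I i, e i u, e i v & u != v].

(** Two reasons why [v] and [w] lie on the same side of [u] at [i]. In a diagram [N(i)] is a
    permutation graph, whose order orients edges and non-edges transitively; this gives the first.
    The second comes from a chord [j] that meets [v] and [w] but not [u]. *)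
Definition vshape (i u v w : T) : Prop :=
  (e u v = e u w /\ e u v <> e v w) \/
  (exists j, [/\ I j, e j v, e j w & ~~ e j u] /\ e u v /\ e u w).

Definition vforce (i u v w : T) : Prop :=
  [/\ varrow i u v, varrow i u w, v <> w & vshape i u v w].

(** The analogue of the relation Gamma between the edges of a comparability graph; the classes of
    [eqv] are the implication classes. *)
Inductive step : T -> T -> T -> T -> T -> T -> Prop :=
| StepL i j u v : varrow i u v -> varrow j u v -> e u v -> step i u v j u v
| StepF i u v w : vforce i u v w -> step i u v i u w
| StepG i u v w : vforce i u v w -> step i v u i w u.

Inductive eqv (i u v : T) : T -> T -> T -> Prop :=
| Eqv0 : eqv i u v i u v
| EqvS j x y k x' y' : eqv i u v j x y -> step j x y k x' y' -> eqv i u v k x' y'.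

Lemma varrowC i u v : varrow i u v = varrow i v u.
Proof. by rewrite /varrow eq_sym; case: (I i); case: (e i u); case: (e i v). Qed.

Lemma vforce_sym i u v w : vforce i u v w -> vforce i u w v.
Proof.
case=> h1 h2 h3 h4; split=> //; first by move=> h; apply: h3.
case: h4 => [[a b]|[j [[a b c d] [h k]]]].
  by left; rewrite -a (e_sym w v).
by right; exists j; split; [split|].
Qed.

Lemma step_sym i u v j x y : step i u v j x y -> step j x y i u v.
Proof.
case=> {i u v j x y} [i j u v h1 h2 h3|i u v w h|i u v w h].
- exact: StepL.
- by apply: StepF; apply: vforce_sym.
- by apply: StepG; apply: vforce_sym.
Qed.

Lemma step_rev i u v j x y : step i u v j x y -> step i v u j y x.
Proof.
case=> {i u v j x y} [i j u v h1 h2 h3|i u v w h|i u v w h].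
- by apply: StepL; rewrite 1?varrowC // e_sym.
- exact: StepG.
- exact: StepF.
Qed.

Lemma step_v i u v j x y : step i u v j x y -> varrow i u v /\ varrow j x y.
Proof.
by case=> {i u v j x y} [i j u v h1 h2 h3|i u v w []|i u v w []] //;
  rewrite ![varrow _ _ u]varrowC.
Qed.

Lemma eqv_trans i u v j x y k a b :
  eqv i u v j x y -> eqv j x y k a b -> eqv i u v k a b.
Proof. by move=> h; elim=> // *; apply: EqvS; eauto. Qed.

Lemma eqv_step i u v j x y : step i u v j x y -> eqv i u v j x y.
Proof. by move=> h; apply: EqvS h; apply: Eqv0. Qed.

Lemma eqv_sym i u v j x y : eqv i u v j x y -> eqv j x y i u v.
Proof.
elim=> [|{}j {}x {}y k x' y' _ ih /step_sym /eqv_step h]; first exact: Eqv0.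
exact: eqv_trans h ih.
Qed.

Lemma eqv_rev i u v j x y : eqv i u v j x y -> eqv i v u j y x.
Proof.
elim=> [|{}j {}x {}y k x' y' _ ih /step_rev /eqv_step h]; first exact: Eqv0.
exact: eqv_trans ih h.
Qed.

Lemma eqv_v i u v j x y : eqv i u v j x y -> varrow i u v -> varrow j x y.
Proof. by elim=> // {}j {}x {}y k x' y' _ _ /step_v []. Qed.

(** The hypothesis of the triangle lemma: at no corner are the two pairs leaving it equivalent. *)
Definition free3 i x y z :=
  [/\ [/\ varrow i x y, varrow i x z & varrow i y z],
      ~ eqv i x y i x z, ~ eqv i y x i y z & ~ eqv i z x i z y].

Lemma vforce_eqv i u v w : vforce i u v w -> eqv i u v i u w.
Proof. by move/StepF/eqv_step. Qed.

(** If one adjacency differed from the other two, the first clause of [vshape] would link the two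
    equal sides at their common corner. *)
Lemma free3_mono i x y z : free3 i x y z -> e x y = e y z /\ e x z = e y z.
Proof.
case=> [[vxy vxz vyz] n1 n2 n3].
have d : forall a b, varrow i a b -> a <> b by move=> a b /and4P[_ _ _ /eqP].
case E1: (e x y); case E2: (e x z); case E3: (e y z) => //; exfalso.
all: try by apply: n1; apply: vforce_eqv; split=> //; [exact: d|left; rewrite E1 E2 E3].
all: try by apply: n2; apply: vforce_eqv; split=> //;
  [rewrite varrowC|exact: d|left; rewrite (e_sym y x) E1 E2 E3].
all: by apply: n3; apply: vforce_eqv; split=> //;
  [rewrite varrowC|rewrite varrowC|exact: d|
   left; rewrite (e_sym z x) (e_sym z y) E1 E2 E3].
Qed.

Lemma free3_swap i x y z : free3 i x y z -> free3 i x z y.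
Proof.
case=> [[vxy vxz vyz] n1 n2 n3]; split=> //.
- by split=> //; rewrite varrowC.
- by move/eqv_sym.
Qed.

(* The apex [x] of a free triangle follows its opposite side [yz]. *)
Lemma carryF i x y z t : free3 i x y z -> vforce i y z t ->
  [/\ varrow i x t, x <> t & eqv i x z i x t].
Proof.
move=> fr; have [exy exz] := free3_mono fr; case: (fr) => [[vxy vxz vyz] n1 n2 n3].
move=> vf; case: (vf) => _ vyt zt sh; have yzt := vforce_eqv vf.
have xt : x <> t by move=> E; subst t; apply: n2; apply: eqv_sym.
have vxt : varrow i x t.
  move: vxy vyt; rewrite /varrow => /and4P[-> -> _ _] /and4P[_ _ -> _] /=.
  exact/eqP.
have vyx : varrow i y x by rewrite varrowC.
have ext : e y z = e y t -> e x t = e y z.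
  move=> E; apply/eqP; apply/negPn/negP => /eqP N; apply: n2.
  apply: (@eqv_trans _ _ _ i y t); last exact: eqv_sym.
  apply: vforce_eqv; split=> //; left; rewrite (e_sym y x) exy E; split=> //.
  by rewrite -E => H; apply: N.
split=> //; apply: vforce_eqv; split=> //.
case: sh => [[E N]|[j [[Ij jz jt jy] [yz yt]]]].
  by left; rewrite (ext E) exz.
have Ext := ext (etrans yz (esym yt)).
case jx: (e j x).
  case: n2; apply: vforce_eqv; split=> //.
    by move=> E; subst z; case/and4P: vxz => _ _ _ /eqP.
  right; exists j; split; first by split.
  by split=> //; rewrite e_sym exy.
right; exists j; split; first by split; rewrite ?jx.
by rewrite exz Ext.
Qed.

Lemma free3_move i j x y z y' z' : free3 i x y z ->
  varrow j y' z' -> varrow j x y' -> varrow j x z' ->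
  eqv i y z j y' z' -> eqv i x y j x y' -> eqv i x z j x z' -> free3 j x y' z'.
Proof.
move=> [_ n1 n2 n3] v1 v2 v3 E1 E2 E3; split; first by split.
- move=> h; apply: n1; apply: eqv_trans E2 _; apply: eqv_trans h _; exact: eqv_sym.
- move=> h; apply: n2; apply: eqv_trans (eqv_rev E2) _.
  apply: eqv_trans h _; exact: eqv_sym.
- move=> h; apply: n3; apply: eqv_trans (eqv_rev E3) _.
  by apply: eqv_trans h _; apply: eqv_sym; apply: eqv_rev.
Qed.

(** The triangle lemma: the side opposite to [x] moves through its class while the other two sides
    stay in theirs. When the side passes from one vertex of [I] to another, the second clause of
    [vshape] shows that the new vertex is adjacent to the apex as well. *)
Lemma carry i x y z j y' z' : free3 i x y z -> eqv i y z j y' z' ->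
  [/\ free3 j x y' z', eqv i x y j x y' & eqv i x z j x z'].
Proof.
move=> fr0; elim=> [|{}j u v k u' v' E [fr Ey Ez] st]; first by split=> //; exact: Eqv0.
have E' := EqvS E st.
have [_ vk] := step_v st.
case: st fr Ey Ez E E' vk => {j u v k u' v'} [j k u v h1 h2 h3|j u v w vf|j u v w vf].
- move=> fr Ey Ez E E' vk; have [exy exz] := free3_mono fr.
  case: (fr) => [[vxy vxz vyz] n1 n2 n3].
  have vkx : varrow k x u /\ varrow k x v.
    case/and4P: h2 => Ik ku kv uv; case/and4P: (vxy) => _ _ _ xu.
    case/and4P: (vxz) => _ _ _ xv; rewrite /varrow Ik ku kv xu xv.
    case kx: (e k x) => //=; exfalso; apply: n1.
    apply: vforce_eqv; split=> //.
      by move=> E0; subst v; rewrite eqxx in uv.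
    right; exists k; split; first by split; rewrite ?kx.
    by rewrite exy exz.
  case: vkx => vku vkv.
  have Fu : eqv i x y k x u.
    by apply: EqvS Ey _; apply: StepL => //; rewrite exy.
  have Fv : eqv i x z k x v.
    by apply: EqvS Ez _; apply: StepL => //; rewrite exz.
  by split=> //; apply: (free3_move fr0) E' Fu Fv.
- move=> fr Ey Ez E E' vk; have [vxt xt Ev] := carryF fr vf.
  have Ez' := eqv_trans Ez Ev.
  case: (fr) => [[vxy _ _] _ _ _].
  by split=> //; apply: (free3_move fr0) E' Ey Ez'.
- move=> fr Ey Ez E E' vk; have [vxt xt Ev] := carryF (free3_swap fr) vf.
  have Ey' := eqv_trans Ey Ev.
  case: (fr) => [[_ vxy _] _ _ _].
  by split=> //; apply: (free3_move fr0) E' Ey' Ez.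
Qed.

Definition aclosed (D : T -> T -> T -> Prop) :=
  forall i u v j x y, step i u v j x y -> D i u v -> D j x y.

Lemma aclosed_eqv D i u v j x y : aclosed D -> eqv i u v j x y -> D i u v -> D j x y.
Proof. by move=> cD; elim=> // {}j {}x {}y k x' y' _ ih st /ih; apply: cD st. Qed.

Definition good (D : T -> T -> T -> Prop) :=
  [/\ forall i u v, D i u v -> varrow i u v, aclosed D &
      forall i u v w, D i u v -> D i v w -> D i u w].

(** A pair [x, y] that is only a composition through [m] closes a free triangle with apex [m], so
    [carry] moves the pair along the step with [m] unchanged. *)
Lemma aclosed_comp (A B : T -> T -> T -> Prop) :
  (forall i u v, A i u v -> varrow i u v) ->
  (forall i u v, B i u v -> varrow i u v) ->
  aclosed A -> aclosed B -> (forall i u v, A i u v -> ~ B i v u) ->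
  aclosed (fun i x y => [\/ A i x y, B i x y |
                         varrow i x y /\ exists m, A i x m /\ B i m y]).
Proof.
move=> vA vB cA cB AB i x y j x' y' st.
have [vxy vxy'] := step_v st.
case=> [h|h|[_ [m [h1 h2]]]].
- by apply: Or31; apply: cA st h.
- by apply: Or32; apply: cB st h.
have /eqP nxy : x != y by case/and4P: vxy.
have classicish : A i x y \/ ~ A i x y by apply: classic.
case: classicish => [h|nA]; first by apply: Or31; apply: cA st h.
have [h|nB] : B i x y \/ ~ B i x y by apply: classic.
  by apply: Or32; apply: cB st h.
have fr : free3 i m x y.
  split.
  - by split; [rewrite varrowC; apply: vA| apply: vB|].
  - move=> h; apply: (AB _ _ _ h1); apply: (aclosed_eqv cB (eqv_sym h)) h2.
  - by move=> h; apply: nA; apply: (aclosed_eqv cA h).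
  - move=> /eqv_rev h; apply: nB; exact: (aclosed_eqv cB h).
have [fr' E1 E2] := carry fr (eqv_step st).
apply: Or33; split=> //; exists m; split.
  by apply: (aclosed_eqv cA (eqv_rev E1)).
exact: (aclosed_eqv cB E2).
Qed.

Hypothesis no_inv : forall i u v, varrow i u v -> ~ eqv i u v i v u.

(** Otherwise [f], [c], [d] form a free triangle, and carrying the side [cd] to the equivalent side
    [df] puts the apex [f] on its own opposite side. *)
Lemma eqv_comp i a b c d f j : varrow i a b ->
  eqv i a b j c d -> eqv i a b j d f -> c <> f /\ eqv i a b j c f.
Proof.
move=> v0 E1 E2.
have v1 := eqv_v E1 v0; have v2 := eqv_v E2 v0.
have cf : c <> f.
  move=> E; subst f; apply: (no_inv v1).
  exact: eqv_trans (eqv_sym E1) E2.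
split=> //.
have [//|N] := classic (eqv i a b j c f).
have fr : free3 j f c d.
  split.
  - split.
    + move: v1 v2; rewrite /varrow => /and4P[-> -> _ _] /and4P[_ _ -> _] /=.
      by rewrite eq_sym; apply/eqP.
    + by rewrite varrowC.
    + exact: v1.
  - move=> /eqv_rev h; apply: N; apply: eqv_trans E2 _; exact: eqv_sym.
  - by move=> h; apply: N; apply: eqv_trans E1 _; apply: eqv_sym.
  - move=> h; apply: (no_inv v2); apply: eqv_trans (eqv_sym E2) _.
    by apply: eqv_trans E1 _; apply: eqv_sym; apply: eqv_rev h.
have [[[_ v _] _ _ _] _ _] := carry fr (eqv_trans (eqv_sym E1) E2).
by case/and4P: v => _ _ _ /eqP.
Qed.

(** Since [D] is closed, the class [S] of the undecided pair and its reversal both miss [D]. Any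
    chain that alternates between [D] and [S] then shortens to one with a single [S]-step, which is
    what [X] describes, and such a chain cannot return to its start. *)
Lemma extend D i0 u0 v0 : good D -> (forall i u, ~ D i u u) -> varrow i0 u0 v0 ->
  ~ D i0 u0 v0 -> ~ D i0 v0 u0 ->
  exists D', [/\ good D', forall i u, ~ D' i u u,
     forall i u v, D i u v -> D' i u v & D' i0 u0 v0].
Proof.
move=> [vD cD tD] irD va n1 n2.
pose S i u v := eqv i0 u0 v0 i u v.
have vS i u v : S i u v -> varrow i u v by move=> h; apply: eqv_v h va.
have cS : aclosed S by move=> i u v j x y st h; apply: EqvS st.
have SD i u v : S i u v -> ~ D i u v.
  by move=> h /(aclosed_eqv cD (eqv_sym h)).
have SDr i u v : S i u v -> ~ D i v u.
  by move=> /eqv_rev h /(aclosed_eqv cD (eqv_sym h)).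
have tS i x y z : S i x y -> S i y z -> S i x z.
  by move=> h1 h2; case: (eqv_comp va h1 h2).
pose E i x y := D i x y \/ x = y.
have EE i x y z : E i x y -> E i y z -> E i x z.
  by move=> [h1|->] // [h2|<-]; [left; apply: tD h1 h2|left].
pose X i x y := exists a b, [/\ E i x a, S i a b & E i b y].
pose D' i x y := D i x y \/ X i x y.
have irX i x : ~ X i x x.
  move=> [a [b [h1 h2 h3]]]; case: (EE _ _ _ _ h3 h1) => [h|h].
    exact: (SDr _ _ _ h2 h).
  by subst b; move/vS: h2 => /and4P[_ _ _ /eqP].
have irD' i x : ~ D' i x x by case=> [/irD|/irX].
have inX i x y : X i x y -> [/\ I i, e i x & e i y].
  have inE j a b : E j a b -> I j -> (e j a -> e j b) /\ (e j b -> e j a).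
    by case=> [/vD /and4P[_ -> -> _]|->].
  move=> [a [b [h1 /vS /and4P[Ii ia ib _] h3]]]; split=> //.
    by case: (inE _ _ _ h1 Ii) => _; apply.
  by case: (inE _ _ _ h3 Ii) => h _; apply: h.
have vX i x y : X i x y -> varrow i x y.
  move=> h; case: (inX _ _ _ h) => h1 h2 h3; rewrite /varrow h1 h2 h3 /=.
  by apply/eqP => E0; subst y; apply: irX h.
(* Two [S]-steps joined by the [D]-step [bc] collapse: either two sides of the triangle [c], [a],
   [b] are equivalent, or carrying [ab] to [cd] would put the apex [c] on its opposite side. *)
have XX i x y z : X i x y -> X i y z -> X i x z.
  move=> [a [b [h1 h2 h3]]] [c [d [k1 k2 k3]]].
  case: (EE _ _ _ _ h3 k1) => [bc|bc]; last first.
    by subst c; exists a, d; split=> //; apply: tS h2 k2.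
  have vbc := vD _ _ _ bc; have vab := vS _ _ _ h2; have vcd := vS _ _ _ k2.
  have ca : c <> a.
    by move=> E0; subst c; apply: (SDr _ _ _ h2 bc).
  have vca : varrow i c a.
    case/and4P: vab => Ii ia _ _; case/and4P: vcd => _ ic _ _.
    by rewrite /varrow Ii ia ic; apply/eqP.
  have h2c : eqv i a b i c d by apply: eqv_trans (eqv_sym h2) k2.
  have [Q|NQ] := classic (eqv i a c i a b).
    have Sac : S i a c by apply: eqv_trans h2 (eqv_sym Q).
    by exists a, d; split=> //; apply: tS Sac k2.
  have [Q|NQ2] := classic (eqv i c a i c b).
    have ac : D i a c.
      by apply: (aclosed_eqv cD (eqv_sym (eqv_rev Q))).
    by exists c, d; split=> //; apply: EE h1 _; left.
  have fr : free3 i c a b.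
    split=> //; first by split=> //; rewrite varrowC.
    by move=> h; apply: (SDr _ _ _ h2); apply: (aclosed_eqv cD h).
  by have [[[/and4P[_ _ _ /eqP]]]] := carry fr h2c.
exists D'; split=> //.
- split.
  + by move=> i u v [/vD|/vX].
  (* [D'] is obtained by composing twice, first [D] with [S] and then the result with [D]. *)
  + have c1 := aclosed_comp vD vS cD cS (fun i u v h k => SDr _ _ _ k h).
    set A1 := (fun i x y => [\/ D i x y, S i x y | _]) in c1.
    have v1 i u v : A1 i u v -> varrow i u v.
      by case=> [/vD|/vS|[]].
    have d1 i u v : A1 i u v -> ~ D i v u.
      case=> [h k|h k|[_ [m [h k]]] l].
      * exact: (irD _ _ (tD _ _ _ _ h k)).
      * exact: (SDr _ _ _ h k).
      * exact: (SDr _ _ _ k (tD _ _ _ _ l h)).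
    have c2 := aclosed_comp v1 vD c1 cD d1.
    move=> i u v j x y st h.
    set A2 := (fun i x y => [\/ A1 i x y, D i x y | _]) in c2.
    have D'A i1 x1 y1 : D' i1 x1 y1 -> A2 i1 x1 y1.
      case=> [k|k]; first by apply: Or32.
      have vk := vX _ _ _ k.
      case: k => a [b [[k1|k1] k2 [k3|k3]]]; subst.
      * apply: Or33; split=> //; exists b; split=> //; apply: Or33.
        split; last by exists a.
        case/and4P: (vS _ _ _ k2) => Ii _ ib _; case/and4P: (vD _ _ _ k1) => _ ix _ _.
        rewrite /varrow Ii ib ix; apply/eqP => E0; subst b.
        exact: (SDr _ _ _ k2 k1).
      * by apply: Or31; apply: Or33; split=> //; exists a.
      * by apply: Or33; split=> //; exists b; split=> //; apply: Or32.
      * by apply: Or31; apply: Or32.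
    case: (c2 _ _ _ _ _ _ st (D'A _ _ _ h)) => [[k|k|[_ [m [k1 k2]]]]|k|[_ [m [[k|k|[_ [m' [k1 k2]]]] k3]]]].
    * by left.
    * by right; exists x, y; split=> //; right.
    * by right; exists m, y; split=> //; [left|right].
    * by left.
    * by left; apply: tD k k3.
    * by right; exists x, m; split=> //; [right|left].
    * by right; exists m', m; split=> //; left.
  + move=> i u v w [h|h] [k|k].
    * by left; apply: tD h k.
    * case: k => a [b [k1 k2 k3]]; right; exists a, b; split=> //.
      by apply: EE k1; left.
    * case: h => a [b [k1 k2 k3]]; right; exists a, b; split=> //.
      by apply: EE k3 _; left.
    * by right; apply: XX h k.
- by move=> i u v h; left.
- by right; exists u0, v0; split; [right|exact: Eqv0|right].
Qed.

End Orientation.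

(** * Chords and their end points *)

Section Geometry.
Import Order.TTheory GRing.Theory Num.Theory.
Local Open Scope ring_scope.
Variable R : realType.
Implicit Types p q r s x : 'rV[R]_2.

(** [hnum p : hden p] is the tangent of half the angle of [p] in homogeneous coordinates; [(-1, 0)]
    becomes the point at infinity. *)
Definition hnum p : R := if p 0 0 == -1 then 1 else p 0 1.
Definition hden p : R := if p 0 0 == -1 then 0 else 1 + p 0 0.
(** Positive when [q] comes after [p] counterclockwise on the circle cut open at [(-1, 0)], which is
    its last point. *)
Definition cgap p q : R := hnum q * hden p - hnum p * hden q.

(** Twice the signed area of the triangle [p], [q], [x]; its sign tells the side of the line [pq] on
    which [x] lies. *)
Definition det3 p q x : R :=
  (q 0 0 - p 0 0) * (x 0 1 - p 0 1) - (q 0 1 - p 0 1) * (x 0 0 - p 0 0).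

Definition hnorm p : R := hnum p ^+ 2 + hden p ^+ 2.

Lemma hcoord p : on_unit_circle p ->
  [/\ 0 < hnorm p, 0 <= hden p, hden p = 0 -> hnum p = 1 &
   p 0 0 = (hden p ^+ 2 - hnum p ^+ 2) / hnorm p /\
   p 0 1 = 2 * hnum p * hden p / hnorm p].
Proof.
rewrite /on_unit_circle /hnorm /hnum /hden => H; case: eqP => [E|/eqP E].
  have y0 : p 0 1 = 0 by apply/eqP; rewrite -sqrf_eq0; apply/eqP; nra.
  by rewrite E y0; split=> //; [lra| split; field].
have x1 : -1 <= p 0 0 by nra.
have x2 : 0 < 1 + p 0 0 by rewrite lt_def; apply/andP; split; [apply/eqP|]; lra.
have N : p 0 1 ^+ 2 + (1 + p 0 0) ^+ 2 = 2 * (1 + p 0 0) by nra.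
rewrite N; split; [lra|lra|lra|]; have h : 1 + p 0 0 != 0 by rewrite gt_eqF.
split.
  have -> : (1 + p 0 0) ^+ 2 - p 0 1 ^+ 2 = 2 * (1 + p 0 0) * p 0 0 by nra.
  by field.
by field.
Qed.

(** The rational parametrization turns the determinant into a Vandermonde product, so sides of
    chords can be read off the order on the circle. *)
Lemma det3E p q x : on_unit_circle p -> on_unit_circle q -> on_unit_circle x ->
  det3 p q x = 4 * (cgap p q * cgap q x * cgap p x) / (hnorm p * hnorm q * hnorm x).
Proof.
move=> /hcoord[np _ _ [Ep Fp]] /hcoord[nq _ _ [Eq Fq]] /hcoord[nx _ _ [Ex Fx]].
rewrite /det3 Ep Fp Eq Fq Ex Fx /cgap; move: np nq nx; rewrite /hnorm.
move: (hnum p) (hden p) (hnum q) (hden q) (hnum x) (hden x) => a b c d f g h1 h2 h3.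
by field; rewrite !gt_eqF.
Qed.

Lemma cgapC p q : cgap p q = - cgap q p.
Proof. by rewrite /cgap; ring. Qed.

Lemma cgap0 p q : on_unit_circle p -> on_unit_circle q -> cgap p q = 0 -> p = q.
Proof.
move=> /hcoord[np bp cp [Ep Fp]] /hcoord[nq bq cq [Eq Fq]] H.
have [k k0 [E1 E2]] : exists2 k, k != 0 & hnum q = k * hnum p /\ hden q = k * hden p.
  move: H np nq; rewrite /cgap /hnorm => H np nq.
  case: (eqVneq (hden p) 0) => [E|N].
    have F := cp E; move: H; rewrite E F => H.
    have E2 : hden q = 0 by lra.
    by exists 1; rewrite ?oner_neq0 // E2 (cq E2); split; lra.
  exists (hden q / hden p); last first.
    split; last by rewrite divfK.
    by rewrite mulrAC; apply: (canRL (mulfK N)); lra.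
  apply/negP => /eqP E.
  have E2 : hden q = 0 by rewrite -(divfK N (hden q)) E mul0r.
  by move: H; rewrite E2 (cq E2) => H; case/eqP: N; lra.
have p0 := gt_eqF np; have q0 := gt_eqF nq.
have kn : hnorm q = k ^+ 2 * hnorm p by rewrite /hnorm E1 E2; ring.
have k0' : k ^+ 2 != 0 by rewrite sqrf_eq0.
apply/rowP => i; have [->|->] : i = 0 \/ i = 1.
  by case: i => [[|[|m]] hm] //; [left|right]; apply: val_inj.
  by rewrite Ep Eq kn E1 E2; field; rewrite p0 k0.
by rewrite Fp Fq kn E1 E2; field; rewrite p0 k0.
Qed.

(** Cross products with nonnegative denominators compare fractions; a zero denominator occurs at the
    last point only. *)
Lemma cgap_trans p q x : on_unit_circle p -> on_unit_circle q -> on_unit_circle x ->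
  0 < cgap p q -> 0 < cgap q x -> 0 < cgap p x.
Proof.
move=> /hcoord[np bp cp _] /hcoord[nq bq cq _] /hcoord[nx bx cx _]; rewrite /cgap.
move: bp cp bq cq bx cx.
move: (hnum p) (hden p) (hnum q) (hden q) (hnum x) (hden x) => a b c d f g.
move=> bp cp bq cq bx cx h1 h2.
have d0 : d != 0 by apply/negP => /eqP E; move: h1 h2; rewrite E (cq E); lra.
have d1 : 0 < d by rewrite lt_def d0.
have b0 : b != 0 by apply/negP => /eqP E; move: h1; rewrite E (cp E); lra.
have b1 : 0 < b by rewrite lt_def b0.
have : 0 < d * (f * b - a * g) by nra.
by rewrite pmulr_rgt0.
Qed.

Lemma det3_seg p q (t : R) r s :
  det3 p q ((1 - t) *: r + t *: s) = (1 - t) * det3 p q r + t * det3 p q s.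
Proof. by rewrite /det3 !mxE; ring. Qed.

Lemma det3_on p q x : on_segment p q x -> det3 p q x = 0.
Proof. by case=> t _ ->; rewrite det3_seg /det3; ring. Qed.

Lemma segments_apart p q r s :
  0 < det3 p q r * det3 p q s -> ~ exists x, on_segment p q x /\ on_segment r s x.
Proof.
move=> H [x [/det3_on h1 [t /andP[t0 t1] E]]].
move: h1; rewrite E det3_seg => h1.
move: H h1; move: (det3 p q r) (det3 p q s) => u v H h1.
have [u0|u0] := ltP 0 u.
  have v0 : 0 < v by rewrite -(pmulr_rgt0 v u0).
  by nra.
have u1 : u < 0 by rewrite lt_neqAle u0 andbT; apply/negP => /eqP E0; rewrite E0 mul0r ltxx in H.
have v0 : v < 0 by rewrite -(nmulr_rgt0 v u1).
by nra.
Qed.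

Lemma segments_cross p q r s : det3 p q r * det3 p q s < 0 ->
  det3 r s p * det3 r s q < 0 -> exists x, on_segment p q x /\ on_segment r s x.
Proof.
move=> h1 h2.
pose a := det3 p q r; pose b := det3 p q s; pose c := det3 r s p; pose d := det3 r s q.
have ab : a - b != 0 by apply/negP => /eqP E; move: h1; rewrite -/a -/b; nra.
have cd : c - d != 0 by apply/negP => /eqP E; move: h2; rewrite -/c -/d; nra.
have E : a - b = d - c by rewrite /a /b /c /d /det3; ring.
have frac (u v : R) : u * v < 0 -> 0 <= u / (u - v) <= 1.
  move=> h; have [u0|u0] := ltP 0 u.
    have v0 : v < 0 by rewrite -(pmulr_rlt0 v u0).
    by rewrite divr_ge0 ?ler_pdivrMr; lra.
  have u1 : u < 0.
    by rewrite lt_neqAle u0 andbT; apply/negP => /eqP E0; rewrite E0 mul0r ltxx in h.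
  have v0 : 0 < v by rewrite -(nmulr_rlt0 v u1).
  have -> : u / (u - v) = (- u) / (v - u) by rewrite -[in RHS](opprB u v) invrN mulrNN.
  by rewrite divr_ge0 ?ler_pdivrMr; lra.
(* The parameter is the zero of the affine function [det3 r s] along the segment from [p] to [q]. *)
exists ((1 - c / (c - d)) *: p + (c / (c - d)) *: q); split.
  by exists (c / (c - d)) => //; apply: frac.
exists (a / (a - b)); first exact: frac.
have dc : d - c != 0 by rewrite -E.
apply/rowP => i; have [->|->] : i = 0 \/ i = 1.
  by case: i => [[|[|m]] hm] //; [left|right]; apply: val_inj.
  rewrite !mxE; move: cd ab; rewrite /a /b /c /d /det3 => cd ab; field.
  by rewrite cd ab.
rewrite !mxE; move: cd ab; rewrite /a /b /c /d /det3 => cd ab; field.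
by rewrite cd ab.
Qed.
End Geometry.

Definition overlap (T : Type) (l r : T -> nat) (u v : T) : bool :=
  [&& l u < l v, l v < r u & r u < r v] || [&& l v < l u, l u < r v & r v < r u].

(** * Meeting chords and alternating ends *)

Section Meet.
Import Order.TTheory GRing.Theory Num.Theory.
Local Open Scope ring_scope.
Variables (R : realType) (E : finType) (pt : E -> 'rV[R]_2).
Hypothesis ptc : forall x, on_unit_circle (pt x).

(** Integer positions bring the combinatorics within reach of [lia]; ends at the same point share a
    rank. *)
Definition crank (x : E) : nat := #|[set y | 0 < cgap (pt y) (pt x)]|.

Lemma cgap_self (p : 'rV[R]_2) : cgap p p = 0.
Proof. by rewrite /cgap subrr. Qed.

Lemma crank_lt x y : (crank x < crank y)%N = (0 < cgap (pt x) (pt y)).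
Proof.
have lt a b : 0 < cgap (pt a) (pt b) -> (crank a < crank b)%N.
  move=> h; apply: proper_card; apply/properP; split.
    by apply/subsetP => z; rewrite !inE => k; apply: cgap_trans k h.
  by exists a; rewrite !inE ?cgap_self ?ltxx.
apply/idP/idP; last exact: lt.
move=> h; have [//|k] := ltP 0 (cgap (pt x) (pt y)).
have [k0|k1] := eqVneq (cgap (pt x) (pt y)) 0.
  have E0 := cgap0 (ptc x) (ptc y) k0.
  by move: h; rewrite /crank E0 ltnn.
have : (crank y < crank x)%N by apply: lt; rewrite cgapC oppr_gt0 lt_neqAle k1.
by move/(ltn_trans h); rewrite ltnn.
Qed.

Lemma crank_eq x y : (crank x = crank y) <-> pt x = pt y.
Proof.
split=> [h|]; last by rewrite /crank => ->.
apply: cgap0 => //; apply/eqP; rewrite eq_le; apply/andP; split.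
  by rewrite leNgt -crank_lt h ltnn.
by rewrite -oppr_le0 -cgapC leNgt -crank_lt h ltnn.
Qed.

Definition inside (x y z : E) : bool := (crank x < crank z)%N (+) (crank y < crank z)%N.

Lemma det3_sign x y z t : pt x <> pt y ->
  exists2 k : R, 0 < k & det3 (pt x) (pt y) (pt z) * det3 (pt x) (pt y) (pt t) =
   k * ((cgap (pt x) (pt z) * cgap (pt y) (pt z)) *
        (cgap (pt x) (pt t) * cgap (pt y) (pt t))).
Proof.
move=> xy; rewrite !det3E //.
have [nx _ _ _] := hcoord (ptc x); have [ny _ _ _] := hcoord (ptc y).
have [nz _ _ _] := hcoord (ptc z); have [nt _ _ _] := hcoord (ptc t).
exists (16 * cgap (pt x) (pt y) ^+ 2 /
  ((hnorm (pt x) * hnorm (pt y) * hnorm (pt z)) * (hnorm (pt x) * hnorm (pt y) * hnorm (pt t)))).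
  have c0 : 0 < cgap (pt x) (pt y) ^+ 2.
    by rewrite exprn_even_gt0 //=; apply/eqP => h; apply: xy; apply: cgap0.
  have h16 : 0 < 16 :> R by lra.
  by move: (_ ^+ 2) c0 => c c0; apply: divr_gt0; repeat apply: mulr_gt0.
by field; rewrite !gt_eqF.
Qed.

Lemma inside_sign x y z : pt x <> pt z -> pt y <> pt z ->
  (cgap (pt x) (pt z) * cgap (pt y) (pt z) < 0) = inside x y z /\
  (0 < cgap (pt x) (pt z) * cgap (pt y) (pt z)) = ~~ inside x y z.
Proof.
move=> xz yz; rewrite /inside !crank_lt.
have a0 : cgap (pt x) (pt z) != 0 by apply/eqP => h; apply: xz; apply: cgap0.
have b0 : cgap (pt y) (pt z) != 0 by apply/eqP => h; apply: yz; apply: cgap0.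
move: a0 b0; set a := cgap _ _; set b := cgap _ _ => a0 b0.
have [a1|a1] := ltP 0 a; have [b1|b1] := ltP 0 b => /=.
- by rewrite mulr_gt0 // ltNge mulr_ge0 // ltW.
- have {}b1 : b < 0 by rewrite lt_neqAle b0.
  by rewrite pmulr_rlt0 // b1 pmulr_rgt0 // ltNge (ltW b1).
- have {}a1 : a < 0 by rewrite lt_neqAle a0.
  by rewrite pmulr_llt0 // a1 pmulr_lgt0 // ltNge (ltW a1).
- have {}a1 : a < 0 by rewrite lt_neqAle a0.
  have {}b1 : b < 0 by rewrite lt_neqAle b0.
  by rewrite nmulr_rlt0 // nmulr_rgt0 // b1 ltNge (ltW b1).
Qed.

(** Apart from shared ends, [det3E] reduces the sign of a product of two determinants to the parity
    of the ends between [z] and [t], and alternation of four points is symmetric in the two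
    chords. *)
Lemma meetP x y z t : pt x <> pt y -> pt z <> pt t ->
  (exists w, on_segment (pt x) (pt y) w /\ on_segment (pt z) (pt t) w) <->
  [|| crank x == crank z, crank x == crank t, crank y == crank z, crank y == crank t |
      inside x y z (+) inside x y t].
Proof.
move=> xy zt.
have on0 (p q : 'rV[R]_2) : on_segment p q p.
  by exists 0; rewrite ?lexx ?ler01 // subr0 scale1r scale0r addr0.
have on1 (p q : 'rV[R]_2) : on_segment p q q.
  by exists 1; rewrite ?lexx ?ler01 // subrr scale1r scale0r add0r.
case: eqP => [/crank_eq xz|nxz] /=.
  by split=> // _; exists (pt x); split; [|rewrite xz].
case: eqP => [/crank_eq xt|nxt] /=.
  by split=> // _; exists (pt x); split; [|rewrite xt].
case: eqP => [/crank_eq yz|nyz] /=.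
  by split=> // _; exists (pt y); split; [|rewrite yz].
case: eqP => [/crank_eq yt|nyt] /=.
  by split=> // _; exists (pt y); split; [|rewrite yt].
have nn a b : crank a <> crank b -> pt a <> pt b by move=> h /crank_eq.
have ns a b : crank a <> crank b -> pt b <> pt a by move=> h /esym/crank_eq.
have [k k0 E1] := det3_sign z t xy; have [k' k0' E2] := det3_sign x y zt.
have [A1 A2] := inside_sign (nn _ _ nxz) (nn _ _ nyz).
have [B1 B2] := inside_sign (nn _ _ nxt) (nn _ _ nyt).
have [C1 C2] := inside_sign (ns _ _ nxz) (ns _ _ nxt).
have [D1 D2] := inside_sign (ns _ _ nyz) (ns _ _ nyt).
have nat4 : inside x y z (+) inside x y t = inside z t x (+) inside z t y.
  rewrite /inside; move: nxz nxt nyz nyt.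
  by case: (ltngtP (crank x) (crank z)) => //; case: (ltngtP (crank x) (crank t)) => //;
    case: (ltngtP (crank y) (crank z)) => //; case: (ltngtP (crank y) (crank t)).
case I : (inside x y z (+) inside x y t); split=> // H.
- apply: segments_cross.
    rewrite E1 pmulr_rlt0 //; move: I A1 A2 B1 B2.
    case: (inside x y z); case: (inside x y t) => //= _ a1 a2 b1 b2.
      by rewrite nmulr_rlt0 ?a1 ?b2.
    by rewrite pmulr_rlt0 ?a2 ?b1.
  rewrite E2 pmulr_rlt0 //; move: I C1 C2 D1 D2; rewrite nat4.
  case: (inside z t x); case: (inside z t y) => //= _ a1 a2 b1 b2.
    by rewrite nmulr_rlt0 ?a1 ?b2.
  by rewrite pmulr_rlt0 ?a2 ?b1.
- exfalso; move: H; apply: segments_apart.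
  rewrite E1 pmulr_rgt0 //; move: I A1 A2 B1 B2.
  case: (inside x y z); case: (inside x y t) => //= _ a1 a2 b1 b2.
    by rewrite nmulr_rgt0 ?a1 ?b1.
  by rewrite pmulr_rgt0 ?a2 ?b2.
Qed.
End Meet.

Lemma lex_lt (B x y x' y' : nat) : y < B -> y' < B ->
  (x * B + y < x' * B + y') = (x < x') || ((x == x') && (y < y')).
Proof.
move=> h h'; have [lt|gt|->] := ltngtP x x' => /=; last by rewrite ltn_add2l.
  by apply/idP; nia.
by apply/negP => k; nia.
Qed.

Lemma lex_eq (B x y x' y' : nat) : y < B -> y' < B ->
  (x * B + y == x' * B + y') = (x == x') && (y == y').
Proof.
move=> h h'; have [lt|gt|->] := ltngtP x x' => /=; last by rewrite eqn_add2l.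
  by apply/negP => /eqP k; nia.
by apply/negP => /eqP k; nia.
Qed.

Lemma dbl_rules (a b : nat) : ((a.*2 < b.*2) = (a < b)) * ((a.*2 == b.*2) = (a == b)) *
 ((a.*2.+1 < b.*2.+1) = (a < b)) * ((a.*2.+1 == b.*2.+1) = (a == b)) *
 ((a.*2 < b.*2.+1) = (a <= b)) * ((a.*2 == b.*2.+1) = false) * ((a.*2.+1 < b.*2) = (a < b)) *
  ((a.*2.+1 == b.*2) = false).
Proof. by do ! split; lia. Qed.
(** Chords sharing an end do meet, so ties must be broken towards overlap: at one point left ends
    (even) precede right ends (odd), ends of one kind are sorted by the other end of their chord,
    and equal chords by index. *)
Lemma lexover (a b c d x y : nat) : x != y -> a < b -> c < d ->
  [|| a == c, a == d, b == c, b == d |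
     ((a < c) (+) (b < c)) (+) ((a < d) (+) (b < d))] =
 [&& ((a.*2 < c.*2) || (a.*2 == c.*2) && (b < d)) || ((a.*2 == c.*2) && (b == d)) && (x < y),
   ((c.*2 < b.*2.+1) || (c.*2 == b.*2.+1) && (d < a)) || ((c.*2 == b.*2.+1) && (d == a)) && (y < x)
   & ((b.*2.+1 < d.*2.+1) || (b.*2.+1 == d.*2.+1) && (a < c)) || ((b.*2.+1 == d.*2.+1) && (a == c)) && (x < y)] 
 || [&& ((c.*2 < a.*2) || (c.*2 == a.*2) && (d < b)) || ((c.*2 == a.*2) && (d == b)) && (y < x),
   ((a.*2 < d.*2.+1) || (a.*2 == d.*2.+1) && (b < c)) || ((a.*2 == d.*2.+1) && (b == c)) && (x < y)
   & ((d.*2.+1 < b.*2.+1) || (d.*2.+1 == b.*2.+1) && (c < a)) || ((d.*2.+1 == b.*2.+1) && (c == a)) && (y < x)].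
Proof.
rewrite !dbl_rules.
by case: (ltngtP a c) => h1 /=; case: (ltngtP b d) => h2 /=; case: (ltngtP x y) => h3 //= _;
  case: (ltngtP b c) => h4 /=; case: (ltngtP a d) => h5 /= => h6 h7; lia.
Qed.

Lemma circle_positions (R : realType) n (e : rel 'I_n) : irreflexive e ->
  circle_graph R e -> exists l r : 'I_n -> nat,
    [/\ forall u, l u < r u, injective l, injective r, forall u v, l u <> r v &
        forall u v, e u v = overlap l r u v].
Proof.
move=> irr [a [b [on H]]].
pose pt (x : 'I_n * bool) := if x.2 then b x.1 else a x.1.
have ptc x : on_unit_circle (pt x) by rewrite /pt; case: (on x.1) => h1 h2 _; case: ifP.
pose lo u := minn (crank pt (u, false)) (crank pt (u, true)).
pose hi u := maxn (crank pt (u, false)) (crank pt (u, true)).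
have ne u : pt (u, false) <> pt (u, true) by case: (on u).
have lohi u : lo u < hi u.
  have : crank pt (u, false) <> crank pt (u, true) by move/(crank_eq ptc)/(ne u).
  by rewrite /lo /hi; lia.
pose B := (n * 2).+1.
have cB x : crank pt x < B.
  by rewrite ltnS /B; apply: leq_trans (max_card _) _; rewrite card_prod card_ord card_bool.
have loB u : lo u < B by rewrite /lo; have := cB (u, false); lia.
have hiB u : hi u < B by rewrite /hi; have := cB (u, false); have := cB (u, true); lia.
have iB (u : 'I_n) : u < B by rewrite /B; have := ltn_ord u; lia.
(* Digits in base [B]: the position doubled, with parity telling left from right; then the opposite
   end; then the index. *)
pose l u := ((lo u).*2 * B + hi u) * B + u.
pose r u := ((hi u).*2.+1 * B + lo u) * B + u.
exists l, r.
have lexE := (lex_lt, lex_eq).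
have lr u : l u < r u.
  by have := lohi u; rewrite /l /r !lexE //; lia.
have key u v : e u v = (u != v) && [|| lo u == lo v, lo u == hi v, hi u == lo v, hi u == hi v |
     ((lo u < lo v) (+) (hi u < lo v)) (+) ((lo u < hi v) (+) (hi u < hi v))].
  have [->|/eqP uv] := eqVneq u v; first by rewrite irr.
  have [_ K] := (H u v uv); move: K (H u v uv) => _ K.
  have M := meetP ptc (ne u) (ne v).
  have -> : e u v = [|| crank pt (u, false) == crank pt (v, false),
    crank pt (u, false) == crank pt (v, true), crank pt (u, true) == crank pt (v, false),
    crank pt (u, true) == crank pt (v, true) |
    inside pt (u, false) (u, true) (v, false) (+) inside pt (u, false) (u, true) (v, true)].
    by apply/idP/idP => [/K/M|/M/K].
  have := lohi u; have := lohi v; rewrite /inside /lo /hi /=.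
  by lia.
split=> //.
- move=> u v /eqP; rewrite /l !lexE // => /andP[_ /eqP]; exact: val_inj.
- move=> u v /eqP; rewrite /r !lexE // => /andP[_ /eqP]; exact: val_inj.
- by move=> u v /eqP; rewrite /l /r !lexE //; lia.
move=> u v; rewrite key; have [->|uv] := eqVneq u v.
  by rewrite /overlap !ltnn.
rewrite /overlap /l /r !lexE //=; apply: lexover; [exact: uv|exact: lohi|exact: lohi].
Qed.

(** * The orders hidden in a chord diagram *)

Section Hidden.
Variables (T : finType) (e : rel T) (I : pred T) (l r : T -> nat).
Hypothesis lr : forall u, l u < r u.
Hypothesis linj : injective l.
Hypothesis rinj : injective r.
Hypothesis l_r : forall u v, l u <> r v.
Hypothesis eE : forall u v, e u v = overlap l r u v.
Hypothesis indep : forall i j, I i -> I j -> ~~ e i j.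

(** Chord [i] splits the circle into the arc inside its interval and an outer arc; [inend] is the
    end on the former. [outkey] unrolls the outer arc starting from [r i], so ends left of [l i] are
    shifted beyond all right ends. *)
Definition inend i u := if l i < l u then l u else r u.
Definition outkey i u := if l i < l u then r u else l u + (\max_v r v).+1.
Definition horder i u v := varrow e I i u v && (inend i u < inend i v).

Lemma NE i u : e i u -> (l i < l u /\ l u < r i /\ r i < r u) \/ (l u < l i /\ l i < r u /\ r u < r i).
Proof. by rewrite eE /overlap; lia. Qed.

Lemma esym_e : symmetric e.
Proof. by move=> u v; rewrite !eE /overlap orbC. Qed.

Lemma rmax u : r u < (\max_v r v).+1.
Proof. by rewrite ltnS; apply: leq_bigmax. Qed.

Lemma neqE u v : u <> v -> [/\ l u <> l v & r u <> r v].
Proof. by move=> uv; split=> /=; [move/linj|move/rinj]. Qed.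

Lemma endP i u : e i u ->
  [/\ l i < l u, l u < r i, r i < r u, inend i u = l u & outkey i u = r u] \/
  [/\ l u < l i, l i < r u, r u < r i, inend i u = r u & outkey i u = l u + (\max_v r v).+1].
Proof.
rewrite /inend /outkey => /NE [[a1 [a2 a3]]|[a1 [a2 a3]]]; first by left; rewrite a1.
have E : (l i < l u) = false by lia.
by right; rewrite E.
Qed.

(** The neighbours of [i] form a permutation diagram between the two arcs of [i]. *)
Lemma outkey_adj i u v : varrow e I i u v ->
  e u v = ((inend i u < inend i v) == (outkey i u < outkey i v)).
Proof.
case/and4P=> _ /endP hu /endP hv /eqP/neqE[n1 n2].
have := rmax u; have := rmax v; rewrite eE /overlap.
have h1 := lr u; have h2 := lr v; have h3 := @l_r u v; have h4 := @l_r v u.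
by case: hu => [[a1 a2 a3 -> ->]|[a1 a2 a3 -> ->]]; case: hv => [[b1 b2 b3 -> ->]|[b1 b2 b3 -> ->]]; lia.
Qed.

Lemma outkey_inj i u v : varrow e I i u v -> outkey i u <> outkey i v.
Proof.
case/and4P=> _ /endP hu /endP hv /eqP/neqE[n1 n2].
have := rmax u; have := rmax v.
by case: hu => [[a1 a2 a3 _ ->]|[a1 a2 a3 _ ->]]; case: hv => [[b1 b2 b3 _ ->]|[b1 b2 b3 _ ->]]; lia.
Qed.

Lemma inend_inj i u v : varrow e I i u v -> inend i u <> inend i v.
Proof.
case/and4P=> _ /endP hu /endP hv /eqP/neqE[n1 n2]; have := @l_r u v; have := @l_r v u.
by case: hu => [[a1 a2 a3 -> _]|[a1 a2 a3 -> _]]; case: hv => [[b1 b2 b3 -> _]|[b1 b2 b3 -> _]]; lia.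
Qed.

Lemma nonadj i j : ~~ e i j -> i <> j ->
  [\/ r i < l j, r j < l i, (l i < l j) && (r j < r i) | (l j < l i) && (r i < r j)].
Proof.
rewrite eE /overlap => h /neqE[n3 n4].
have := lr i; have := lr j; have := @l_r i j; have := @l_r j i => m1 m2 m3 m4.
have [a|a] := ltnP (r i) (l j); first by apply: Or41.
have [b|b] := ltnP (r j) (l i); first by apply: Or42.
have [c|c] := ltnP (l i) (l j); first by apply: Or43; lia.
by apply: Or44; lia.
Qed.

Lemma adjP u v : e u v -> [/\ l u < l v, l v < r u & r u < r v] \/ [/\ l v < l u, l u < r v & r v < r u].
Proof. by rewrite eE /overlap => /orP[/and3P[]|/and3P[]]; [left|right]. Qed.

(** Two crossing chords can be met in opposite orders only by chords that cross each other, and [I]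
    is independent. *)
Lemma horder_L i j u v : varrow e I i u v -> varrow e I j u v -> e u v ->
  (inend i u < inend i v) = (inend j u < inend j v).
Proof.
case/and4P=> Ii /endP hiu /endP hiv /eqP/neqE[n1 n2]; case/and4P=> Ij /endP hju /endP hjv _.
case: (eqVneq i j) => [->//|/eqP ij] uv.
have := nonadj (indep Ii Ij) ij; have lri := lr i; have lrj := lr j => nij.
case: hiu => [[a1 a2 a3 -> _]|[a1 a2 a3 -> _]]; case: hiv => [[b1 b2 b3 -> _]|[b1 b2 b3 -> _]];
  case: hju => [[c1 c2 c3 -> _]|[c1 c2 c3 -> _]]; case: hjv => [[d1 d2 d3 -> _]|[d1 d2 d3 -> _]];
  case: (adjP uv) => [[p1 p2 p3]|[p1 p2 p3]]; case: nij => nij; lia.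
Qed.

Lemma same_side (a b x y z : nat) : a < y < b -> a < z < b -> (x <= a) || (b <= x) ->
  (x < y) = (x < z).
Proof. by move=> /andP[? ?] /andP[? ?] /orP[?|?]; apply/idP/idP; lia. Qed.

(** On one of the two arcs of [i] the ends of [y] and [z] lie in the part cut off by [j], where [x]
    has no end, so they are on the same side of [x] there. Since [x] meets both, the orders on the
    two arcs agree on these pairs. *)
Lemma horder_R i j x y z : varrow e I i x y -> varrow e I i x z -> I j ->
  e j y -> e j z -> ~~ e j x -> e x y -> e x z ->
  (inend i x < inend i y) = (inend i x < inend i z).
Proof.
move=> vxy vxz Ij jy jz jx xy xz.
case/and4P: (vxy) => Ii ix iy _; case/and4P: (vxz) => _ _ iz _.
have ij : i <> j by move=> E; rewrite -E ix in jx.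
have nij := nonadj (indep Ii Ij) ij; have lri := lr i; have lrj := lr j.
have lrx := lr x.
have jnx : j <> x by move=> E; move: (indep Ii Ij); rewrite E ix.
have njx := nonadj jx jnx; have := xz; have := xy.
rewrite (outkey_adj vxy) (outkey_adj vxz).
suff : (inend i x < inend i y) = (inend i x < inend i z) \/
       (outkey i x < outkey i y) = (outkey i x < outkey i z).
  by case=> -> // /eqP -> /eqP ->.
have rM := rmax x; have rMj := rmax j.
case: nij => [nij|nij|/andP[n1 n2]|/andP[n1 n2]].
- right; apply: (@same_side (l j) (r j)).
  + by clear -nij iy jy lri lrj lr linj rinj l_r eE; case: (endP iy) => -[? ? ? _ ->]; case: (NE jy) => -[? []]; lia.
  + by clear -nij iz jz lri lrj lr linj rinj l_r eE; case: (endP iz) => -[? ? ? _ ->]; case: (NE jz) => -[? []]; lia.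
  + by clear -nij njx ix lri lrj lrx rM rMj linj rinj l_r eE; case: (endP ix) => -[? ? ? _ ->]; case: njx; lia.
- right; apply: (@same_side (l j + (\max_v r v).+1) (r j + (\max_v r v).+1)).
  + by clear -nij iy jy lri lrj lr linj rinj l_r eE; case: (endP iy) => -[? ? ? _ ->]; case: (NE jy) => -[? []]; lia.
  + by clear -nij iz jz lri lrj lr linj rinj l_r eE; case: (endP iz) => -[? ? ? _ ->]; case: (NE jz) => -[? []]; lia.
  + by clear -nij njx ix lri lrj lrx rM rMj linj rinj l_r eE; case: (endP ix) => -[? ? ? _ ->]; case: njx; lia.
- left; apply: (@same_side (l j) (r j)).
  + by clear -n1 n2 iy jy lri lrj lr linj rinj l_r eE; case: (endP iy) => -[? ? ? -> _]; case: (NE jy) => -[? []]; lia.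
  + by clear -n1 n2 iz jz lri lrj lr linj rinj l_r eE; case: (endP iz) => -[? ? ? -> _]; case: (NE jz) => -[? []]; lia.
  + by clear -n1 n2 njx ix lri lrj lrx rM rMj linj rinj l_r eE; case: (endP ix) => -[? ? ? -> _]; case: njx; lia.
- right; have rMy := rmax y; have rMz := rmax z; apply: (@same_side (r j) (l j + (\max_v r v).+1)).
  + by clear -n1 n2 iy jy lri lrj lr rMy rMj linj rinj l_r eE; case: (endP iy) => -[? ? ? _ ->]; case: (NE jy) => -[? []]; lia.
  + by clear -n1 n2 iz jz lri lrj lr rMz rMj linj rinj l_r eE; case: (endP iz) => -[? ? ? _ ->]; case: (NE jz) => -[? []]; lia.
  + by clear -n1 n2 njx ix lri lrj lrx rM rMj linj rinj l_r eE; case: (endP ix) => -[? ? ? _ ->]; case: njx; lia.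
Qed.

Lemma horder_trans i u v w : horder i u v -> horder i v w -> horder i u w.
Proof.
move=> /andP[/and4P[Ii iu iv _] h1] /andP[/and4P[_ _ iw _] h2].
have h := ltn_trans h1 h2; rewrite /horder h andbT /varrow Ii iu iw /=.
by apply/eqP => E; rewrite E ltnn in h.
Qed.

Lemma horder_total i u v : varrow e I i u v -> ~~ horder i u v -> horder i v u.
Proof.
move=> h; rewrite /horder h /= varrowC h /= -leqNgt leq_eqVlt => /orP[/eqP E|//].
by case: (inend_inj h).
Qed.

Lemma horder_irr i u : ~~ horder i u u.
Proof. by rewrite /horder ltnn andbF. Qed.

Lemma horder_asym i u v : horder i u v -> ~~ horder i v u.
Proof. by move=> h; apply/negP => /(horder_trans h); apply/negP/horder_irr. Qed.

(** For the first clause: if [u] were between [v] and [w], equal adjacency of [uv] and [uw] would by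
    [outkey_adj] pass on to [vw]. *)
Lemma horder_vforce i u v w : vforce e I i u v w ->
  (inend i u < inend i v) = (inend i u < inend i w).
Proof.
case=> vuv vuw /eqP vw [[E N]|[j [[Ij jv jw ju] [uv uw]]]]; last exact: horder_R jv jw ju uv uw.
have vvw : varrow e I i v w.
  by move: vuv vuw; rewrite /varrow vw => /and4P[-> _ -> _] /and4P[_ _ -> _].
move: E N; rewrite (outkey_adj vuv) (outkey_adj vuw) (outkey_adj vvw).
have := inend_inj vuv; have := inend_inj vuw; have := inend_inj vvw.
have := outkey_inj vuv; have := outkey_inj vuw; have := outkey_inj vvw.
move: (inend i u) (inend i v) (inend i w) (outkey i u) (outkey i v) (outkey i w) => a b c f g k.
by case: (ltngtP a b) => h1 //; case: (ltngtP a c) => h2 //; case: (ltngtP b c) => h3 //;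
  case: (ltngtP f g) => h4 //; case: (ltngtP f k) => h5 //; case: (ltngtP g k) => h6 //; lia.
Qed.

Lemma horder_closed : aclosed e I (fun i u v => horder i u v).
Proof.
move=> i u v j x y st; have [v1 v2] := step_v st; case: st v1 v2 => {i u v j x y}.
- move=> i j u v h1 h2 h3 v1 v2; rewrite /horder v1 v2 /=.
  by rewrite (horder_L h1 h2 h3).
- by move=> i u v w h v1 v2; rewrite /horder v1 v2 /= (horder_vforce h).
- move=> i u v w h v1 v2; apply: contraLR => N.
  have := horder_total v2 N; rewrite /horder => /andP[_].
  rewrite -(horder_vforce h) => k.
  by apply: horder_asym; rewrite /horder k varrowC v1.
Qed.

(** The order of the diagram is closed and asymmetric, so it separates each class from its
    reversal. *)
Lemma horder_noinv i u v : varrow e I i u v -> ~ eqv e I i u v i v u.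
Proof.
move=> va E; have [h|/(horder_total va) h] := boolP (horder i u v).
  by have := aclosed_eqv horder_closed E h; apply/negP/horder_asym.
by have := aclosed_eqv horder_closed (eqv_rev esym_e E) h; apply/negP/horder_asym.
Qed.

(** Two disjoint chords leave two arcs between them; this is the one from [i] to [j]. The branches
    are: [i] left of [j], [i] inside [j], [j] inside [i], and [j] left of [i], where the arc passes
    the cut. *)
Definition inarc i j z :=
  if r i < l j then (r i < z) && (z < l j)
  else if (l j < l i) && (r i < r j) then (r i < z) && (z < r j)
  else if (l i < l j) && (r j < r i) then (l i < z) && (z < l j)
  else (r i < z) || (z < l j).

(* The end of [u] between the chords [i] and [j] lies on the arc that leads
   clockwise from [i] to [j]. *)
Definition top i j u := inarc i j (l u) || inarc i j (r u).

(** All positions of [u] with explicit inequalities, so that the lemmas on arcs become case analyses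
    closed by [lia]. *)
Variant top_spec i j u : bool -> Prop :=
| Top1 of r i < l j & l i < l u & l u < r i & r i < r u & r u < l j : top_spec i j u true
| Top2 of r i < l j & l i < l u & l u < r i & r i < r j & r j < r u : top_spec i j u false
| Top3 of r i < l j & l u < l i & l i < r u & r u < r i : top_spec i j u false
| Top4 of r j < l i & l i < l u & l u < r i & r i < r u : top_spec i j u true
| Top5 of r j < l i & l u < l j & l i < r u & r u < r i : top_spec i j u true
| Top6 of r j < l i & r j < l u & l u < l i & l i < r u & r u < r i : top_spec i j u false
| Top7 of l i < l j & r j < r i & l i < l u & l u < l j & r i < r u : top_spec i j u true
| Top8 of l i < l j & r j < r i & r j < l u & l u < r i & r i < r u : top_spec i j u false
| Top9 of l i < l j & r j < r i & l u < l i & l i < r u & r u < l j : top_spec i j u true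
| Top10 of l i < l j & r j < r i & l u < l i & r j < r u & r u < r i : top_spec i j u false
| Top11 of l j < l i & r i < r j & l i < l u & l u < r i & r i < r u & r u < r j : top_spec i j u true
| Top12 of l j < l i & r i < r j & l j < l u & l u < l i & l i < r u & r u < r i : top_spec i j u false.

Lemma topP i j u : I i -> I j -> i <> j -> e i u -> ~~ e j u -> top_spec i j u (top i j u).
Proof.
move=> Ii Ij ij iu ju.
have nij := nonadj (indep Ii Ij) ij; have lri := lr i; have lrj := lr j; have lru := lr u.
have jnu : j <> u by move=> E; move: (indep Ii Ij); rewrite E iu.
have nju := nonadj ju jnu.
rewrite /top /inarc.
case: nij => [nij|nij|/andP[n1 n2]|/andP[n1 n2]].
- rewrite nij; case: (NE iu) => [[a1 [a2 a3]]|[a1 [a2 a3]]].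
    have [c|c] := ltnP (r u) (l j).
      have -> : (r i < l u) && (l u < l j) || (r i < r u) && true by lia.
      exact: Top1.
    have -> : (r i < l u) && (l u < l j) || (r i < r u) && false = false by lia.
    by apply: Top2 => //; case: nju; lia.
  have -> : (r i < l u) && (l u < l j) || (r i < r u) && (r u < l j) = false by lia.
  exact: Top3.
- have -> : (r i < l j) = false by lia.
  have -> : (l j < l i) && (r i < r j) = false by lia.
  have -> : (l i < l j) && (r j < r i) = false by lia.
  case: (NE iu) => [[a1 [a2 a3]]|[a1 [a2 a3]]].
    have -> : [|| (r i < l u) || (l u < l j), r i < r u | r u < l j] by lia.
    exact: Top4.
  have [c|c] := ltnP (l u) (l j).
    by rewrite !orbT; apply: Top5.
  have -> : [|| (r i < l u) || false, r i < r u | r u < l j] = false by lia.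
  by apply: Top6 => //; case: nju; lia.
- have -> : (r i < l j) = false by lia.
  have -> : (l j < l i) && (r i < r j) = false by lia.
  rewrite n1 n2 /=; case: (NE iu) => [[a1 [a2 a3]]|[a1 [a2 a3]]].
    have [c|c] := ltnP (l u) (l j).
      by rewrite a1; apply: Top7.
    have -> : (l i < l u) && false || (l i < r u) && (r u < l j) = false by lia.
    by apply: Top8 => //; case: nju; lia.
  have [c|c] := ltnP (r u) (l j).
    by rewrite a2 orbT; apply: Top9.
  have -> : (l i < l u) && (l u < l j) || (l i < r u) && false = false by lia.
  by apply: Top10 => //; case: nju; lia.
- have -> : (r i < l j) = false by lia.
  rewrite n1 n2 /=; case: (NE iu) => [[a1 [a2 a3]]|[a1 [a2 a3]]].
    have c : r u < r j by case: nju; lia.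
    by rewrite a3 c orbT; apply: Top11.
  have -> : (r i < l u) && (l u < r j) || (r i < r u) && (r u < r j) = false by lia.
  by apply: Top12 => //; case: nju; lia.
Qed.

(** Both chords have an end on one of the two arcs between [i] and [j] and can only cross if they
    share it; [top i j] and [top j i] name opposite arcs. *)
Lemma top_adj i j u w : I i -> I j -> i <> j ->
  e i u -> ~~ e j u -> e j w -> ~~ e i w -> e u w -> top i j u = ~~ top j i w.
Proof.
move=> Ii Ij ij iu ju jw iw /adjP uw.
have lri := lr i; have lrj := lr j.
have Su := topP Ii Ij ij iu ju; have Sw := topP Ij Ii (nesym ij) jw iw.
clear -lri lrj uw Su Sw.
by case: Su => *; case: Sw => * //; exfalso; case: uw => -[*]; lia.
Qed.

(** A chord from [i] meets [w] iff it ends farther from [i] on their common arc. So [u] ends beyond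
    [v], and as [u] and [v] cross, this also orders their ends on the other arc of [i]. *)
Lemma top_order i j u v w : I i -> I j -> i <> j ->
  e i u -> ~~ e j u -> e i v -> ~~ e j v -> e j w -> ~~ e i w ->
  e u v -> e u w -> ~~ e v w -> top i j u = top i j v ->
  if top i j u then inend i v < inend i u else inend i u < inend i v.
Proof.
move=> Ii Ij ij iu ju iv jv jw iw /adjP uv uw vw E.
have Ew := top_adj Ii Ij ij iu ju jw iw uw.
have lri := lr i; have lrj := lr j; have luv := @l_r u v; have lvu := @l_r v u.
have Su := topP Ii Ij ij iu ju; have Sv := topP Ii Ij ij iv jv.
have Sw := topP Ij Ii (nesym ij) jw iw; move/adjP: uw => uw.
have nvw : v <> w by move=> E0; rewrite E0 jw in jv.
have nw := nonadj vw nvw; have Eu := endP iu; have Ev := endP iv.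
move: Su Sv Sw E Ew; clear -lri lrj luv lvu uv uw nw Eu Ev.
move: (top i j u) (top i j v) (top j i w) => tu tv tw Su Sv Sw E Ew.
destruct Su; destruct Sv; try discriminate E; (try by exfalso; lia);
  destruct Sw; try discriminate Ew; (try by exfalso; lia);
  case: Eu => -[? ? ? -> _]; (try by exfalso; lia); case: Ev => -[? ? ? -> _];
  (try by exfalso; lia); case: uv => -[*]; (try by exfalso; lia);
  case: uw => -[*]; (try by exfalso; lia); case: nw => *; lia.
Qed.

(** Along one arc adjacency only compares end points, so two disjoint edges cannot be induced. *)
Lemma top_chain i j u v w x : I i -> I j -> i <> j ->
  e i u -> ~~ e j u -> e i v -> ~~ e j v ->
  e j w -> ~~ e i w -> e j x -> ~~ e i x ->
  e u w -> e v x -> top i j u = top i j v -> e u x || e v w.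
Proof.
move=> Ii Ij ij iu ju iv jv jw iw jx ix uw vx E.
apply/negPn/negP; rewrite negb_or => /andP[ux vw].
have Ew := top_adj Ii Ij ij iu ju jw iw uw.
have Ex := top_adj Ii Ij ij iv jv jx ix vx.
have lri := lr i; have lrj := lr j.
have Su := topP Ii Ij ij iu ju; have Sv := topP Ii Ij ij iv jv.
have Sw := topP Ij Ii (nesym ij) jw iw; have Sx := topP Ij Ii (nesym ij) jx ix.
move/adjP: uw => uw; move/adjP: vx => vx.
have nvw : v <> w by move=> E0; rewrite E0 jw in jv.
have nux : u <> x by move=> E0; rewrite E0 jx in ju.
have nw := nonadj vw nvw; have nx := nonadj ux nux.
move: Su Sv Sw Sx E Ew Ex; clear -lri lrj uw vx nw nx.
move: (top i j u) (top i j v) (top j i w) (top j i x) => tu tv tw tx Su Sv Sw Sx E Ew Ex.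
destruct Su; destruct Sv; try discriminate E; (try by exfalso; lia);
  destruct Sw; try discriminate Ew; (try by exfalso; lia);
  destruct Sx; try discriminate Ex; (try by exfalso; lia);
  case: uw => -[? ? ?]; (try by exfalso; lia); case: vx => -[? ? ?]; (try by exfalso; lia);
  case: nw => *; (try by exfalso; lia); case: nx => *; lia.
Qed.
End Hidden.

(** * Sorts and orientations *)

Section Cert.
Variable n : nat.
Local Notation V := 'I_n.+1.
Variables (e : rel V) (I : pred V).

Definition priv (i j u : V) : bool := [&& I i, I j, e i u & ~~ e j u].
(** Only vertices with a private neighbour of [j] next to them reveal through adjacency on which arc
    they end. *)
Definition ntriv (i j u : V) : bool := priv i j u && [exists w, priv j i w && e u w].
Definition fstnt (i j v : V) : bool := ntriv i j v && [forall x : V, (x < v) ==> ~~ ntriv i j x].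
Definition samelab (i j u : V) : bool :=
  [exists v, fstnt i j v && [exists w, [&& priv j i w, e u w & e v w]]].
(** Choices are made canonical by taking least vertices, so that they can be expressed by
    formulas. *)
Definition own (u i : V) : bool := [&& I i, e i u & [forall k : V, (k < i) ==> ~~ (I k && e k u)]].
Definition common (u w c : V) : bool := [&& I c, e c u & e c w].
Definition fstcommon (u w c : V) : bool := common u w c && [forall k : V, (k < c) ==> ~~ common u w k].
Definition samesig (x y : V) : bool := [forall i, I i ==> (e i x == e i y)].

(* The adjacency between [N(i) \ N(j)] and [N(j) \ N(i)] consists of two disjoint
   bipartite chains; [samelab] says which of them are met by the first nontrivial
   vertex, and the guess [G i j] names that one. *)
Variable G : V -> V -> bool.
Definition side (i j u : V) : bool := ntriv i j u && ~~ (samelab i j u == G i j).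

(** The conclusion of [top_order], with arcs replaced by the sides computed from the guess. *)
Definition forced (i x y : V) : bool :=
  [exists j, [&& ntriv i j x, ntriv i j y, e x y, side i j x == side i j y &
    [exists w, [&& priv j i w, side i j x ==> (e y w && ~~ e x w) &
                 ~~ side i j x ==> (e x w && ~~ e y w)]]]].

Variable D : V -> V -> V -> bool.
(** Intended as a strict partial order; its chains are then independent sets. *)
Definition par (x y : V) : bool :=
  [&& ~~ I x, ~~ I y, x != y, ~~ e x y, samesig x y & [exists i, own x i && D i x y]].
(* Vertices of [I] form singleton sorts and come first. *)
Definition orient (u w : V) : bool :=
  e u w && (I u || [&& ~~ I u, ~~ I w &
    [exists c, fstcommon u w c && D c u w] ||
    (~~ [exists c, common u w c] && [exists i, exists j, [&& own u i, own w j & ~~ side i j u]])]).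

(* [high t x]: some chain of [par] below [x] has more than [t] elements. *)
Fixpoint high (t : nat) (x : V) : bool :=
  [exists y, par y x && (if t is t'.+1 then high t' y else true)].

(** A sort is given by the neighbours in [I], the behaviour towards every [j] in [I], and the
    height. Equal heights exclude comparability by [par], which is to make a sort a clique. *)
Definition same (x y : V) : bool :=
  (x == y) || [&& ~~ I x, ~~ I y, samesig x y,
    [forall i, forall j, own x i && I j ==> (ntriv i j x == ntriv i j y) && (side i j x == side i j y)] &
    [forall t : V, high t x == high t y]].

Definition sle (x y : V) : bool := same x y && ((x == y) || orient x y).

(** What quantifier elimination relies on, tested on the outcome: [orient] orients every edge, sorts
    are cliques, [orient] is monotone. Transitivity of [par] is tested too because it bounds the
    heights, hence the number of sorts. *)
Definition cert_ok : bool :=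
  [&& [forall u, forall w, e u w == orient u w || orient w u],
      [forall x, forall y, same x y && (x != y) ==> e x y],
      [forall u, forall w, forall u', forall w',
        [&& sle u' u, sle w w' & orient u w] ==> orient u' w'] &
      [forall x, forall y, forall z, par x y && par y z ==> par x z]].

Hypothesis e_sym : symmetric e.
Hypothesis e_irr : irreflexive e.
Hypothesis I_indep : forall i j, I i -> I j -> ~~ e i j.
Hypothesis I_max : forall u, I u \/ exists2 i, I i & e i u.

Lemma samesigP x y : reflect (forall i, I i -> e i x = e i y) (samesig x y).
Proof.
apply: (iffP forallP) => h i; first by move=> hi; have := h i; rewrite hi => /eqP.
by apply/implyP => /h ->.
Qed.

Lemma first_ex (P : pred V) x : P x -> exists2 y, P y & forall z : V, z < y -> ~~ P z.
Proof.
move=> hx; case: (arg_minnP (fun y : V => y : nat) hx) => y hy h; exists y => // z.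
by apply: contraTN => /h; rewrite leqNgt.
Qed.

Lemma first_uniq (P : pred V) x y : P x -> (forall z : V, z < x -> ~~ P z) ->
  P y -> (forall z : V, z < y -> ~~ P z) -> x = y.
Proof.
move=> hx mx hy my; apply/val_inj => /=.
by case: (ltngtP x y) => // h; [have := my _ h; rewrite hx|have := mx _ h; rewrite hy].
Qed.

Lemma ownP u i : reflect [/\ I i, e i u & forall k : V, k < i -> ~~ (I k && e k u)] (own u i).
Proof.
apply: (iffP and3P) => -[h1 h2 h3]; split=> //; first by move=> k hk; have := forallP h3 k; rewrite hk.
by apply/forallP => k; apply/implyP; apply: h3.
Qed.

Lemma own_ex u : ~~ I u -> exists i, own u i.
Proof.
case: (I_max u) => [->//|[i hi hu]] _.
have [j /andP[h1 h2] h3] := first_ex (P := fun i => I i && e i u) (introT andP (conj hi hu)).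
by exists j; apply/ownP.
Qed.

Lemma own_uniq u i j : own u i -> own u j -> i = j.
Proof.
move=> /ownP[a b c] /ownP[a' b' c']; apply: (@first_uniq (fun i => I i && e i u)) => //; exact/andP.
Qed.

Lemma own_same x y i : samesig x y -> own x i -> own y i.
Proof.
move=> /samesigP h /ownP[a b c]; apply/ownP; split=> //; first by rewrite -h.
by move=> k /c; case E : (I k) => //=; rewrite h.
Qed.

Lemma samesig_sym x y : samesig x y -> samesig y x.
Proof. by move=> /samesigP h; apply/samesigP => i /h. Qed.

Lemma samesig_trans x y z : samesig x y -> samesig y z -> samesig x z.
Proof. by move=> /samesigP h /samesigP k; apply/samesigP => i hi; rewrite h ?k. Qed.

Lemma sameP x y : same x y -> x <> y -> [/\ ~~ I x, ~~ I y, samesig x y &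
  (forall i j, own x i -> I j -> ntriv i j x = ntriv i j y /\ side i j x = side i j y) /\
  forall t : V, high t x = high t y].
Proof.
move=> /orP[/eqP //|/and5P[h1 h2 h3 /forallP h4 /forallP h5] _]; split=> //; split=> [i j hi hj|t].
  by have /forallP/(_ j) := h4 i; rewrite hi hj => /andP[/eqP -> /eqP ->].
exact/eqP.
Qed.

Lemma same_refl x : same x x. Proof. by rewrite /same eqxx. Qed.

Lemma same_sym x y : same x y -> same y x.
Proof.
have [->//|/eqP ne h] := eqVneq x y.
have [h1 h2 h3 [h4 h5]] := sameP h ne.
apply/orP; right; apply/and5P; split=> //; first exact: samesig_sym.
  apply/forallP => i; apply/forallP => j; apply/implyP => /andP[hi hj].
  by have [-> ->] := h4 i j (own_same (samesig_sym h3) hi) hj; rewrite !eqxx.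
by apply/forallP => t; rewrite h5.
Qed.

Lemma same_trans x y z : same x y -> same y z -> same x z.
Proof.
have [->//|/eqP ne h] := eqVneq x y.
have [<-//|/eqP ne' h'] := eqVneq y z.
have [h1 h2 h3 [h4 h5]] := sameP h ne; have [k1 k2 k3 [k4 k5]] := sameP h' ne'.
apply/orP; right; apply/and5P; split=> //; first exact: samesig_trans k3.
  apply/forallP => i; apply/forallP => j; apply/implyP => /andP[hi hj].
  have [-> ->] := h4 i j hi hj.
  by have [-> ->] := k4 i j (own_same h3 hi) hj; rewrite !eqxx.
by apply/forallP => t; rewrite h5 k5.
Qed.

Lemma parP x y : reflect [/\ ~~ I x /\ ~~ I y, x <> y, ~~ e x y, samesig x y & exists2 i, own x i & D i x y]
  (par x y).
Proof.
apply: (iffP and5P) => [[h1 h2 /eqP h3 h4 /andP[h5 /existsP[i /andP[h6 h7]]]]|[[h1 h2] /eqP h3 h4 h5 [i h6 h7]]].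
  by split=> //; exists i.
by split=> //; rewrite h5; apply/existsP; exists i; rewrite h6.
Qed.

Section Chains.
Hypothesis par_trans : transitive par.

Lemma par_irr : irreflexive par.
Proof. by move=> x; apply/negP => /parP[_ /(_ erefl)]. Qed.

Lemma high_chain t x : high t x -> exists s, [/\ size s = t.+2, last x s = x, s != [::] & sorted par s].
Proof.
elim: t x => [|t IH] x /= /existsP[y /andP[yx h]].
  by exists [:: y; x]; split=> //=; rewrite yx.
have [[|z s] [h1 h2 h3 h4]] := IH y h; first by [].
exists (rcons (z :: s) x); split=> //; first by rewrite size_rcons h1.
  by rewrite last_rcons.
by move: h4 h2 => /=; rewrite rcons_path => -> /= ->.
Qed.

(** A chain of [par] is an independent set, and height [t] means a chain of [t + 2] vertices. *)
Lemma high_bound t x : high t x -> t.+2 <= independence_number e.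
Proof.
move=> /high_chain[s [h1 _ _ h4]].
have us : uniq s by apply: sorted_uniq h4; [exact: par_trans|exact: par_irr].
have -> : t.+2 = #|[set y in s]| by rewrite cardsE (card_uniqP us).
rewrite /independence_number; apply: (@leq_bigmax_cond _ (independent e) (fun S : {set V} => #|S|)).
apply/forallP => u; apply/implyP; rewrite inE => hu; apply/forallP => v; apply/implyP; rewrite inE => hv.
move: h4; rewrite (sorted_pairwise par_trans) => /(pairwiseP u) h4.
move: hu hv => /(nthP u)[a ha <-] /(nthP u)[b hb <-].
case: (ltngtP a b) => hab; last by rewrite hab e_irr.
  by have /parP[] := h4 _ _ ha hb hab.
by rewrite e_sym; have /parP[] := h4 _ _ hb ha hab.
Qed.
End Chains.

End Cert.

(** * A chord diagram with a matching guess passes the check *)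

Section Pass.
Variable n : nat.
Local Notation V := 'I_n.+1.
Variables (e : rel V) (I : pred V) (l r : V -> nat) (G : V -> V -> bool).
Hypothesis lr : forall u, l u < r u.
Hypothesis linj : injective l.
Hypothesis rinj : injective r.
Hypothesis l_r : forall u v, l u <> r v.
Hypothesis eE : forall u v, e u v = overlap l r u v.
Hypothesis I_indep : forall i j, I i -> I j -> ~~ e i j.
Hypothesis I_max : forall u, I u \/ exists2 i, I i & e i u.
Hypothesis G_top : forall i j v, fstnt e I i j v -> G i j = ~~ top l r i j v.

Let e_sym : symmetric e := esym_e eE.

Lemma e_irr : irreflexive e.
Proof. by move=> u; rewrite eE /overlap; lia. Qed.

Lemma priv_neq i j u : priv e I i j u -> i <> j.
Proof. by case/and4P => _ _ h1 h2 E; rewrite -E h1 in h2. Qed.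

Lemma ntrivP i j u : reflect (priv e I i j u /\ exists2 w, priv e I j i w & e u w) (ntriv e I i j u).
Proof.
apply: (iffP andP) => -[h].
  by case/existsP => w /andP[h1 h2]; split=> //; exists w.
by case=> w h1 h2; split=> //; apply/existsP; exists w; rewrite h1.
Qed.

Lemma priv_adj i j u w : priv e I i j u -> priv e I j i w -> e u w -> top l r i j u = ~~ top l r j i w.
Proof.
move=> hu hw; have ij := priv_neq hu; case/and4P: hu => *; case/and4P: hw => *.
exact: (@top_adj _ e I l r lr linj rinj l_r eE I_indep i j u w).
Qed.

(** By [top_chain], a chord on the arc of the first nontrivial one shares a neighbour with it; by
    [top_adj], a chord on the other arc does not. [G i j] then tells which arc this is. *)
Lemma side_top i j u : ntriv e I i j u -> side e I G i j u = top l r i j u.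
Proof.
move=> hu; have [v hv mv] := first_ex hu.
have fv : fstnt e I i j v by rewrite /fstnt hv; apply/forallP => x; apply/implyP; apply: mv.
rewrite /side hu (G_top fv) /=.
have -> : samelab e I i j u = (top l r i j u == top l r i j v).
  have /ntrivP[pu [w pw uw]] := hu; have /ntrivP[pv [x px vx]] := hv.
  have ij := priv_neq pu.
  apply/existsP/eqP => [[v' /andP[fv' /existsP[w' /and3P[h1 h2 h3]]]]|E].
    have E : v' = v.
      case/andP: fv' => h4 /forallP h5; apply: (first_uniq h4 _ hv mv) => z hz.
      by have := h5 z; rewrite hz.
    by rewrite (priv_adj pu h1 h2) (priv_adj pv h1) // -E.
  exists v; rewrite fv /=; apply/existsP.
  case/and4P: (pu) => *; case/and4P: (pv) => *; case/and4P: (pw) => *; case/and4P: (px) => *.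
  have /orP[h|h] : e u x || e v w by apply: (@top_chain _ e I l r lr linj rinj l_r eE I_indep i j).
    by exists x; rewrite px h.
  by exists w; rewrite pw uw h.
by case: (top l r i j u); case: (top l r i j v).
Qed.

Lemma forcedP i x y : forced e I G i x y -> exists j w, [/\ ntriv e I i j x, ntriv e I i j y, e x y,
  side e I G i j x = side e I G i j y &
  priv e I j i w /\ if side e I G i j x then e y w && ~~ e x w else e x w && ~~ e y w].
Proof.
case/existsP => j /and5P[h1 h2 h3 /eqP h4 /existsP[w /and3P[h5 h6 h7]]].
by exists j, w; split=> //; split=> //; move: h6 h7; case: side.
Qed.

Lemma forced_horder i x y : forced e I G i x y -> horder e I l r i x y.
Proof.
case/forcedP => j [w [hx hy xy hs [hw h]]].
move: hs h; rewrite !side_top // => hs h.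
case/ntrivP: hx => hx _; case/ntrivP: hy => hy _; have ij := priv_neq hx.
case/and4P: (hx) => Ii Ij ix jx; case/and4P: (hy) => _ _ iy jy; case/and4P: hw => _ _ jw iw.
have ne : x != y by apply: contraTneq xy => ->; rewrite e_irr.
rewrite /horder /varrow Ii ix iy ne /=.
have H := @top_order _ e I l r lr linj rinj l_r eE I_indep i j.
case E : (top l r i j x) h => /andP[h1 h2].
  have := H y x w Ii Ij ij iy jy ix jx jw iw; rewrite (e_sym y x) -hs E => K; exact: (K xy h1 h2 erefl).
by have := H x y w Ii Ij ij ix jx iy jy jw iw; rewrite -hs E => K; exact: (K xy h1 h2 erefl).
Qed.

(** [D] is any total order obeying the closure rules and containing the forced pairs; it may differ
    from [horder]. *)
Variable D : V -> V -> V -> bool.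
Hypothesis D_good : good e I (fun i x y => D i x y).
Hypothesis D_irr : forall i x, ~ D i x x.
Hypothesis D_total : forall i x y, varrow e I i x y -> D i x y \/ D i y x.
Hypothesis D_forced : forall i x y, forced e I G i x y -> D i x y.

Notation par := (par e I D).
Notation orient := (orient e I G D).
Notation same := (same e I G D).

Let Dc i u v j x y : step e I i u v j x y -> D i u v -> D j x y.
Proof. by case: D_good => _ h _; apply: h. Qed.
Let Dt i x y z : D i x y -> D i y z -> D i x z. Proof. by case: D_good => _ _ h; apply: h. Qed.

Lemma D_asym i x y : D i x y -> D i y x -> False.
Proof. by move=> h /(Dt h)/D_irr. Qed.

Lemma D_swap i u v w : varrow e I i u v -> varrow e I i u w -> v <> w -> e u v = e u w -> e u v <> e v w ->
  D i u v -> D i w u -> False.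
Proof.
move=> h1 h2 h3 h4 h5 h6; apply: D_asym; apply: (Dc _ h6); apply: StepF; split=> //.
by left.
Qed.

Lemma D_shift i j x y : varrow e I i x y -> varrow e I j x y -> e x y -> D i x y -> D j x y.
Proof. by move=> h1 h2 h3; apply: Dc; apply: StepL. Qed.

Lemma own_varrow i x y : own e I x i -> samesig e I x y -> x <> y -> varrow e I i x y.
Proof.
move=> /ownP[h1 h2 _] /samesigP h /eqP h3; rewrite /varrow h1 h2 -h ?h2 //.
Qed.

(** If [x] and [z] were adjacent, the non-edges [yx], [yz] around that edge would put [x] and [z] on
    the same side of [y]. *)
Lemma par_trans : transitive par.
Proof.
move=> y x z /parP[[nx ny] xy exy sxy [i oi dxy]] /parP[[_ nz] yz eyz syz [j oj dyz]].
have E : j = i by apply: own_uniq oj (own_same sxy oi).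
rewrite {}E in oj dyz.
have sxz := samesig_trans sxy syz.
have xz : x <> z by move=> E; rewrite -E in dyz; apply: D_asym dxy dyz.
apply/parP; split=> //; last by exists i => //; apply: Dt dxy dyz.
apply/negP => exz; apply: (@D_swap i y z x) dyz dxy.
- exact: own_varrow.
- exact: own_varrow (samesig_sym sxy) (nesym xy).
- exact: nesym.
- by rewrite (negbTE eyz) e_sym (negbTE exy).
- by rewrite (negbTE eyz) e_sym exz.
Qed.

Lemma indep_bound : independence_number e <= n.+1.
Proof.
apply/bigmax_leqP => S _; by rewrite -[X in _ <= X](card_ord n.+1) max_card.
Qed.

(** A nonadjacent pair of one sort would be comparable in [par], and equality of its heights would
    produce chains longer than the number of vertices. *)
Lemma same_adj x y : same x y -> x <> y -> e x y.
Proof.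
move=> hs ne; have [nx ny sxy [hl hh]] := sameP hs ne.
apply/negPn/negP => nxy.
have [i oi] := own_ex I_max nx.
suff [a [b [hab Dab]]] : exists a b, par a b /\ forall t : V, high e I D t a = high e I D t b.
  (* A chain ending in [a] extends to [b], and equal heights bring the longer chain back to [a]. *)
  have H t : t < n.+1 -> high e I D t a.
    elim: t => [|t IH] ht; have := Dab (Ordinal ht) => /= ->; apply/existsP; exists a; rewrite hab //=.
    by apply: IH; apply: ltnW.
  have := high_bound e_sym e_irr par_trans (H n (ltnSn n)); have := indep_bound; lia.
case: (D_total (own_varrow oi sxy ne)) => h.
  by exists x, y; split=> //; apply/parP; split=> //; exists i.
exists y, x; split=> [|t]; last by rewrite hh.
apply/parP; split=> //; [exact: nesym|by rewrite e_sym|exact: samesig_sym|].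
by exists i => //; apply: own_same sxy oi.
Qed.

Lemma orientP u w : reflect (e u w /\ (I u \/ [/\ ~~ I u, ~~ I w &
   (exists2 c, fstcommon e I u w c & D c u w) \/
   ((forall c, ~~ common e I u w c) /\ exists i j, [/\ own e I u i, own e I w j & ~~ side e I G i j u])]))
  (orient u w).
Proof.
apply: (iffP andP) => -[h1 h2]; split=> //.
  case/orP: h2 => [->|/and3P[h2 h3 h4]]; first by left.
  right; split=> //; case/orP: h4 => [/existsP[c /andP[h4 h5]]|/andP[h4 h5]]; first by left; exists c.
  right; split; first by move=> c; apply: contra h4 => h4; apply/existsP; exists c.
  by case/existsP: h5 => i /existsP[j /and3P[h5 h6 h7]]; exists i, j.
case: h2 => [->//|[-> -> h]]; apply/orP; right; apply/orP; case: h => [[c h4 h5]|[h4 [i [j [h5 h6 h7]]]]].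
  by left; apply/existsP; exists c; rewrite h4.
right; apply/andP; split; first by apply/existsP => -[c]; apply/negP.
by apply/existsP; exists i; apply/existsP; exists j; rewrite h5 h6.
Qed.

Lemma fstcommon_ex u w c : common e I u w c -> exists c', fstcommon e I u w c'.
Proof.
move=> h; have [v hv mv] := first_ex h; exists v.
by rewrite /fstcommon hv; apply/forallP => x; apply/implyP; apply: mv.
Qed.

Lemma common_sym u w c : common e I u w c = common e I w u c.
Proof. by rewrite /common; case: (I c); case: (e c u); case: (e c w). Qed.

Lemma fstcommon_sym u w c : fstcommon e I u w c -> fstcommon e I w u c.
Proof.
move=> /andP[h1 h2]; rewrite /fstcommon common_sym h1; apply/forallP => k.
by rewrite common_sym; apply: (forallP h2).
Qed.

Lemma own_priv u w i j : own e I u i -> own e I w j -> (forall c, ~~ common e I u w c) ->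
  priv e I i j u /\ priv e I j i w.
Proof.
move=> /ownP[h1 h2 _] /ownP[h3 h4 _] h; rewrite /priv h1 h2 h3 h4 /=.
have := h i; have := h j; rewrite /common h1 h2 h3 h4 /= andbT.
by move=> -> ->.
Qed.

Lemma adj_neq u w : e u w -> u != w.
Proof. by apply: contraTneq => ->; rewrite e_irr. Qed.

Lemma ntriv_own u w i j : own e I u i -> own e I w j -> (forall c, ~~ common e I u w c) -> e u w ->
  ntriv e I i j u /\ ntriv e I j i w.
Proof.
move=> h1 h2 h3 h4; have [h5 h6] := own_priv h1 h2 h3.
split; apply/ntrivP; split=> //; first by exists w.
by exists u => //; rewrite e_sym.
Qed.

Lemma side_opp u w i j : own e I u i -> own e I w j -> (forall c, ~~ common e I u w c) -> e u w ->
  side e I G i j u = ~~ side e I G j i w.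
Proof.
move=> h1 h2 h3 h4; have [h5 h6] := own_priv h1 h2 h3; have [h7 h8] := ntriv_own h1 h2 h3 h4.
by rewrite !side_top //; apply: priv_adj.
Qed.

Lemma common_varrow u w c : fstcommon e I u w c -> e u w -> varrow e I c u w.
Proof. by move=> /andP[/and3P[h1 h2 h3] _] /adj_neq h4; rewrite /varrow h1 h2 h3 h4. Qed.

Lemma orient_adj u w : e u w = orient u w || orient w u.
Proof.
apply/idP/orP => [h|[/orientP[]//|/orientP[h _]]]; last by rewrite e_sym.
have h' : e w u by rewrite e_sym.
case Iu : (I u); first by left; apply/orientP; split=> //; left.
case Iw : (I w); first by right; apply/orientP; split=> //; left.
have [/existsP[c /fstcommon_ex[c' hc]]|/existsPn nc] := boolP [exists c, common e I u w c].
  case: (D_total (common_varrow hc h)) => hd; [left|right]; apply/orientP; split=> //; right.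
    by rewrite Iu Iw; split=> //; left; exists c'.
  by rewrite Iu Iw; split=> //; left; exists c' => //; apply: fstcommon_sym.
have [i oi] := own_ex I_max (negbT Iu); have [j oj] := own_ex I_max (negbT Iw).
case E : (side e I G i j u).
  right; apply/orientP; split=> //; right; rewrite Iu Iw; split=> //; right.
  split; first by move=> c; rewrite common_sym.
  by exists j, i; split=> //; rewrite (side_opp oj oi) ?E // => c; rewrite common_sym.
left; apply/orientP; split=> //; right; rewrite Iu Iw; split=> //; right.
by split=> //; exists i, j; rewrite E.
Qed.

Lemma same_orient x y c : same x y -> x <> y -> orient x y -> I c -> e c x -> D c x y.
Proof.
move=> hs ne /orientP[exy ho] Ic cx; have [nx ny sxy _] := sameP hs ne.
have va i : I i -> e i x -> varrow e I i x y.
  by move=> Ii ix; rewrite /varrow Ii ix -(samesigP _ _ _ _ sxy) // ix /=; apply/eqP.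
case: ho => [|[_ _ [[d hd dd]|[hn _]]]]; first by rewrite (negbTE nx).
  have /andP[/and3P[Id dx dy] _] := hd.
  by apply: (@D_shift d c) => //; apply: va.
by have /negP[] := hn c; rewrite /common Ic cx -(samesigP _ _ _ _ sxy).
Qed.

Lemma fstcommon_samel u u' w c : samesig e I u u' -> fstcommon e I u w c -> fstcommon e I u' w c.
Proof.
move=> /samesigP h; have hc k : common e I u' w k = common e I u w k.
  by rewrite /common; case E : (I k) => //=; rewrite h.
by rewrite /fstcommon hc => /andP[-> /forallP h2]; apply/forallP => k; rewrite hc.
Qed.

(** If [u'w] is an edge, its direction follows from transitivity of [D] at the common neighbour or
    from equality of sides. If it were not, either [uu'] and [uw] would be edges around a non-edge
    at the common neighbour, or [w] would force the order of [u] and [u'] the other way. *)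
Lemma orient_left u u' w : orient u w -> same u' u -> u' <> u -> orient u' u -> orient u' w.
Proof.
move=> /orientP[uw ho] hs ne uu'; have [nu' nu su [hl _]] := sameP hs ne.
have euu' := same_adj hs ne.
case: ho => [|[_ nw ho]]; first by rewrite (negbTE nu).
have key : e u' w -> orient u' w.
  move=> h; apply/orientP; split=> //; right; split=> //.
  case: ho => [[c hc dc]|[hn [i [j [oi oj hij]]]]].
    left; exists c; first by apply: fstcommon_samel hc; apply: samesig_sym.
    have /andP[/and3P[Ic cu cw] _] := hc.
    by apply: Dt dc; apply: (same_orient hs ne uu') => //; rewrite (samesigP _ _ _ _ su).
  right; split.
    move=> c; have := hn c; rewrite /common; case E : (I c) => //=.
    by rewrite -(samesigP _ _ _ _ su).
  exists i, j; split=> //; first exact: own_same (samesig_sym su) oi.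
  have /ownP[Ij _ _] := oj.
  by have [_ ->] := hl i j (own_same (samesig_sym su) oi) Ij.
apply: key; apply/negPn/negP => nuw.
case: ho => [[c hc dc]|[hn [i [j [oi oj hij]]]]].
  have /andP[/and3P[Ic cu cw] _] := hc.
  have cu' : e c u' by rewrite (samesigP _ _ _ _ su).
  have d : D c u' u by apply: (same_orient hs ne uu').
  have uw' : u' <> w by move=> E; apply: (D_asym d); rewrite E.
  apply: (@D_swap c u w u') dc d.
  - by rewrite /varrow Ic cu cw adj_neq.
  - by rewrite /varrow Ic cu cu' eq_sym; apply/eqP.
  - exact: nesym.
  - by rewrite uw e_sym euu'.
  - by rewrite uw e_sym (negbTE nuw).
have oi' := own_same (samesig_sym su) oi.
have /ownP[Ij _ _] := oj; have /ownP[Ii iu' _] := oi'.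
have [hl1 hl2] := hl i j oi' Ij.
have [nt nt'] := ntriv_own oi oj hn uw; have [pu pw] := own_priv oi oj hn.
have d : D i u' u by apply: (same_orient hs ne uu').
apply: (D_asym d); apply: D_forced; apply/existsP; exists j.
rewrite nt hl1 nt e_sym euu' hl2 eqxx /=; apply/existsP; exists w.
by rewrite pw (negbTE hij) uw nuw.
Qed.

Lemma orient_right u w w' : orient u w -> same w w' -> w <> w' -> orient w w' -> orient u w'.
Proof.
move=> /orientP[uw ho] hs ne ww'; have [nw nw' sw [hl _]] := sameP hs ne.
have eww' := same_adj hs ne.
case: ho => [Iu|[nu _ ho]].
  by apply/orientP; split; [rewrite -(samesigP _ _ _ _ sw)|left].
have key : e u w' -> orient u w'.
  move=> h; apply/orientP; split=> //; right; split=> //.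
  case: ho => [[c hc dc]|[hn [i [j [oi oj hij]]]]].
    left; exists c; first by apply: fstcommon_sym; apply: fstcommon_samel sw _; apply: fstcommon_sym.
    have /andP[/and3P[Ic cu cw] _] := hc.
    by apply: (Dt dc); apply: (same_orient hs ne ww').
  right; split.
    move=> c; have := hn c; rewrite /common; case E : (I c) => //=.
    by rewrite (samesigP _ _ _ _ sw).
  by exists i, j; split=> //; apply: own_same oj.
apply: key; apply/negPn/negP => nuw.
case: ho => [[c hc dc]|[hn [i [j [oi oj hij]]]]].
  have /andP[/and3P[Ic cu cw] _] := hc.
  have cw' : e c w' by rewrite -(samesigP _ _ _ _ sw).
  have d : D c w w' by apply: (same_orient hs ne ww').
  have uw' : u <> w' by move=> E; apply: (D_asym d); rewrite -E.
  apply: (@D_swap c w w' u) d dc.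
  - by rewrite /varrow Ic cw cw'; apply/eqP.
  - by rewrite /varrow Ic cw cu eq_sym adj_neq.
  - exact: nesym.
  - by rewrite eww' e_sym uw.
  - by rewrite eww' e_sym (negbTE nuw).
have oj' := own_same sw oj.
have /ownP[Ii _ _] := oi; have /ownP[Ij jw _] := oj.
have [hl1 hl2] := hl j i oj Ii.
have [nt nt'] := ntriv_own oi oj hn uw; have [pu pw] := own_priv oi oj hn.
have d : D j w w' by apply: (same_orient hs ne ww').
apply: (D_asym d); apply: D_forced; apply/existsP; exists i.
rewrite -hl1 nt' e_sym eww' -hl2 eqxx /=; apply/existsP; exists u.
have := side_opp oi oj hn uw; rewrite (negbTE hij) => /esym/negbFE ->.
by rewrite pu /= !(e_sym _ u) uw nuw.
Qed.

Theorem cert_pass : cert_ok e I G D.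
Proof.
apply/and4P; split.
- by apply/forallP => u; apply/forallP => w; rewrite -orient_adj.
- by apply/forallP => x; apply/forallP => y; apply/implyP => /andP[h /eqP]; apply: same_adj.
- apply/forallP => u; apply/forallP => w; apply/forallP => u'; apply/forallP => w'.
  apply/implyP => /and3P[/andP[h1 h2] /andP[h3 h4] h].
  have {}h : orient u' w.
    by case: eqP h2 => [->//|ne /= h2]; apply: orient_left h h1 ne h2.
  by case: eqP h4 => [<-//|ne /= h4]; apply: orient_right h h3 ne h4.
apply/forallP => x; apply/forallP => y; apply/forallP => z; apply/implyP => /andP[].
exact: par_trans.
Qed.

End Pass.

(** * The number of sorts *)

Definition sort_bound (a : nat) : nat := a + 2 ^ (4 * a).

Section Count.
Variable n : nat.
Local Notation V := 'I_n.+1.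
Variables (e : rel V) (I : pred V) (G : V -> V -> bool) (D : V -> V -> V -> bool).
Hypothesis e_sym : symmetric e.
Hypothesis e_irr : irreflexive e.
Hypothesis I_indep : forall i j, I i -> I j -> ~~ e i j.
Hypothesis ok : cert_ok e I G D.

Local Notation al := (independence_number e).

Lemma ok_trans : transitive (par e I D).
Proof.
move=> y x z h1 h2; case/and4P: ok => _ _ _ /forallP/(_ x)/forallP/(_ y)/forallP/(_ z).
by rewrite h1 h2.
Qed.

Lemma I_bound : #|[set i | I i]| <= al.
Proof.
apply: (@leq_bigmax_cond _ (independent e) (fun S : {set V} => #|S|)).
apply/forallP => u; apply/implyP; rewrite inE => hu; apply/forallP => v; apply/implyP; rewrite inE => hv.
exact: I_indep.
Qed.

Let sigs x := [set i | I i && e i x].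
Let trivs x := [set j | I j && [exists i, own e I x i && ntriv e I i j x]].
Let sides x := [set j | I j && [exists i, own e I x i && side e I G i j x]].
Let highs x := [ffun t : 'I_al => high e I D t x].
Let key x := (sigs x, trivs x, sides x, highs x).

Lemma key_same x y : ~~ I x -> ~~ I y -> key x = key y -> same e I G D x y.
Proof.
move=> nx ny [/setP h1 /setP h2 /setP h3 /ffunP h4].
have s : samesig e I x y by apply/samesigP => i Ii; have := h1 i; rewrite !inE Ii.
apply/orP; right; apply/and5P; split=> //.
  apply/forallP => i; apply/forallP => j; apply/implyP => /andP[oi Ij].
  have oi' := own_same s oi.
  have E z P : own e I z i -> [exists i, own e I z i && P i] = P i.
    move=> hz; apply/existsP/idP => [[k /andP[hk]]|hp]; first by rewrite (own_uniq hk hz).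
    by exists i; rewrite hz.
  have := h2 j; have := h3 j; rewrite !inE Ij /= !(E x (fun i => _)) // !(E y (fun i => _)) // => -> ->.
  by rewrite !eqxx.
apply/forallP => t; apply/eqP; case: (ltnP t al) => ht.
  by have := h4 (Ordinal ht); rewrite !ffunE.
by apply/idP/idP => /(high_bound e_sym e_irr ok_trans) h; lia.
Qed.

(** Members of [I] are sorts of their own, at most [a] in number for independence number [a]. Any
    other sort is determined by three subsets of [I] and [a] bits for the heights, which explains
    the exponent [4 * a]. *)
Lemma sorts_bound (R : {set V}) : (forall x y, x \in R -> y \in R -> same e I G D x y -> x = y) ->
  #|R| <= sort_bound al.
Proof.
move=> inj; rewrite -(cardsID [set i | I i] R) /sort_bound leq_add //.
  by apply: leq_trans (subset_leq_card _) I_bound; apply: subsetIr.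
rewrite -(card_in_imset (f := key)); last first.
  move=> x y; rewrite !inE => /andP[hx hx'] /andP[hy hy'] /key_same h.
  by apply: inj => //; apply: h.
pose P := powerset [set i | I i].
apply: leq_trans (_ : #|setX (setX (setX P P) P) [set: {ffun 'I_al -> bool}]| <= _).
  apply: subset_leq_card; apply/subsetP => _ /imsetP[x _ ->].
  by rewrite !inE /= andbT -andbA; apply/and3P; split; apply/subsetP => i; rewrite !inE => /andP[].
rewrite !cardsX cardsT card_ffun card_bool card_ord !card_powerset.
have h : 2 ^ #|[set i | I i]| <= 2 ^ al by rewrite leq_exp2l // I_bound.
have -> : 4 * al = al + al + al + al by lia.
by rewrite !expnD !leq_mul.
Qed.
End Count.

(** * A small functional language *)

Fixpoint tlist (t : tree) : seq tree := if t is Node x s then x :: tlist s else [::].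

(** Data that fit the shape [b] are unchanged, so clipping never alters the intended results; it
    makes their size evident. *)
Fixpoint clip (t b : tree) : tree :=
  match t, b with
  | Node t1 t2, Node b1 b2 => Node (clip t1 b1) (clip t2 b2)
  | _, _ => Leaf
  end.

(* The body of [LApp] and of the iterators is closed: it sees only the packed
   argument shown in [sem].  [LRec r b c i e] recurses over all subtrees; if
   [r] holds, every intermediate value is clipped to the shape of [c], so that
   terms all of whose recursions are clipped run in polynomial time. *)
Inductive lang : Type :=
| LArg
| LLeaf
| LNode of lang & lang
| LFst of lang
| LSnd of lang
| LIf of lang & lang & lang
| LApp of lang & lang
| LNth of lang & lang
| LMap of lang & lang
| LRec of bool & lang & lang & lang & lang.

Section Trec.
Variables (f : tree -> tree -> tree -> tree) (z : tree).
Fixpoint trec (t : tree) : tree :=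
  if t is Node x y then f t (trec x) (trec y) else z.
End Trec.

Definition oclip (r : bool) (v c : tree) : tree := if r then clip v c else v.

Definition tcons : seq tree -> tree := foldr Node Leaf.

Fixpoint sem (e : lang) (a : tree) : tree :=
  match e with
  | LArg => a
  | LLeaf => Leaf
  | LNode e1 e2 => Node (sem e1 a) (sem e2 a)
  | LFst e => tfst (sem e a)
  | LSnd e => tsnd (sem e a)
  | LIf e0 e1 e2 => if sem e0 a is Node _ _ then sem e1 a else sem e2 a
  | LApp b e => sem b (sem e a)
  | LNth l i => nth Leaf (tlist (sem l a)) (size (tlist (sem i a)))
  | LMap b l => tcons [seq sem b (Node x a) | x <- tlist (sem l a)]
  | LRec r b c i e =>
      trec (fun t x y => oclip r (sem b (Node t (Node (Node x y) a))) (sem c (Node t a)))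
        (sem i a) (sem e a)
  end.

(** A crude bound on the fixed overheads of the compiled code. *)
Definition step_cost : nat := 100.

Section RecCost.
Variables (f : tree -> tree -> tree -> tree) (z : tree) (c : tree -> tree -> tree -> nat).
Fixpoint reccost (t : tree) : nat :=
  if t is Node x y then c t (trec f z x) (trec f z y) + reccost x + reccost y else step_cost.
End RecCost.

Notation tsz := Defs.tsize.

(** An upper bound, not the exact time: both branches of a conditional are charged. *)
Fixpoint cost (e : lang) (a : tree) : nat :=
  match e with
  | LArg | LLeaf => 1
  | LNode e1 e2 => (cost e1 a + cost e2 a).+1
  | LFst e | LSnd e => (cost e a).+1
  | LIf e0 e1 e2 => (cost e0 a + cost e1 a + cost e2 a).+1
  | LApp b e => (cost e a + cost b (sem e a)).+1
  | LNth l i => cost l a + cost i a + step_cost * (size (tlist (sem i a))).+1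
  | LMap b l => cost l a + step_cost +
      \sum_(x <- tlist (sem l a)) (cost b (Node x a) + step_cost)
  | LRec r b c i e => cost i a + cost e a + step_cost +
      reccost
        (fun t x y => oclip r (sem b (Node t (Node (Node x y) a))) (sem c (Node t a)))
        (sem i a)
        (fun t x y => cost b (Node t (Node (Node x y) a)) + cost c (Node t a) +
           step_cost * (tsz (sem c (Node t a))).+1)
        (sem e a)
  end.

(** * Compilation into programs *)

Definition runs (P : program) (a : tree) (ex : exp) (v : tree) (c : nat) : Prop :=
  exists2 t, eval P a ex v t & t <= c.

Lemma runs_le P a ex v c c' : runs P a ex v c -> c <= c' -> runs P a ex v c'.
Proof. by move=> [t h1 h2] h; exists t => //; apply: leq_trans h. Qed.

Lemma runs_arg P a : runs P a EArg a 1.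
Proof. by exists 1 => //; constructor. Qed.

Lemma runs_leaf P a : runs P a ELeaf Leaf 1.
Proof. by exists 1 => //; constructor. Qed.

Lemma runs_node P a e1 e2 v1 v2 c1 c2 :
  runs P a e1 v1 c1 -> runs P a e2 v2 c2 -> runs P a (ENode e1 e2) (Node v1 v2) (c1 + c2).+1.
Proof.
by move=> [t1 h1 k1] [t2 h2 k2]; exists (t1 + t2).+1; [constructor|rewrite ltnS leq_add].
Qed.

Lemma runs_fst P a e v c : runs P a e v c -> runs P a (EFst e) (tfst v) c.+1.
Proof. by move=> [t h k]; exists t.+1; [constructor|rewrite ltnS]. Qed.

Lemma runs_snd P a e v c : runs P a e v c -> runs P a (ESnd e) (tsnd v) c.+1.
Proof. by move=> [t h k]; exists t.+1; [constructor|rewrite ltnS]. Qed.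

Lemma runs_fst_eq P a e v w c : runs P a e v c -> w = tfst v -> runs P a (EFst e) w c.+1.
Proof. by move=> h ->; apply: runs_fst. Qed.

Lemma runs_snd_eq P a e v w c : runs P a e v c -> w = tsnd v -> runs P a (ESnd e) w c.+1.
Proof. by move=> h ->; apply: runs_snd. Qed.

Lemma runs_then P a e0 e1 e2 l r v c0 c1 :
  runs P a e0 (Node l r) c0 -> runs P a e1 v c1 -> runs P a (EIf e0 e1 e2) v (c0 + c1).+1.
Proof.
move=> [t0 h0 k0] [t1 h1 k1]; exists (t0 + t1).+1; last by rewrite ltnS leq_add.
exact: ev_if_node h0 h1.
Qed.

Lemma runs_else P a e0 e1 e2 v c0 c1 :
  runs P a e0 Leaf c0 -> runs P a e2 v c1 -> runs P a (EIf e0 e1 e2) v (c0 + c1).+1.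
Proof.
move=> [t0 h0 k0] [t1 h1 k1]; exists (t0 + t1).+1; last by rewrite ltnS leq_add.
exact: ev_if_leaf h0 h1.
Qed.

Lemma runs_call P a j e b v c1 c2 :
  runs P a e b c1 -> runs P b (nth ELeaf P j) v c2 -> runs P a (ECall j e) v (c1 + c2).+1.
Proof.
move=> [t1 h1 k1] [t2 h2 k2]; exists (t1 + t2).+1; last by rewrite ltnS leq_add.
exact: ev_call h1 h2.
Qed.

(** Calls use absolute indices, so code is generated for a given offset [k] and must work in every
    program that holds the table [fs] there. *)
Definition impl (k : nat) (fs : program) (ex : exp) (f : tree -> tree) (c : tree -> nat) : Prop :=
  forall P0 P' a, size P0 = k -> runs (P0 ++ fs ++ P') a ex (f a) (c a).

Definition compilable (f : tree -> tree) (c : tree -> nat) : Prop :=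
  forall k, exists fs ex, impl k fs ex f c.

Lemma impl_cat k fs fs' ex f c : impl k fs ex f c -> impl k (fs ++ fs') ex f c.
Proof. by move=> h P0 P' a hk; rewrite -catA; apply: h. Qed.

Lemma impl_catr k fs fs' ex f c : impl (k + size fs) fs' ex f c -> impl k (fs ++ fs') ex f c.
Proof.
move=> h P0 P' a hk; have := h (P0 ++ fs) P' a; rewrite -!catA; apply.
by rewrite size_cat hk.
Qed.

Lemma compilable2 f1 c1 f2 c2 k : compilable f1 c1 -> compilable f2 c2 ->
  exists fs ex1 ex2, impl k fs ex1 f1 c1 /\ impl k fs ex2 f2 c2.
Proof.
move=> h1 h2; have [fs1 [ex1 k1]] := h1 k; have [fs2 [ex2 k2]] := h2 (k + size fs1).
by exists (fs1 ++ fs2), ex1, ex2; split; [apply: impl_cat|apply: impl_catr].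
Qed.

Lemma nth_table k (P0 fs : program) g P' : size P0 = k ->
  nth ELeaf (P0 ++ (fs ++ [:: g]) ++ P') (k + size fs) = g.
Proof. by move=> <-; rewrite nth_cat ltnNge leq_addr /= addKn -catA nth_cat ltnn subnn. Qed.

Definition has_fun k fs j (f : tree -> tree) (c : tree -> nat) : Prop :=
  forall P0 P' a, size P0 = k ->
    runs (P0 ++ fs ++ P') a (nth ELeaf (P0 ++ fs ++ P') j) (f a) (c a).

Lemma compile_fun f c k : compilable f c -> exists fs j, has_fun k fs j f c.
Proof.
move=> /(_ k) [fs [ex h]]; exists (fs ++ [:: ex]), (k + size fs) => P0 P' a hk.
by rewrite nth_table //; have := h P0 ([:: ex] ++ P') a hk; rewrite -!catA.
Qed.

Lemma has_fun_cat k fs fs' j f c : has_fun k fs j f c -> has_fun k (fs ++ fs') j f c.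
Proof. by move=> h P0 P' a hk; rewrite -catA; apply: h. Qed.

Lemma has_fun_catr k fs fs' j f c : has_fun (k + size fs) fs' j f c -> has_fun k (fs ++ fs') j f c.
Proof.
move=> h P0 P' a hk; have := h (P0 ++ fs) P' a; rewrite -!catA; apply.
by rewrite size_cat hk.
Qed.

Ltac runstep := first
  [ exact: runs_arg | exact: runs_leaf | eapply runs_node
  | eapply runs_fst_eq; [runstep|reflexivity] | eapply runs_snd_eq; [runstep|reflexivity] ].

Definition clip_fun j : exp :=
  EIf (EFst EArg) (EIf (ESnd EArg)
    (ENode (ECall j (ENode (EFst (EFst EArg)) (EFst (ESnd EArg))))
           (ECall j (ENode (ESnd (EFst EArg)) (ESnd (ESnd EArg))))) ELeaf) ELeaf.

Lemma clip_runs P j : nth ELeaf P j = clip_fun j ->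
  forall t b, runs P (Node t b) (nth ELeaf P j) (clip t b) (30 * tsz b).
Proof.
move=> hj t b; elim: b t => [|b1 IH1 b2 IH2] [|t1 t2]; rewrite hj /clip_fun /=.
- by apply: runs_le; [apply: runs_else; repeat runstep|].
- by apply: runs_le; [apply: runs_then; [repeat runstep|apply: runs_else; repeat runstep]|].
- apply: runs_le; [apply: runs_else; repeat runstep|lia].
apply: runs_le.
  apply: runs_then; first by repeat runstep.
  apply: runs_then; first by repeat runstep.
  by apply: runs_node; (apply: runs_call; [repeat runstep|]); [apply: IH1|apply: IH2].
lia.
Qed.

Lemma compile_clip k : exists fs j, forall P0 P' t b, size P0 = k -> let P := P0 ++ fs ++ P' in
  runs P (Node t b) (nth ELeaf P j) (clip t b) (30 * tsz b).
Proof.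
exists [:: clip_fun k], k => P0 P' t b hk P; apply: clip_runs.
by rewrite /P nth_cat hk ltnn subnn.
Qed.

Definition nth_fun j : exp :=
  EIf (ESnd EArg) (ECall j (ENode (ESnd (EFst EArg)) (ESnd (ESnd EArg)))) (EFst (EFst EArg)).

Lemma nth_runs P j : nth ELeaf P j = nth_fun j -> forall l i,
  runs P (Node l i) (nth ELeaf P j) (nth Leaf (tlist l) (size (tlist i))) (20 * (size (tlist i)).+1).
Proof.
move=> hj l i; elim: i l => [|x _ i IH] l; rewrite hj /nth_fun /=.
  have -> : nth Leaf (tlist l) 0 = tfst l by case: l.
  by apply: runs_le; [apply: runs_else; repeat runstep|].
have -> : nth Leaf (tlist l) (size (tlist i)).+1 = nth Leaf (tlist (tsnd l)) (size (tlist i)).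
  by case: l => //=; rewrite nth_nil.
apply: runs_le.
  apply: runs_then; first by repeat runstep.
  by apply: runs_call; [repeat runstep|apply: IH].
lia.
Qed.

Definition map_fun jb j : exp :=
  EIf (EFst EArg) (ENode (ECall jb (ENode (EFst (EFst EArg)) (ESnd EArg)))
    (ECall j (ENode (ESnd (EFst EArg)) (ESnd EArg)))) ELeaf.

Lemma map_runs P jb j f c : nth ELeaf P j = map_fun jb j ->
  (forall a, runs P a (nth ELeaf P jb) (f a) (c a)) -> forall l a,
  runs P (Node l a) (nth ELeaf P j) (tcons [seq f (Node x a) | x <- tlist l])
    (30 + \sum_(x <- tlist l) (c (Node x a) + step_cost)).
Proof.
move=> hj hb l a; elim: l => [|x _ l IH]; rewrite hj /map_fun /=.
  by apply: runs_le; [apply: runs_else; repeat runstep|].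
rewrite big_cons; apply: runs_le.
  apply: runs_then; first by repeat runstep.
  apply: runs_node; (apply: runs_call; [repeat runstep|]); [exact: hb|exact: IH].
rewrite /= /step_cost; lia.
Qed.

Definition rec_call jb j : exp :=
  ECall jb (ENode (EFst EArg) (ENode
    (ENode (ECall j (ENode (EFst (EFst EArg)) (ESnd EArg)))
           (ECall j (ENode (ESnd (EFst EArg)) (ESnd EArg)))) (ESnd (ESnd EArg)))).

Definition rec_fun (r : bool) jb jc jx j : exp :=
  EIf (EFst EArg)
    (if r then ECall jx (ENode (rec_call jb j)
                  (ECall jc (ENode (EFst EArg) (ESnd (ESnd EArg)))))
     else rec_call jb j)
    (EFst (ESnd EArg)).

Lemma rec_runs P r jb jc jx j f c g d : nth ELeaf P j = rec_fun r jb jc jx j ->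
  (forall a, runs P a (nth ELeaf P jb) (f a) (c a)) ->
  (forall a, runs P a (nth ELeaf P jc) (g a) (d a)) ->
  (forall t b, runs P (Node t b) (nth ELeaf P jx) (clip t b) (30 * tsz b)) ->
  forall a z t, let h t x y := oclip r (f (Node t (Node (Node x y) a))) (g (Node t a)) in
  runs P (Node t (Node z a)) (nth ELeaf P j) (trec h z t)
   (reccost h z (fun t x y => c (Node t (Node (Node x y) a)) + d (Node t a) +
           step_cost * (tsz (g (Node t a))).+1) t).
Proof.
move=> hj hb hc hx a z t h; elim: t => [|t1 IH1 t2 IH2]; rewrite hj /rec_fun /=.
  by apply: runs_le; [apply: runs_else; repeat runstep|].
set t := Node t1 t2; set x := trec h z t1; set y := trec h z t2.
have H : runs P (Node t (Node z a)) (rec_call jb j) (f (Node t (Node (Node x y) a)))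
  (c (Node t (Node (Node x y) a)) + 40 +
   reccost h z (fun t x y => c (Node t (Node (Node x y) a)) + d (Node t a) +
           step_cost * (tsz (g (Node t a))).+1) t1 +
   reccost h z (fun t x y => c (Node t (Node (Node x y) a)) + d (Node t a) +
           step_cost * (tsz (g (Node t a))).+1) t2).
  apply: runs_le.
    apply: runs_call; last exact: hb.
    apply: runs_node; first by repeat runstep.
    apply: runs_node; last by repeat runstep.
    by apply: runs_node; (apply: runs_call; [repeat runstep|]); [apply: IH1|apply: IH2].
  rewrite /= -/x -/y; lia.
rewrite /h -/t; clear hj IH1 IH2; destruct r => /=; apply: runs_le.
- apply: runs_then; first by repeat runstep.
  apply: runs_call; last exact: hx.
  apply: runs_node; first exact: H.
  by apply: runs_call; [repeat runstep|exact: hc].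
- rewrite /h /= /step_cost; lia.
- by apply: runs_then H; repeat runstep.
rewrite /h /= /step_cost; lia.
Qed.

Theorem compile e : compilable (sem e) (cost e).
Proof.
elim: e => [||e1 h1 e2 h2|e h|e h|e0 h0 e1 h1 e2 h2|b hb e h|l hl i hi|b hb l hl
  |r b hb c hc i hi e he] k.
- by exists [::], EArg => P0 P' a _; apply: runs_arg.
- by exists [::], ELeaf => P0 P' a _; apply: runs_leaf.
- have [fs [x1 [x2 [k1 k2]]]] := compilable2 k h1 h2.
  by exists fs, (ENode x1 x2) => P0 P' a hk; apply: runs_node; [apply: k1|apply: k2].
- by have [fs [ex kx]] := h k; exists fs, (EFst ex) => P0 P' a hk; apply: runs_fst; apply: kx.
- by have [fs [ex kx]] := h k; exists fs, (ESnd ex) => P0 P' a hk; apply: runs_snd; apply: kx.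
- have [fs [x1 [x2 [k1 k2]]]] := compilable2 k h1 h2.
  have [fs0 [x0 k0]] := h0 (k + size fs).
  exists (fs ++ fs0), (EIf x0 x1 x2) => P0 P' a hk /=.
  have := impl_catr k0 P' a hk.
  have := impl_cat fs0 k1 P' a hk; have := impl_cat fs0 k2 P' a hk.
  case: (sem e0 a) => [|u v] K2 K1 K.
    by apply: runs_le; [apply: runs_else K K2|lia].
  by apply: runs_le; [apply: runs_then K K1|lia].
- have [fs [ex kx]] := h k; have [fs' [j k']] := compile_fun (k + size fs) hb.
  exists (fs ++ fs'), (ECall j ex) => P0 P' a hk /=; apply: runs_call; first exact: (impl_cat _ kx).
  by refine (has_fun_catr _ _ _ hk); exact: k'.
- have [fs [x1 [x2 [k1 k2]]]] := compilable2 k hl hi.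
  set j := k + size fs.
  exists (fs ++ [:: nth_fun j]), (ECall j (ENode x1 x2)) => P0 P' a hk /=.
  apply: runs_le.
    apply: runs_call; last by apply: nth_runs; exact: nth_table.
    by apply: runs_node; [apply: (impl_cat _ k1)|apply: (impl_cat _ k2)].
  rewrite /= /step_cost; lia.
- have [fs [ex kx]] := hl k; have [fs' [jb k']] := compile_fun (k + size fs) hb.
  set j := k + size (fs ++ fs'); set g := map_fun jb j.
  exists ((fs ++ fs') ++ [:: g]), (ECall j (ENode ex EArg)) => P0 P' a hk /=.
  apply: runs_le.
    apply: runs_call; last first.
      apply: (@map_runs _ jb _ (sem b) (cost b)); first exact: nth_table.
      by move=> a'; refine (has_fun_cat _ (has_fun_catr _) _ _ hk); exact: k'.
    apply: runs_node; last exact: runs_arg.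
    exact: (impl_cat _ (impl_cat _ kx) _ _ hk).
  rewrite /= /step_cost; lia.
have [fs [x1 [x2 [k1 k2]]]] := compilable2 k hi he.
have [fsb [jb kb]] := compile_fun (k + size fs) hb.
have [fsc [jc kc]] := compile_fun (k + size (fs ++ fsb)) hc.
have [fsx [jx kx]] := compile_clip (k + size ((fs ++ fsb) ++ fsc)).
set F := ((fs ++ fsb) ++ fsc) ++ fsx; set j := k + size F; set g := rec_fun r jb jc jx j.
exists (F ++ [:: g]), (ECall j (ENode x2 (ENode x1 EArg))) => P0 P' a hk /=.
apply: runs_le.
  apply: runs_call; last first.
    apply: (@rec_runs _ r jb jc jx _ (sem b) (cost b) (sem c) (cost c)); first exact: nth_table.
    - by move=> a'; refine (has_fun_cat _ (has_fun_cat _ (has_fun_cat _ (has_fun_catr _))) _ _ hk); exact: kb.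
    - by move=> a'; refine (has_fun_cat _ (has_fun_cat _ (has_fun_catr _)) _ _ hk); exact: kc.
    - move=> t' b'; have := kx (P0 ++ (fs ++ fsb) ++ fsc) ([:: g] ++ P') t' b'.
      by rewrite /F -!catA; apply; rewrite !size_cat hk !addnA.
  apply: runs_node; first exact: (impl_cat _ (impl_cat _ (impl_cat _ (impl_cat _ k2))) _ _ hk).
  apply: runs_node; last exact: runs_arg.
  exact: (impl_cat _ (impl_cat _ (impl_cat _ (impl_cat _ k1))) _ _ hk).
rewrite /= /step_cost; lia.
Qed.

(** Function 0 only calls the compiled function, whose table starts at offset 1; this accounts for
    the two extra steps. *)
Lemma lang_program e : exists P : program, forall a, exists t,
  run P a (sem e a) t /\ t <= (cost e a).+2.
Proof.
have [fs [j k]] := compile_fun 1 (compile e).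
exists (ECall j EArg :: fs) => a; have := k [:: ECall j EArg] [::] a erefl.
rewrite cats0 => h; have [t ht le] := runs_call (runs_arg _ a) h.
by exists t; split.
Qed.

(** * Bounds on sizes and running times *)

Section Bounds.
Variables (zb zc : nat -> nat).
(** Unclipped, the bound is iterated along the recursion and may outgrow every polynomial; clipped,
    it is independent of the intermediate values. *)
Definition rec_bound (r : bool) (i n s : nat) : nat :=
  if r then i + zc (n + s).+1 else iter n (fun x => x + zb (n + x + x + s).+3) i.
End Bounds.

Fixpoint sz (e : lang) (s : nat) : nat :=
  match e with
  | LArg => s
  | LLeaf => 1
  | LNode e1 e2 => (sz e1 s + sz e2 s).+1
  | LFst e | LSnd e => sz e s
  | LIf _ e1 e2 => sz e1 s + sz e2 s
  | LApp b e => sz b (sz e s)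
  | LNth l _ => sz l s
  | LMap b l => (sz l s * (sz b (sz l s + s).+1).+1).+1
  | LRec r b c i e => rec_bound (sz b) (sz c) r (sz i s) (sz e s) s
  end.

Fixpoint tm (e : lang) (s : nat) : nat :=
  match e with
  | LArg | LLeaf => 1
  | LNode e1 e2 => (tm e1 s + tm e2 s).+1
  | LFst e | LSnd e => (tm e s).+1
  | LIf e0 e1 e2 => (tm e0 s + tm e1 s + tm e2 s).+1
  | LApp b e => (tm e s + tm b (sz e s)).+1
  | LNth l i => tm l s + tm i s + step_cost * (sz i s).+1
  | LMap b l => tm l s + step_cost + sz l s * (tm b (sz l s + s).+1 + step_cost)
  | LRec r b c i e =>
      let n := sz e s in
      let R := rec_bound (sz b) (sz c) r (sz i s) n s in
      tm i s + tm e s + step_cost +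
      n * (tm b (n + R + R + s).+3 + tm c (n + s).+1 + step_cost * (sz c (n + s).+1).+1 + step_cost)
  end.

Lemma tsz_gt0 t : 0 < tsz t. Proof. by case: t. Qed.

Lemma tsz_fst t : tsz (tfst t) <= tsz t. Proof. by case: t => //= *; lia. Qed.

Lemma tsz_snd t : tsz (tsnd t) <= tsz t. Proof. by case: t => //= *; lia. Qed.

Lemma size_tlist t : size (tlist t) < tsz t.
Proof. by elim: t => //= x _ y IH; have := tsz_gt0 x; lia. Qed.

Lemma tsz_nth t i : tsz (nth Leaf (tlist t) i) <= tsz t.
Proof.
elim: t i => [|x _ y IH] [|i] //=; first by lia.
by apply: leq_trans (IH i) _; lia.
Qed.

Lemma tsz_clip t b : tsz (clip t b) <= tsz b.
Proof. by elim: b t => [|x IHx y IHy] [|u v] //=; have := IHx u; have := IHy v; lia. Qed.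

Lemma tlistK s : tlist (tcons s) = s. Proof. by elim: s => //= x s ->. Qed.

Lemma tsz_tcons_map (f : tree -> tree) t B :
  (forall x, tsz x < tsz t -> tsz (f x) <= B) ->
  tsz (tcons [seq f x | x <- tlist t]) <= (tsz t * B.+1).+1.
Proof.
elim: t => [|x _ y IH] h //=.
have := h x; have := tsz_gt0 y; have := tsz_gt0 x; have : tsz (tcons [seq f z | z <- tlist y]) <= (tsz y * B.+1).+1.
  by apply: IH => z hz; apply: h => /=; lia.
rewrite /= => h1 h2 h3 /(_ ltac:(lia)) h4.
nia.
Qed.

Lemma sum_tlist (f : tree -> nat) t B :
  (forall x, tsz x < tsz t -> f x <= B) -> \sum_(x <- tlist t) f x <= tsz t * B.
Proof.
elim: t => [|x _ y IH] h /=; first by rewrite big_nil.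
rewrite big_cons; have := h x; have : \sum_(z <- tlist y) f z <= tsz y * B.
  by apply: IH => z hz; apply: h => /=; lia.
have := tsz_gt0 y; have := tsz_gt0 x; rewrite /= => h1 h2 h3 /(_ ltac:(lia)) h4.
nia.
Qed.

Lemma trec_bound (r : bool) (f g : tree -> tree) zb zc z a s i n :
  (forall x m, tsz x <= m -> tsz (f x) <= zb m) ->
  (forall x m, tsz x <= m -> tsz (g x) <= zc m) ->
  tsz a <= s -> tsz z <= i -> forall t, tsz t <= n ->
  tsz (trec (fun t x y => oclip r (f (Node t (Node (Node x y) a))) (g (Node t a))) z t)
    <= rec_bound zb zc r i n s.
Proof.
move=> hf hg ha hz; case: r => t ht /=.
  case: t ht => [|x y] ht /=; first by lia.
  rewrite (leq_trans (tsz_clip _ _)) // -[X in X <= _]add0n leq_add //; apply: hg => /=.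
  by move: ht => /=; lia.
pose F x := x + zb (n + x + x + s).+3; rewrite -/F.
suff H k : forall t, tsz t <= n -> tsz t <= k -> tsz (trec (fun t x y =>
    f (Node t (Node (Node x y) a))) z t) <= iter k F i by exact: H.
elim: k => [|k IH] {ht}t hn ht; first by have := tsz_gt0 t; lia.
case: t ht hn => [|x y] ht hn /=; first by apply: leq_trans hz _; rewrite -iterS; elim: (k.+1) => //= j h; apply: leq_trans h _; apply: leq_addr.
have := IH x; have := IH y; move: ht hn => /= ht hn /(_ ltac:(lia) ltac:(lia)) h1 /(_ ltac:(lia) ltac:(lia)) h2.
rewrite {1}/F; apply: leq_trans (leq_addl _ _); apply: hf => /=; lia.
Qed.

Lemma reccost_bound f z (c : tree -> tree -> tree -> nat) n B R :
  (forall t, tsz t <= n -> tsz (trec f z t) <= R) ->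
  (forall t x y, tsz t <= n -> tsz x <= R -> tsz y <= R -> c t x y <= B) ->
  forall t, tsz t <= n -> reccost f z c t <= tsz t * (B + step_cost).
Proof.
move=> hR hc; elim=> [|x IHx y IHy] ht /=; first by lia.
have := IHx; have := IHy; move: (ht) => /= ht' /(_ ltac:(lia)) h1 /(_ ltac:(lia)) h2.
have := hc (Node x y) (trec f z x) (trec f z y) ht.
have := hR x ltac:(lia); have := hR y ltac:(lia) => h3 h4 /(_ h4 h3) h5.
nia.
Qed.

Theorem sz_bound e a s : tsz a <= s -> tsz (sem e a) <= sz e s.
Proof.
elim: e a s => [||e1 h1 e2 h2|e h|e h|e0 h0 e1 h1 e2 h2|b hb e h|l hl i hi|b hb l hl
  |r b hb c hc i hi e he] a s hs //=.
- by have := h1 _ _ hs; have := h2 _ _ hs; lia.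
- by apply: leq_trans (tsz_fst _) (h _ _ hs).
- by apply: leq_trans (tsz_snd _) (h _ _ hs).
- by have := h1 _ _ hs; have := h2 _ _ hs; case: (sem e0 a) => *; lia.
- by apply: hb; apply: h.
- by apply: leq_trans (tsz_nth _ _) (hl _ _ hs).
- have H := hl _ _ hs; apply: leq_trans (_ : (tsz (sem l a) * (sz b (sz l s + s).+1).+1).+1 <= _); last first.
    by rewrite ltnS leq_mul2r H orbT.
  by apply: (@tsz_tcons_map (fun x => sem b (Node x a))) => x hx; apply: hb => /=; lia.
by apply: trec_bound => //; [apply: hi|apply: he].
Qed.

Theorem cost_bound e a s : tsz a <= s -> cost e a <= tm e s.
Proof.
elim: e a s => [||e1 h1 e2 h2|e h|e h|e0 h0 e1 h1 e2 h2|b hb e h|l hl i hi|b hb l hl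
  |r b hb c hc i hi e he] a s hs //=.
- by have := h1 _ _ hs; have := h2 _ _ hs; lia.
- exact: h.
- exact: h.
- by have := h0 _ _ hs; have := h1 _ _ hs; have := h2 _ _ hs; lia.
- by have := h _ _ hs; have := hb _ _ (sz_bound e hs); lia.
- have := hl _ _ hs; have := hi _ _ hs; have := sz_bound i hs; have := size_tlist (sem i a).
  by rewrite /step_cost; lia.
- have H := sz_bound l hs; have := hl _ _ hs.
  have : \sum_(x <- tlist (sem l a)) (cost b (Node x a) + step_cost) <=
     tsz (sem l a) * (tm b (sz l s + s).+1 + step_cost).
    by apply: sum_tlist => x hx; rewrite leq_add2r; apply: hb => /=; lia.
  by rewrite /step_cost; nia.
have Hi := sz_bound i hs; have He := sz_bound e hs.
have := hi _ _ hs; have := he _ _ hs.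
set n := sz e s in He *; set R := rec_bound _ _ _ _ _ _.
set f := fun t x y => _; set C := fun t x y => _.
have H1 t : tsz t <= n -> tsz (trec f (sem i a) t) <= R.
  by move=> ht; apply: trec_bound => // x m; apply: sz_bound.
have H2 t x y : tsz t <= n -> tsz x <= R -> tsz y <= R -> C t x y <=
  tm b (n + R + R + s).+3 + tm c (n + s).+1 + step_cost * (sz c (n + s).+1).+1.
  move=> ht hx hy; rewrite /C.
  have h1 : tsz (Node t a) <= (n + s).+1 by rewrite /=; lia.
  have h2 : tsz (Node t (Node (Node x y) a)) <= (n + R + R + s).+3 by rewrite /=; lia.
  by have := hb _ _ h2; have := hc _ _ h1; have := sz_bound c h1; rewrite /step_cost; lia.
have := reccost_bound H1 H2 He; rewrite /step_cost; nia.
Qed.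

(** The base is at least 2, so a single exponent absorbs constants, sums, products and
    compositions. *)
Definition polyb (f : nat -> nat) : Prop := exists D, forall s, f s <= s.+2 ^ D.

Lemma polyb_le f g : polyb g -> (forall s, f s <= g s) -> polyb f.
Proof. by move=> [D h] le; exists D => s; apply: leq_trans (le s) (h s). Qed.

Lemma polyb_const c : polyb (fun=> c).
Proof. by exists c => s; apply: ltnW; apply: ltn_expl. Qed.

Lemma polyb_id : polyb id. Proof. by exists 1 => s; rewrite expn1; lia. Qed.

Lemma polyb_add f g : polyb f -> polyb g -> polyb (fun s => f s + g s).
Proof.
move=> [D h] [D' h']; exists (maxn D D').+1 => s; rewrite expnS.
have e1 : s.+2 ^ D <= s.+2 ^ maxn D D' by rewrite leq_exp2l // leq_maxl.
have e2 : s.+2 ^ D' <= s.+2 ^ maxn D D' by rewrite leq_exp2l // leq_maxr.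
by have := h s; have := h' s; nia.
Qed.

Lemma polyb_mul f g : polyb f -> polyb g -> polyb (fun s => f s * g s).
Proof. by move=> [D h] [D' h']; exists (D + D') => s; rewrite expnD leq_mul. Qed.

Lemma polyb_S f : polyb f -> polyb (fun s => (f s).+1).
Proof.
by move=> h; apply: polyb_le (polyb_add h (polyb_const 1)) _ => s; rewrite addn1.
Qed.

Lemma polyb_comp f g : polyb f -> polyb g -> polyb (fun s => f (g s)).
Proof.
move=> [D h] /polyb_S/polyb_S [D' h']; exists (D' * D) => s; rewrite expnM.
apply: leq_trans (h _) _; case: D {h} => // D; rewrite leq_exp2r //; exact: h'.
Qed.

Fixpoint restricted (e : lang) : bool :=
  match e with
  | LArg | LLeaf => true
  | LFst e | LSnd e => restricted e
  | LNode e1 e2 | LApp e1 e2 | LNth e1 e2 | LMap e1 e2 => restricted e1 && restricted e2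
  | LIf e0 e1 e2 => [&& restricted e0, restricted e1 & restricted e2]
  | LRec r b c i e => [&& r, restricted b, restricted c, restricted i & restricted e]
  end.

Ltac pb := repeat first
  [ assumption | apply: polyb_S | apply: polyb_add | apply: polyb_mul | apply: polyb_id
  | apply: polyb_const
  | match goal with H : polyb ?f |- polyb (fun s => ?f (@?g s)) => apply: (polyb_comp (f := f) (g := g) H) end].

(** Clipped values are bounded through the clipping shape, so no bound is ever iterated and all
    bounds are compositions of polynomials. *)
Theorem restricted_poly e : restricted e -> polyb (sz e) /\ polyb (tm e).
Proof.
elim: e => [||e1 h1 e2 h2|e h|e h|e0 h0 e1 h1 e2 h2|b hb e h|l hl i hi|b hb l hl
  |r b hb c hc i hi e he] /=.
- by split; pb.
- by split; pb.
- by case/andP=> /h1 [? ?] /h2 [? ?]; split; pb.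
- by move/h => [? ?]; split; pb.
- by move/h => [? ?]; split; pb.
- by case/and3P=> /h0 [? ?] /h1 [? ?] /h2 [? ?]; split; pb.
- by case/andP=> /hb [? ?] /h [? ?]; split; pb.
- by case/andP=> /hl [? ?] /hi [? ?]; split; pb.
- by case/andP=> /hb [? ?] /hl [? ?]; split; pb.
by case/and5P=> -> /hb [? ?] /hc [? ?] /hi [? ?] /he [? ?]; split; rewrite /rec_bound; pb.
Qed.

(* [def true f]: [f] is computed by a restricted term, hence in polynomial time. *)
Definition def (r : bool) (f : tree -> tree) : Prop :=
  exists2 e, (r -> restricted e) & sem e =1 f.

Definition tif (c x y : tree) : tree := if c is Node _ _ then x else y.
Definition tnth (l i : tree) : tree := nth Leaf (tlist l) (size (tlist i)).
Definition tmap (f : tree -> tree) (l : tree) : tree := tcons [seq f x | x <- tlist l].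
Definition tfold (f : tree -> tree -> tree) (z l : tree) : tree := foldr f z (tlist l).
Definition tcfold (f : tree -> tree -> tree) (c z l : tree) : tree :=
  foldr (fun x y => clip (f x y) c) z (tlist l).
Definition tcrec (f : tree -> tree -> tree -> tree) (c : tree -> tree) (z t : tree) : tree :=
  trec (fun t x y => clip (f t x y) (c t)) z t.

(** * Closure properties of definable functions *)

Section Closure.
Variable r : bool.
Implicit Types f g h l i z c e : tree -> tree.

Lemma def_ext f g : f =1 g -> def r f -> def r g.
Proof. by move=> h [e he hs]; exists e => // a; rewrite hs. Qed.

Lemma def_id : def r (fun a => a). Proof. by exists LArg. Qed.

Lemma def_leaf : def r (fun=> Leaf). Proof. by exists LLeaf. Qed.

Lemma def_node f g : def r f -> def r g -> def r (fun a => Node (f a) (g a)).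
Proof.
move=> [x hx kx] [y hy ky]; exists (LNode x y) => [h|a] /=; first by rewrite hx ?hy.
by rewrite kx ky.
Qed.

Lemma def_fst f : def r f -> def r (fun a => tfst (f a)).
Proof. by move=> [x hx kx]; exists (LFst x) => [h|a] /=; [exact: hx|rewrite kx]. Qed.

Lemma def_snd f : def r f -> def r (fun a => tsnd (f a)).
Proof. by move=> [x hx kx]; exists (LSnd x) => [h|a] /=; [exact: hx|rewrite kx]. Qed.

Lemma def_if f g h : def r f -> def r g -> def r h -> def r (fun a => tif (f a) (g a) (h a)).
Proof.
move=> [x hx kx] [y hy ky] [z hz kz]; exists (LIf x y z) => [?|a] /=.
  by rewrite hx ?hy ?hz.
by rewrite kx ky kz.
Qed.

Lemma def_app g f : def r g -> def r f -> def r (fun a => g (f a)).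
Proof.
move=> [x hx kx] [y hy ky]; exists (LApp x y) => [h|a] /=; first by rewrite hx ?hy.
by rewrite ky kx.
Qed.

Lemma def_nth l i : def r l -> def r i -> def r (fun a => tnth (l a) (i a)).
Proof.
move=> [x hx kx] [y hy ky]; exists (LNth x y) => [h|a] /=; first by rewrite hx ?hy.
by rewrite kx ky.
Qed.

Lemma def_map (b : tree -> tree -> tree) l :
  def r (fun p => b (tsnd p) (tfst p)) -> def r l -> def r (fun a => tmap (b a) (l a)).
Proof.
move=> [x hx kx] [y hy ky]; exists (LMap x y) => [h|a] /=; first by rewrite hx ?hy.
by rewrite ky /tmap; congr tcons; apply: eq_map => u; rewrite kx.
Qed.

Lemma def_crec (b : tree -> tree -> tree -> tree -> tree) (c : tree -> tree -> tree) z e :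
  def r (fun p => b (tsnd (tsnd p)) (tfst p) (tfst (tfst (tsnd p))) (tsnd (tfst (tsnd p)))) ->
  def r (fun p => c (tsnd p) (tfst p)) ->
  def r z -> def r e -> def r (fun a => tcrec (b a) (c a) (z a) (e a)).
Proof.
move=> [x hx kx] [y hy ky] [u hu ku] [v hv kv].
exists (LRec true x y u v) => [h|a] /=; first by rewrite hx ?hy ?hu ?hv.
rewrite ku kv /tcrec; elim: (e a) => //= t1 -> t2 ->.
by rewrite kx ky.
Qed.

Lemma def_cfold (b : tree -> tree -> tree -> tree) c z l :
  def r (fun p => b (tsnd (tsnd p)) (tfst p) (tfst (tsnd p))) ->
  def r c -> def r z -> def r l -> def r (fun a => tcfold (b a) (c a) (z a) (l a)).
Proof.
move=> hb [y hy ky] hz hl.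
apply: def_ext (_ : _ =1 _) (@def_crec (fun a t x y => b a (tfst t) y) (fun a t => c a) z l _ _ hz hl).
- by move=> a; rewrite /tcrec /tcfold; elim: (l a) => //= t1 _ t2 ->.
- case: hb => x hx kx.
  exists (LApp x (LNode (LFst (LFst LArg)) (LNode (LSnd (LFst (LSnd LArg))) (LSnd (LSnd LArg))))) => [h|a] /=.
    by rewrite hx.
  by rewrite kx.
by exists (LApp y (LSnd LArg)) => [h|a] /=; rewrite ?hy ?ky.
Qed.

End Closure.

Lemma def_rec (b : tree -> tree -> tree -> tree -> tree) (z e : tree -> tree) :
  def false (fun p => b (tsnd (tsnd p)) (tfst p) (tfst (tfst (tsnd p))) (tsnd (tfst (tsnd p)))) ->
  def false z -> def false e -> def false (fun a => trec (b a) (z a) (e a)).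
Proof.
move=> [x hx kx] [u hu ku] [v hv kv].
exists (LRec false x LLeaf u v) => // a /=.
by rewrite ku kv; elim: (e a) => //= t1 -> t2 ->; rewrite kx.
Qed.

Lemma def_fold (b : tree -> tree -> tree -> tree) (z l : tree -> tree) :
  def false (fun p => b (tsnd (tsnd p)) (tfst p) (tfst (tsnd p))) ->
  def false z -> def false l -> def false (fun a => tfold (b a) (z a) (l a)).
Proof.
move=> hb hz hl.
apply: def_ext (_ : _ =1 _) (@def_rec (fun a t x y => b a (tfst t) y) z l _ hz hl).
  by move=> a; rewrite /tfold; elim: (l a) => //= t1 _ t2 ->.
case: hb => x hx kx.
exists (LApp x (LNode (LFst (LFst LArg)) (LNode (LSnd (LFst (LSnd LArg))) (LSnd (LSnd LArg))))) => // a /=.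
by rewrite kx.
Qed.

Definition def2 r (f : tree -> tree -> tree) : Prop := def r (fun p => f (tfst p) (tsnd p)).
Definition def3 r (f : tree -> tree -> tree -> tree) : Prop :=
  def r (fun p => f (tfst p) (tfst (tsnd p)) (tsnd (tsnd p))).

Lemma def_app2 r f g h : def2 r f -> def r g -> def r h -> def r (fun a => f (g a) (h a)).
Proof. by move=> hf hg hh; apply: (def_app hf (def_node hg hh)). Qed.

Lemma def_app3 r f g h k : def3 r f -> def r g -> def r h -> def r k ->
  def r (fun a => f (g a) (h a) (k a)).
Proof. by move=> hf hg hh hk; apply: (def_app hf (def_node hg (def_node hh hk))). Qed.

Create HintDb defs.

(** Follows the syntax of a function on trees, so that its defining expression serves as the proof
    that the language contains it. *)
Ltac def_step :=
  cbv beta;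
  match goal with
  | |- def2 _ _ => unfold def2
  | |- def3 _ _ => unfold def3
  | |- def ?r (fun a => a) => exact (def_id r)
  | |- def ?r (fun a => Leaf) => exact (def_leaf r)
  | |- def ?r (fun a => Node (@?f a) (@?g a)) => apply (@def_node r f g)
  | |- def ?r (fun a => tfst (@?f a)) => apply (@def_fst r f)
  | |- def ?r (fun a => tsnd (@?f a)) => apply (@def_snd r f)
  | |- def ?r (fun a => tif (@?f a) (@?g a) (@?h a)) => apply (@def_if r f g h)
  | |- def ?r (fun a => tnth (@?f a) (@?g a)) => apply (@def_nth r f g)
  | |- def ?r (fun a => tmap (@?b a) (@?l a)) => apply (@def_map r b l)
  | |- def ?r (fun a => tcrec (@?b a) (@?c a) (@?z a) (@?l a)) => apply (@def_crec r b c z l)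
  | |- def ?r (fun a => tcfold (@?b a) (@?c a) (@?z a) (@?l a)) => apply (@def_cfold r b c z l)
  | |- def ?r (fun a => trec (@?b a) (@?z a) (@?l a)) => apply (@def_rec b z l)
  | |- def ?r (fun a => tfold (@?b a) (@?z a) (@?l a)) => apply (@def_fold b z l)
  | |- def ?r (fun a => ?f (@?g a) (@?h a) (@?k a)) => apply (@def_app3 r f g h k); [solve [auto with defs]|..]
  | |- def ?r (fun a => ?f (@?g a) (@?h a)) => apply (@def_app2 r f g h); [solve [auto with defs]|..]
  | |- def ?r (fun a => ?f (@?g a)) => apply (@def_app r f g); [solve [auto with defs]|..]
  end.
Ltac ldef := repeat def_step.

(** * Unary arithmetic *)

Definition nval (t : tree) : nat := size (tlist t).

Lemma code_natK n : nval (code_nat n) = n.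
Proof. by elim: n => //= n IH; rewrite /nval /= -[size _]/(nval _) IH. Qed.

(** Numerical functions in unary, with unclipped recursion allowed; they serve to show that time
    bounds are computable. *)
Definition ndef (c : tree -> nat) : Prop := def false (fun a => code_nat (c a)).

Lemma ndef_const n : ndef (fun=> n).
Proof. by elim: n => [|n IH]; [exact: def_leaf|exact: (def_node (def_leaf _) IH)]. Qed.

Lemma ndef_S c : ndef c -> ndef (fun a => (c a).+1).
Proof. by move=> h; exact: (def_node (def_leaf _) h). Qed.

Lemma tlist_code n : tlist (code_nat n) = nseq n Leaf.
Proof. by elim: n => //= n ->. Qed.

Lemma ndef_comp c f : ndef c -> def false f -> ndef (fun a => c (f a)).
Proof. by move=> hc hf; apply: (def_app (g := fun a => code_nat (c a)) hc hf). Qed.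

Lemma ndef_iter n i (h : tree -> nat -> nat) : ndef n -> ndef i ->
  ndef (fun p => h (tsnd p) (nval (tfst p))) -> ndef (fun a => iter (n a) (h a) (i a)).
Proof.
move=> hn hi hh.
apply: def_ext (_ : _ =1 _) (@def_fold (fun a _ y => code_nat (h a (nval y))) _ _ _ hi hn).
  move=> a; rewrite /tfold tlist_code; elim: (n a) => //= k ->.
  by rewrite code_natK.
exact: (def_app (g := fun p => code_nat (h (tsnd p) (nval (tfst p)))) hh (def_snd (def_id _))).
Qed.

Lemma ndef_nval f : def false f -> ndef (fun a => nval (f a)).
Proof.
move=> hf; apply: def_ext (_ : _ =1 _) (@def_fold (fun _ _ y => Node Leaf y) _ _ _ (def_leaf _) hf).
  by move=> a; rewrite /tfold /nval; elim: (tlist (f a)) => //= x s ->.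
ldef.
Qed.

Lemma ndef_add c d : ndef c -> ndef d -> ndef (fun a => c a + d a).
Proof.
move=> hc hd; apply: def_ext (_ : _ =1 _) (@ndef_iter c d (fun _ n => n.+1) hc hd _).
  by move=> a; congr code_nat; elim: (c a) => //= k ->.
exact: (@ndef_S (fun p => nval (tfst p)) (ndef_nval (def_fst (def_id _)))).
Qed.

Lemma ndef_mul c d : ndef c -> ndef d -> ndef (fun a => c a * d a).
Proof.
move=> hc hd; apply: def_ext (_ : _ =1 _) (@ndef_iter c (fun=> 0) (fun a n => d a + n) hc (ndef_const 0) _).
  by move=> a; congr code_nat; elim: (c a) => //= k ->; rewrite mulSn.
apply: (@ndef_add (fun p => d (tsnd p)) (fun p => nval (tfst p))).
  exact: ndef_comp hd (def_snd (def_id _)).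
exact: ndef_nval (def_fst (def_id _)).
Qed.

Ltac ndef_step :=
  cbv beta;
  lazymatch goal with
  | |- ndef (fun a => (@?c a).+1) => apply (@ndef_S c)
  | |- ndef (fun a => @?c a + @?d a) => apply (@ndef_add c d)
  | |- ndef (fun a => @?c a * @?d a) => apply (@ndef_mul c d)
  | |- ndef (fun a => nval (@?c a)) => apply (@ndef_nval c)
  | |- ndef (fun a => ?c (tsnd a)) => apply (@ndef_comp c tsnd); [|exact (def_snd (def_id _))]
  | |- def _ _ => def_step
  end.

Lemma ndef_exp c d : ndef c -> ndef (fun a => c a ^ d).
Proof.
move=> hc; elim: d => [|d IH]; first exact: (ndef_const 1).
by apply: def_ext (ndef_mul hc IH) => a; rewrite expnS.
Qed.

(** Size bounds are built from sums, products and iteration, hence are again computed by terms. This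
    is the source of computability of the parameter-dependent factor. *)
Lemma ndef_sz e c : ndef c -> ndef (fun a => sz e (c a)).
Proof.
elim: e c => [||e1 h1 e2 h2|e h|e h|e0 h0 e1 h1 e2 h2|b hb e h|l hl i hi|b hb l hl
  |r b hb c hc i hi e he] d hd //=; try by auto.
- exact: ndef_const.
- by apply: ndef_S; apply: ndef_add; auto.
- by apply: ndef_add; auto.
- apply: ndef_S; apply: ndef_mul; first by auto.
  by apply: ndef_S; apply: hb; apply: ndef_S; apply: ndef_add; auto.
rewrite /rec_bound; case: r; first by apply: ndef_add; [auto|apply: hc; apply: ndef_S; apply: ndef_add; auto].
apply: ndef_iter; [by auto|by auto|].
cbv beta.
apply: (@ndef_add (fun p => nval (tfst p)) (fun p => sz b _)); first by repeat ndef_step.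
apply: (hb (fun p => (sz e (d (tsnd p)) + nval (tfst p) + nval (tfst p) + d (tsnd p)).+3)).
have he' := @ndef_comp (fun a => sz e (d a)) tsnd (he _ hd) (def_snd (def_id _)).
by repeat first [exact: he'|ndef_step].
Qed.

Lemma ndef_tm e c : ndef c -> ndef (fun a => tm e (c a)).
Proof.
have S := ndef_sz.
elim: e c => [||e1 h1 e2 h2|e h|e h|e0 h0 e1 h1 e2 h2|b hb e h|l hl i hi|b hb l hl
  |r b hb c hc i hi e he] d hd /=.
all: try have H := S (LRec r b c i e) _ hd.
all: repeat first [by auto|exact: H|exact: ndef_const|
  match goal with h : forall c : tree -> nat, ndef c -> ndef (fun a => tm ?b (c a))
   |- ndef (fun a => tm ?b (@?c a)) => apply (h c) end
  |match goal with |- ndef (fun a => sz ?b (@?c a)) => apply (S b c) end| ndef_step].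
Qed.

Lemma computable2_ndef f : ndef (fun a => f (nval (tfst a)) (nval (tsnd a))) -> computable2 f.
Proof.
move=> [e _ he]; have [P hP] := lang_program e; exists P => k l.
have [t [ht _]] := hP (Node (code_nat k) (code_nat l)); exists t.
by move: ht; rewrite he /= !code_natK.
Qed.

(** * First-order loop programs *)

Definition tt1 : tree := Node Leaf Leaf.

Lemma def_tt r : def r (fun=> tt1). Proof. by rewrite /tt1; ldef. Qed.

Fixpoint tget (k : nat) (l : tree) : tree := if k is k'.+1 then tget k' (tsnd l) else tfst l.
Fixpoint tset (k : nat) (v l : tree) : tree :=
  if k is k'.+1 then Node (tfst l) (tset k' v (tsnd l)) else Node v (tsnd l).
Fixpoint tupd (k : nat) (v l : tree) : tree :=
  tif l (if k is k'.+1 then Node (tfst l) (tupd k' v (tsnd l)) else Node v (tsnd l)) Leaf.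

Lemma def_tget r k : def r (tget k).
Proof.
elim: k => [|k IH]; first by rewrite /tget; apply: (def_fst (def_id _)).
exact: (@def_app r (tget k) tsnd IH (def_snd (def_id _))).
Qed.

Lemma def_tset r k : def2 r (tset k).
Proof.
elim: k => [|k IH]; rewrite /def2 /=; first by ldef.
by repeat first [def_step|exact: IH].
Qed.

Lemma def_tupd r k : def2 r (tupd k).
Proof.
elim: k => [|k IH]; rewrite /def2 /=; first by ldef.
by repeat first [def_step|exact: IH].
Qed.

Definition tlt (x y : tree) : tree := tnth (tmap (fun=> tt1) y) x.
Lemma def_tlt r : def2 r tlt.
Proof. by rewrite /def2 /tlt; repeat first [exact: def_tt|def_step]. Qed.

#[export] Hint Resolve def_tt def_tget def_tset def_tupd def_tlt : defs.

Ltac ldefs := repeat first [ by auto with defs | def_step ].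

(* Loop programs act on a list of ternary relations.  Variables are numbers;
   [FR k x y z] reads relation [k], [SAsg k f] makes [f] the new relation [k]
   of the variables 0, 1, 2, and [SFor x s] runs [s] for every vertex [x]. *)
Inductive form : Type :=
| FR of nat & nat & nat & nat
| FLt of nat & nat
| FNot of form
| FAnd of form & form
| FEx of nat & form
| FEq of nat & nat
| FOr of form & form
| FImp of form & form
| FIff of form & form
| FAll of nat & form.

Inductive stmt : Type :=
| SAsg of nat & form
| SSeq of stmt & stmt
| SFor of nat & stmt.

Fixpoint ftree (f : form) (S E V : tree) : tree :=
  match f with
  | FR k x y z => tnth (tnth (tnth (tget k S) (tget x E)) (tget y E)) (tget z E)
  | FLt x y => tlt (tget x E) (tget y E)
  | FNot f => tif (ftree f S E V) Leaf tt1
  | FAnd f g => tif (ftree f S E V) (ftree g S E V) Leaf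
  | FEx x f => tcfold (fun v acc => tif (ftree f S (tset x v E) V) tt1 acc) tt1 Leaf V
  | FEq x y => tif (tlt (tget x E) (tget y E)) Leaf (tif (tlt (tget y E) (tget x E)) Leaf tt1)
  | FOr f g => tif (ftree f S E V) tt1 (ftree g S E V)
  | FImp f g => tif (ftree f S E V) (ftree g S E V) tt1
  | FIff f g => tif (ftree f S E V) (ftree g S E V) (tif (ftree g S E V) Leaf tt1)
  | FAll x f => tcfold (fun v acc => tif (ftree f S (tset x v E) V) acc Leaf) tt1 tt1 V
  end.

Lemma def_ftree f : def3 true (ftree f).
Proof. by elim: f => [k x y z|x y|f IH|f IHf g IHg|x f IH|x y|f IHf g IHg|f IHf g IHg|f IHf g IHg|x f IH];
  rewrite /def3 /=; ldefs. Qed.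

(** [F] is a state of the same format with all entries true, used as the clipping shape of the
    loops. *)
Fixpoint stree (s : stmt) (E V F S : tree) : tree :=
  match s with
  | SAsg k f => tupd k (tmap (fun x => tmap (fun y => tmap (fun z =>
      ftree f S (tset 0 x (tset 1 y (tset 2 z E))) V) V) V) V) S
  | SSeq s1 s2 => stree s2 E V F (stree s1 E V F S)
  | SFor x s => tcfold (fun v S' => stree s (tset x v E) V F S') F S V
  end.

Definition def4 r (f : tree -> tree -> tree -> tree -> tree) : Prop :=
  def r (fun p => f (tfst p) (tfst (tsnd p)) (tfst (tsnd (tsnd p))) (tsnd (tsnd (tsnd p)))).

Lemma def_app4 r f g h k l : def4 r f -> def r g -> def r h -> def r k -> def r l ->
  def r (fun a => f (g a) (h a) (k a) (l a)).
Proof.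
by move=> hf hg hh hk hl; apply: (def_app hf (def_node hg (def_node hh (def_node hk hl)))).
Qed.

Ltac def_step4 := cbv beta; match goal with
  |- def ?r (fun a => ?f (@?g a) (@?h a) (@?k a) (@?l a)) =>
     apply (@def_app4 r f g h k l); [solve [auto with defs]|..] end.

Lemma def_stree s : def4 true (stree s).
Proof.
have H := def_ftree.
by elim: s => [k f|s1 IH1 s2 IH2|x s IH]; rewrite /def4 /=;
  repeat first [ by auto with defs | def_step4 | def_step ].
Qed.

(** * Semantics of loop programs *)

Section Semantics.
Variable n : nat.
Local Notation V := 'I_n.+1.
Definition rel3 := V -> V -> V -> bool.
Definition rel0 : rel3 := fun _ _ _ => false.
Implicit Types (st : seq rel3) (env : nat -> V).

Definition eset (env : nat -> V) (x : nat) (v : V) : nat -> V := fun y => if y == x then v else env y.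
Definition slot st k : rel3 := nth rel0 st k.

Fixpoint upd (k : nat) (R : rel3) st : seq rel3 :=
  match st, k with
  | [::], _ => [::]
  | _ :: st, 0 => R :: st
  | R' :: st, k.+1 => R' :: upd k R st
  end.

Lemma size_upd k R st : size (upd k R st) = size st.
Proof. by elim: st k => [|R' st IH] [|k] //=; rewrite IH. Qed.

Lemma slot_upd k R st j : slot (upd k R st) j = if (j == k) && (k < size st) then R else slot st j.
Proof.
elim: st k j => [|R' st IH] [|k] [|j] //=; rewrite ?andbF ?eqSS ?ltnS //.
Qed.

Fixpoint fsem (f : form) st env : bool :=
  match f with
  | FR k x y z => slot st k (env x) (env y) (env z)
  | FLt x y => env x < env y
  | FNot f => ~~ fsem f st env
  | FAnd f g => fsem f st env && fsem g st env
  | FEx x f => [exists v, fsem f st (eset env x v)]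
  | FEq x y => env x == env y
  | FOr f g => fsem f st env || fsem g st env
  | FImp f g => fsem f st env ==> fsem g st env
  | FIff f g => fsem f st env == fsem g st env
  | FAll x f => [forall v, fsem f st (eset env x v)]
  end.

Definition env0 : nat -> V := fun=> ord0.

Fixpoint ssem (s : stmt) env st : seq rel3 :=
  match s with
  | SAsg k f => upd k (fun x y z => fsem f st (eset (eset (eset env 2 z) 1 y) 0 x)) st
  | SSeq s1 s2 => ssem s2 env (ssem s1 env st)
  | SFor x s => foldr (fun v st => ssem s (eset env x v) st) st (enum V)
  end.

Definition vcode (v : V) : tree := code_nat v.
Definition vlist : tree := tcons [seq vcode v | v <- enum V].
Definition cube (R : rel3) : tree :=
  tcons [seq tcons [seq tcons [seq code_bool (R x y z) | z <- enum V] | y <- enum V] | x <- enum V].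
Definition scode st : tree := tcons [seq cube R | R <- st].
Definition fullst (k : nat) : tree := scode (nseq k (fun _ _ _ => true)).
Definition enc (E : tree) env : Prop := forall x, tget x E = vcode (env x).

(* The default vertex is coded by [Leaf], so the empty environment tree codes [env0]. *)
Lemma enc0 : enc Leaf env0. Proof. by rewrite /enc; elim. Qed.

Lemma enc_set E env x v : enc E env -> enc (tset x (vcode v) E) (eset env x v).
Proof.
move=> h y; have -> : vcode (eset env x v y) = if y == x then vcode v else vcode (env y).
  by rewrite /eset; case: eqP.
by rewrite -(h y) {h env}; elim: x y E => [|x IH] [|y] E //=; rewrite eqSS IH.
Qed.

Lemma tnth_map (T : Type) (x0 : T) (f : T -> tree) s k : k < size s ->
  tnth (tcons [seq f x | x <- s]) (code_nat k) = f (nth x0 s k).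
Proof.
move=> hk; rewrite /tnth tlistK -[size _]/(nval _) code_natK.
by rewrite (nth_map x0).
Qed.

Lemma tnth_enum (f : V -> tree) v : tnth (tcons [seq f x | x <- enum V]) (vcode v) = f v.
Proof. by rewrite /vcode (@tnth_map _ ord0) ?size_enum_ord // nth_ord_enum. Qed.

Lemma tget_scode k st : tget k (scode st) = if k < size st then cube (slot st k) else Leaf.
Proof.
elim: st k => [|R st IH] k; first by rewrite ltn0; elim: k.
by case: k => //= k; rewrite IH.
Qed.

Lemma tupd_scode k R st : tupd k (cube R) (scode st) = scode (upd k R st).
Proof. by elim: st k => [|R' st IH] [|k] //=; congr Node; apply: IH. Qed.

Lemma tnth_leaf v : tnth Leaf v = Leaf. Proof. by rewrite /tnth /= nth_nil. Qed.

Lemma tlt_code a b : tlt (code_nat a) (code_nat b) = code_bool (a < b).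
Proof.
rewrite /tlt /tnth /tmap tlistK tlist_code -[size _]/(nval _) code_natK map_nseq nth_nseq.
by case: ltnP.
Qed.

Lemma clip_bool b : clip (code_bool b) tt1 = code_bool b. Proof. by case: b. Qed.

Lemma tlist_vlist : tlist vlist = [seq vcode v | v <- enum V]. Proof. exact: tlistK. Qed.

Lemma tmap_vlist f : tmap f vlist = tcons [seq f (vcode v) | v <- enum V].
Proof. by rewrite /tmap tlist_vlist -map_comp. Qed.

Lemma ftree_sem f st E env : enc E env ->
  ftree f (scode st) E vlist = code_bool (fsem f st env).
Proof.
elim: f E env => [k x y z|x y|f IH|f IHf g IHg|x f IH|x y|f IHf g IHg|f IHf g IHg|f IHf g IHg|x f IH]
  E env h /=.
- rewrite !h tget_scode; case: ltnP => hk; first by rewrite !tnth_enum.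
  by rewrite !tnth_leaf /slot nth_default.
- by rewrite !h tlt_code.
- by rewrite (IH _ _ h); case: fsem.
- by rewrite (IHf _ _ h) (IHg _ _ h); case: fsem.
- rewrite /tcfold tlist_vlist -[RHS]/(code_bool [exists v, _]).
  have -> : [exists v, fsem f st (eset env x v)] = has (fun v => fsem f st (eset env x v)) (enum V).
    by apply/existsP/hasP => [[v hv]|[v _ hv]]; exists v; rewrite ?mem_enum.
  elim: (enum V) => //= v s ->.
  by rewrite (IH _ _ (enc_set x v h)); case: fsem => //=; rewrite clip_bool.
- by rewrite !h !tlt_code -val_eqE /=; case: ltngtP.
- by rewrite (IHf _ _ h) (IHg _ _ h); case: fsem.
- by rewrite (IHf _ _ h) (IHg _ _ h); case: fsem.
- by rewrite (IHf _ _ h) (IHg _ _ h); case: fsem; case: fsem.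
rewrite /tcfold tlist_vlist.
have -> : [forall v, fsem f st (eset env x v)] = all (fun v => fsem f st (eset env x v)) (enum V).
  by apply/forallP/allP => [hv v _|hv v]; [|apply: hv; rewrite mem_enum].
elim: (enum V) => //= v s ->.
by rewrite (IH _ _ (enc_set x v h)); case: fsem => //=; rewrite clip_bool.
Qed.

Lemma clip_cube R : clip (cube R) (cube (fun _ _ _ => true)) = cube R.
Proof.
have H (T : Type) (f g : T -> tree) s : (forall x, clip (f x) (g x) = f x) ->
    clip (tcons [seq f x | x <- s]) (tcons [seq g x | x <- s]) = tcons [seq f x | x <- s].
  by move=> h; elim: s => //= x s ->; rewrite h.
by do 3!(apply: (H) => ?); rewrite clip_bool.
Qed.

Lemma clip_scode st : clip (scode st) (fullst (size st)) = scode st.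
Proof. by elim: st => //= R st IH; congr Node; [exact: clip_cube|exact: IH]. Qed.

Lemma size_ssem s env st : size (ssem s env st) = size st.
Proof.
elim: s env st => [k f|s1 IH1 s2 IH2|x s IH] env st /=; rewrite ?size_upd ?IH2 ?IH1 //.
by elim: (enum V) => //= v l IHl; rewrite IH.
Qed.

(** Statements preserve the format of a state, so clipping to the full state is harmless. *)
Theorem stree_sem s st E env : enc E env ->
  stree s E vlist (fullst (size st)) (scode st) = scode (ssem s env st).
Proof.
elim: s st E env => [k f|s1 IH1 s2 IH2|x s IH] st E env h /=.
- rewrite -tupd_scode; congr tupd.
  rewrite tmap_vlist; congr tcons; apply: eq_map => u.
  rewrite tmap_vlist; congr tcons; apply: eq_map => v.
  rewrite tmap_vlist; congr tcons; apply: eq_map => w.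
  exact: (ftree_sem f st (enc_set 0 u (enc_set 1 v (enc_set 2 w h)))).
- by rewrite (IH1 _ _ _ h) -{1}(size_ssem s1 env st) (IH2 _ _ _ h).
rewrite /tcfold tlist_vlist.
have : size (foldr (fun v st => ssem s (eset env x v) st) st (enum V)) = size st.
  by elim: (enum V) => //= v l IHl; rewrite size_ssem.
elim: (enum V) => //= v l IHl hs.
have hs' : size (foldr (fun v st => ssem s (eset env x v) st) st l) = size st by rewrite -hs size_ssem.
rewrite IHl // -{1}hs' (IH _ _ _ (enc_set x v h)) -{1}hs clip_scode.
by [].
Qed.

End Semantics.

(** * Computing the orientation *)

(* Relations of lower arity occupy ternary slots by repeating a variable. *)
Definition fE x y := FR 0 x y y.
Definition fI x := FR 1 x x x.
Definition fG i j := FR 2 i j j.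
Definition fnt := FR 3.
Definition fside := FR 4.
Definition fD := FR 5.
Definition fhigh t x := FR 6 t x x.
Definition fpar x y := FR 7 x y y.
Definition fM x y := FR 8 x y y.
Definition fsame x y := FR 9 x y y.

(** Variables 0, 1, 2 index the entry being written, 3 to 8 belong to loops, and those from 10 on
    are bound by quantifiers. *)
Definition greedy_form : form :=
  FOr (fI 0) (FAnd (FEq 0 3) (FNot (FEx 10 (FAnd (fI 10) (fE 3 10))))).

Definition priv_form i j u := FAnd (fI i) (FAnd (fI j) (FAnd (fE i u) (FNot (fE j u)))).
Definition ntriv_form :=
  FAnd (priv_form 0 1 2) (FEx 10 (FAnd (priv_form 1 0 10) (fE 2 10))).
Definition samelab_form :=
  FEx 10 (FAnd (FAnd (fnt 0 1 10) (FAll 11 (FImp (FLt 11 10) (FNot (fnt 0 1 11)))))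
    (FEx 12 (FAnd (priv_form 1 0 12) (FAnd (fE 2 12) (fE 10 12))))).
Definition side_form := FAnd (fnt 0 1 2) (FNot (FIff samelab_form (fG 0 1))).
Definition forced_form :=
  FEx 10 (FAnd (fnt 0 10 1) (FAnd (fnt 0 10 2) (FAnd (fE 1 2)
    (FAnd (FIff (fside 0 10 1) (fside 0 10 2))
    (FEx 11 (FAnd (priv_form 10 0 11)
      (FAnd (FImp (fside 0 10 1) (FAnd (fE 2 11) (FNot (fE 1 11))))
            (FImp (FNot (fside 0 10 1)) (FAnd (fE 1 11) (FNot (fE 2 11))))))))))).

Definition varrow_form i u v := FAnd (fI i) (FAnd (fE i u) (FAnd (fE i v) (FNot (FEq u v)))).
Definition vforce_form i u v w :=
  FAnd (varrow_form i u v) (FAnd (varrow_form i u w) (FAnd (FNot (FEq v w))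
    (FOr (FAnd (FIff (fE u v) (fE u w)) (FNot (FIff (fE u v) (fE v w))))
      (FEx 11 (FAnd (FAnd (fI 11) (FAnd (fE 11 v) (FAnd (fE 11 w) (FNot (fE 11 u)))))
         (FAnd (fE u v) (fE u w))))))).
Definition close_form :=
  FOr (fD 0 1 2) (FOr (FEx 10 (FAnd (fD 0 1 10) (fD 0 10 2)))
  (FOr (FEx 10 (FAnd (fD 10 1 2) (FAnd (varrow_form 10 1 2) (FAnd (varrow_form 0 1 2) (fE 1 2)))))
  (FOr (FEx 10 (FAnd (fD 0 1 10) (vforce_form 0 1 10 2)))
       (FEx 10 (FAnd (fD 0 10 2) (vforce_form 0 2 10 1)))))).
(** The three loops repeat the round once for every triple that could still be added. *)
Definition close_stmt := SFor 6 (SFor 7 (SFor 8 (SAsg 5 close_form))).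
Definition add_form :=
  FOr (fD 0 1 2) (FAnd (FAnd (FEq 0 3) (FAnd (FEq 1 4) (FEq 2 5)))
    (FAnd (varrow_form 0 1 2) (FAnd (FNot (fD 0 1 2)) (FNot (fD 0 2 1))))).
Definition decide_stmt := SFor 3 (SFor 4 (SFor 5 (SSeq (SAsg 5 add_form) close_stmt))).

Definition samesig_form x y := FAll 12 (FImp (fI 12) (FIff (fE 12 x) (fE 12 y))).
Definition own_form u i := FAnd (fI i) (FAnd (fE i u)
  (FAll 12 (FImp (FLt 12 i) (FNot (FAnd (fI 12) (fE 12 u)))))).
Definition par_form :=
  FAnd (FNot (fI 0)) (FAnd (FNot (fI 1)) (FAnd (FNot (FEq 0 1)) (FAnd (FNot (fE 0 1))
    (FAnd (samesig_form 0 1) (FEx 10 (FAnd (own_form 0 10) (fD 10 0 1))))))).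
(** Heights are antitone in [t], so asking for all smaller ones replaces asking for the predecessor
    of [t], and [t = 0] needs no case of its own. *)
Definition high_form :=
  FEx 10 (FAnd (fpar 10 1) (FAll 11 (FImp (FLt 11 0) (fhigh 11 10)))).
Definition common_form u w c := FAnd (fI c) (FAnd (fE c u) (fE c w)).
Definition orient_form :=
  FAnd (fE 0 1) (FOr (fI 0) (FAnd (FNot (fI 0)) (FAnd (FNot (fI 1))
    (FOr (FEx 10 (FAnd (FAnd (common_form 0 1 10)
                    (FAll 11 (FImp (FLt 11 10) (FNot (common_form 0 1 11))))) (fD 10 0 1)))
         (FAnd (FNot (FEx 10 (common_form 0 1 10)))
           (FEx 10 (FEx 11 (FAnd (own_form 0 10) (FAnd (own_form 1 11) (FNot (fside 10 11 0))))))))))).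
Definition same_form :=
  FOr (FEq 0 1) (FAnd (FNot (fI 0)) (FAnd (FNot (fI 1)) (FAnd (samesig_form 0 1)
    (FAnd (FAll 10 (FAll 11 (FImp (FAnd (own_form 0 10) (fI 11))
       (FAnd (FIff (fnt 10 11 0) (fnt 10 11 1)) (FIff (fside 10 11 0) (fside 10 11 1))))))
     (FAll 10 (FIff (fhigh 10 0) (fhigh 10 1))))))).
Definition sle_form x y := FAnd (fsame x y) (FOr (FEq x y) (fM x y)).
Definition ok_form :=
  FAnd (FAll 10 (FAll 11 (FIff (fE 10 11) (FOr (fM 10 11) (fM 11 10)))))
  (FAnd (FAll 10 (FAll 11 (FImp (FAnd (fsame 10 11) (FNot (FEq 10 11))) (fE 10 11))))
  (FAnd (FAll 10 (FAll 11 (FAll 12 (FAll 13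
     (FImp (FAnd (sle_form 12 10) (FAnd (sle_form 11 13) (fM 10 11))) (fM 12 13))))))
  (FAll 10 (FAll 11 (FAll 12 (FImp (FAnd (fpar 10 11) (fpar 11 12)) (fpar 10 12))))))).

Definition greedy_stmt := SFor 3 (SAsg 1 greedy_form).
Definition high_stmt := SFor 3 (SAsg 6 high_form).
Definition attempt_stmt :=
  SSeq (SAsg 3 ntriv_form) (SSeq (SAsg 4 side_form) (SSeq (SAsg 5 forced_form)
  (SSeq close_stmt (SSeq decide_stmt (SSeq (SAsg 7 par_form) (SSeq high_stmt
  (SSeq (SAsg 8 orient_form) (SSeq (SAsg 9 same_form) (SAsg 10 ok_form))))))))).

Arguments slot : simpl never.
Arguments upd : simpl never.

(** * Invariants of nested loops *)

Section Loops.
Variable n : nat.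
Local Notation V := 'I_n.+1.
Local Notation state := (seq (rel3 n)).

(** Counts runs of the body: each level of nesting multiplies the guaranteed progress by the number
    of vertices. *)
Lemma for_add (Q : nat -> state -> Prop) c x s :
  (forall env k st, Q k st -> Q (c + k) (ssem s env st)) ->
  forall env k st, Q k st -> Q (n.+1 * c + k) (ssem (SFor x s) env st).
Proof.
move=> h env k st hq /=; rewrite -[in n.+1 * c](size_enum_ord n.+1).
by elim: (enum V) => //= v l IH; rewrite mulSn -addnA; apply: h.
Qed.

(** For loops that settle one instance per vertex; [le] is a preorder along which settled instances
    persist. *)
Lemma for_est (Inv : state -> Prop) (le : state -> state -> Prop) (R : (nat -> V) -> state -> Prop) x s :
  (forall st, le st st) -> (forall st1 st2 st3, le st1 st2 -> le st2 st3 -> le st1 st3) ->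
  (forall env st st', le st st' -> R env st -> R env st') ->
  (forall env st, Inv st -> let st' := ssem s env st in [/\ Inv st', le st st' & R env st']) ->
  forall env st, Inv st -> let st' := ssem (SFor x s) env st in
    [/\ Inv st', le st st' & forall v, R (eset env x v) st'].
Proof.
move=> hr ht hm h env st hi /=.
suff [h1 h2 h3] : let st' := foldr (fun v st => ssem s (eset env x v) st) st (enum V) in
    [/\ Inv st', le st st' & forall v, v \in enum V -> R (eset env x v) st'].
  by split=> // v; apply: h3; rewrite mem_enum.
elim: (enum V) => [|v l /= [h1 h2 h3]] //=.
have [k1 k2 k3] := h (eset env x v) _ h1; split=> //; first exact: ht k2.
by move=> w; rewrite inE => /orP[/eqP ->|/h3 hw] //; apply: hm k2 hw.
Qed.

End Loops.

(** * Correctness of the loop programs *)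

Section Program.
Variable n : nat.
Local Notation V := 'I_n.+1.
Local Notation state := (seq (rel3 n)).
Implicit Types (st : state) (env : nat -> V).

Definition keeps k st st' : Prop := size st' = size st /\ forall j, j <> k -> slot st' j = slot st j.

Lemma keeps_refl k st : keeps k st st. Proof. by []. Qed.

Lemma keeps_trans k st1 st2 st3 : keeps k st1 st2 -> keeps k st2 st3 -> keeps k st1 st3.
Proof. by move=> [h1 h2] [h3 h4]; split=> [|j hj]; rewrite ?h3 ?h4 ?h2. Qed.

Lemma keeps_upd k R st : keeps k st (upd k R st).
Proof.
by split=> [|j hj]; rewrite ?size_upd // slot_upd; case: eqP.
Qed.

Lemma slot_same k R st : k < size st -> slot (upd k R st) k = R.
Proof. by move=> h; rewrite slot_upd eqxx h. Qed.

Definition edge (st : state) : rel V := fun x y => slot st 0 x y y.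
Definition indp (st : state) : pred V := fun x => slot st 1 x x x.
Definition guess (st : state) : V -> V -> bool := fun i j => slot st 2 i j j.

Lemma edge_keeps k st st' : keeps k st st' -> k <> 0 -> edge st' = edge st.
Proof. by move=> [_ h] hk; rewrite /edge h //; apply: nesym. Qed.

Lemma indp_keeps k st st' : keeps k st st' -> k <> 1 -> indp st' = indp st.
Proof. by move=> [_ h] hk; rewrite /indp h //; apply: nesym. Qed.

Lemma greedyP env st : 1 < size st -> indp st =1 xpred0 -> symmetric (edge st) -> irreflexive (edge st) ->
  let st' := ssem greedy_stmt env st in
  [/\ keeps 1 st st', forall i j, indp st' i -> indp st' j -> ~~ edge st i j &
   forall u, indp st' u \/ exists2 i, indp st' i & edge st i u].
Proof.
move=> hs h0 hsym hirr /=.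
pose Inv st1 := keeps 1 st st1 /\ forall i j, indp st1 i -> indp st1 j -> ~~ edge st i j.
pose le (st1 st2 : state) := forall u, indp st1 u -> indp st2 u.
pose R env st1 := indp st1 (env 3) \/ exists2 i, indp st1 i & edge st i (env 3).
have [|||||[h1 h2] h3 h4] := @for_est n Inv le R 3 (SAsg 1 greedy_form) _ _ _ _ env st.
- by move=> ? ?.
- by move=> s1 s2 s3 l1 l2 u /l1/l2.
- by move=> env1 s1 s2 l1 [/l1|[i /l1 hi hu]]; [left|right; exists i].
- move=> env1 st1 [k1 k2] st2.
  have hs1 : 1 < size st1 by case: k1 => ->.
  have E : indp st2 =1 fun u => indp st1 u || ((u == env1 3) &&
      ~~ [exists i, indp st1 i && edge st (env1 3) i]).
    by move=> u; rewrite -(edge_keeps k1) // /indp /st2 /= slot_same.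
  split.
  - split; first exact: keeps_trans k1 (keeps_upd _ _ _).
    move=> i j; rewrite !E => /orP[hi|/andP[/eqP -> /existsPn hi]] /orP[hj|/andP[/eqP -> /existsPn hj]].
    - exact: k2.
    - by have := hj i; rewrite hi hsym.
    - by have := hi j; rewrite hj.
    - by rewrite hirr.
  - by move=> u hu; rewrite E hu.
  rewrite /R E eqxx /=; case: (boolP [exists i, _]) => [/existsP[i /andP[h1 h2]]|_].
    by right; exists i; rewrite ?E ?h1 // hsym.
  by left; rewrite orbT.
- by split=> // i j; rewrite h0.
split=> // u; have := h4 u; rewrite /R /eset eqxx; exact.
Qed.

Section Closure.
Variables (e : rel V) (I : pred V).
Definition vforceb (i u v w : V) : bool :=
  [&& varrow e I i u v, varrow e I i u w, v != w &
   (e u v == e u w) && ~~ (e u v == e v w) ||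
   [exists j, [&& I j, e j v, e j w & ~~ e j u] && (e u v && e u w)]].

Lemma vforceP i u v w : reflect (vforce e I i u v w) (vforceb i u v w).
Proof.
apply: (iffP and4P) => [[h1 h2 /eqP h3 h4]|[h1 h2 h3 h4]].
  split=> //; case/orP: h4 => [/andP[/eqP h4 /eqP h5]|/existsP[j /andP[/and4P[a b c d] /andP[f g]]]].
    by left.
  by right; exists j.
split=> //; first exact/eqP.
apply/orP; case: h4 => [[/eqP -> /eqP ->]|[j [[a b c d] [f g]]]]; first by left.
by right; apply/existsP; exists j; rewrite a b c d f g.
Qed.

Definition cstep (D : V -> V -> V -> bool) (i x y : V) : bool :=
  D i x y || ([exists z, D i x z && D i z y] ||
  ([exists j, [&& D j x y, varrow e I j x y, varrow e I i x y & e x y]] ||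
  ([exists w, D i x w && vforceb i x w y] || [exists w, D i w y && vforceb i y w x]))).

Definition tclosed (D : V -> V -> V -> Prop) : Prop :=
  aclosed e I D /\ forall i u v w, D i u v -> D i v w -> D i u w.

Lemma cstep_fix D : (forall i x y, cstep D i x y -> D i x y) -> tclosed (fun i x y => D i x y).
Proof.
move=> h; split=> [i u v j x y|i u v w h1 h2].
  case=> {i u v j x y} [i j u v h1 h2 h3|i u v w h1|i u v w h1] d; apply: h; rewrite /cstep.
  - by apply/or4P/Or43; apply/existsP; exists i; rewrite d h1 h2.
  - apply/orP; right; apply/or4P/Or43; apply/existsP; exists v; rewrite d; exact/vforceP.
  - apply/orP; right; apply/or4P/Or44; apply/existsP; exists v; rewrite d; exact/vforceP.
by apply: h; apply/or3P/Or32; apply/existsP; exists v; rewrite h1.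
Qed.

Lemma cstep_sub (D : V -> V -> V -> bool) X : tclosed X -> (forall i x y, D i x y -> X i x y) ->
  forall i x y, cstep D i x y -> X i x y.
Proof.
move=> [h1 h2] h i x y; rewrite /cstep => /orP[/h //|/or4P[]/existsP[z]].
- by case/andP=> /h a /h b; apply: h2 a b.
- by case/and4P=> /h a b c d; apply: h1 a; apply: StepL.
- by case/andP=> /h a /vforceP b; apply: h1 a; apply: StepF.
- by case/andP=> /h a /vforceP b; apply: h1 a; apply: StepG.
Qed.
End Closure.

(** A round either adds a triple or has reached a fixed point. With as many rounds as triples, a
    relation that grew each time is full, hence a fixed point too. *)
Lemma closeP env st : 5 < size st -> let st' := ssem close_stmt env st in
  [/\ keeps 5 st st', forall i x y, slot st 5 i x y -> slot st' 5 i x y,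
    tclosed (edge st) (indp st) (fun i x y => slot st' 5 i x y) &
    forall X, tclosed (edge st) (indp st) X -> (forall i x y, slot st 5 i x y -> X i x y) ->
      forall i x y, slot st' 5 i x y -> X i x y].
Proof.
move=> hs st'.
pose card st1 := #|[set t : V * V * V | slot st1 5 t.1.1 t.1.2 t.2]|.
pose fx st1 := forall i x y, cstep (edge st) (indp st) (slot st1 5) i x y -> slot st1 5 i x y.
pose Q k st1 := [/\ keeps 5 st st1, forall i x y, slot st 5 i x y -> slot st1 5 i x y,
   fx st1 \/ k <= card st1 &
    forall X, tclosed (edge st) (indp st) X -> (forall i x y, slot st 5 i x y -> X i x y) ->
      forall i x y, slot st1 5 i x y -> X i x y].
have body env1 k st1 : Q k st1 -> Q (1 + k) (ssem (SAsg 5 close_form) env1 st1).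
  case=> k1 k2 k3 k4; have hs1 : 5 < size st1 by case: k1 => ->.
  set st2 := ssem _ _ _.
  have E : slot st2 5 = cstep (edge st) (indp st) (slot st1 5).
    by rewrite -(edge_keeps k1) // -(indp_keeps k1) // /st2 /= slot_same.
  have inc i x y : slot st1 5 i x y -> slot st2 5 i x y by rewrite E /cstep => ->.
  split.
  - exact: keeps_trans k1 (keeps_upd _ _ _).
  - by move=> i x y /k2/inc.
  - have [F|F] := boolP [forall i, forall x, forall y, slot st2 5 i x y ==> slot st1 5 i x y].
      left; have E2 : slot st2 5 = slot st1 5.
        apply: functional_extensionality => i; apply: functional_extensionality => x.
        apply: functional_extensionality => y; apply/idP/idP; last exact: inc.
        by move: F => /forallP/(_ i)/forallP/(_ x)/forallP/(_ y)/implyP.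
      by rewrite /fx E2 -E E2.
    case: k3 => k3.
      case/negP: F; apply/forallP => i; apply/forallP => x; apply/forallP => y; apply/implyP.
      by rewrite E; apply: k3.
    right; rewrite add1n; apply: leq_ltn_trans k3 _; apply: proper_card; apply/properP; split.
      by apply/subsetP => t; rewrite !inE; apply: inc.
    case/forallPn: F => i /forallPn[x /forallPn[y]]; rewrite negb_imply => /andP[f1 f2].
    by exists (i, x, y); rewrite !inE.
  move=> X hX hX' i x y; rewrite E; apply: cstep_sub => // a b c; exact: k4.
have q0 : Q 0 st by split=> //; right.
have := for_add 6 (for_add 7 (for_add 8 body)) env q0.
rewrite -/close_stmt -/st' => -[h1 h2 h3 h4]; split=> //; apply: cstep_fix.
case: h3 => // h3 i x y _.
have : [set t : V * V * V | slot st' 5 t.1.1 t.1.2 t.2] == setT.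
  by rewrite eqEcard subsetT cardsT !card_prod !card_ord; move: h3; rewrite /card; lia.
by move/eqP/setP/(_ (i, x, y)); rewrite !inE.
Qed.

(** The computed closure is the least closed transitive relation containing the new pair, so it lies
    inside the one supplied by [extend] and inherits irreflexivity from it. *)
Lemma decideP env st : 5 < size st -> symmetric (edge st) ->
  (forall i u v, varrow (edge st) (indp st) i u v -> ~ eqv (edge st) (indp st) i u v i v u) ->
  good (edge st) (indp st) (fun i x y => slot st 5 i x y) -> (forall i x, ~ slot st 5 i x x) ->
  let st' := ssem decide_stmt env st in
  [/\ forall i x y, slot st 5 i x y -> slot st' 5 i x y,
    good (edge st) (indp st) (fun i x y => slot st' 5 i x y), forall i x, ~ slot st' 5 i x x &
    forall i x y, varrow (edge st) (indp st) i x y -> slot st' 5 i x y \/ slot st' 5 i y x].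
Proof.
move=> hs hsym ninv hg hirr st'.
pose Inv st1 := [/\ keeps 5 st st1, good (edge st) (indp st) (fun i x y => slot st1 5 i x y) &
  forall i x, ~ slot st1 5 i x x].
pose le (st1 st2 : state) := forall i x y, slot st1 5 i x y -> slot st2 5 i x y.
pose R env st1 := varrow (edge st) (indp st) (env 3) (env 4) (env 5) ->
   slot st1 5 (env 3) (env 4) (env 5) \/ slot st1 5 (env 3) (env 5) (env 4).
have le_refl st1 : le st1 st1 by [].
have le_trans st1 st2 st3 : le st1 st2 -> le st2 st3 -> le st1 st3.
  by move=> h1 h2 i x y /h1/h2.
have R_mono env1 st1 st2 : le st1 st2 -> R env1 st1 -> R env1 st2.
  by move=> h1 h2 /h2[/h1|/h1]; [left|right].
have body env1 st1 : Inv st1 -> let st3 := ssem (SSeq (SAsg 5 add_form) close_stmt) env1 st1 in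
    [/\ Inv st3, le st1 st3 & R env1 st3].
  case=> k1 g1 i1; rewrite /=; set st2 := upd 5 _ st1; set st3 := ssem close_stmt env1 st2.
  have hs1 : 5 < size st1 by case: k1 => ->.
  have k2 : keeps 5 st1 st2 by apply: keeps_upd.
  pose new i x y := [&& i == env1 3, x == env1 4 & y == env1 5] &&
    [&& varrow (edge st) (indp st) i x y, ~~ slot st1 5 i x y & ~~ slot st1 5 i y x].
  have E2 i x y : slot st2 5 i x y = slot st1 5 i x y || new i x y.
    by rewrite /new -(edge_keeps k1) // -(indp_keeps k1) // /st2 slot_same.
  have [X [gX iX hX]] : exists X, [/\ good (edge st) (indp st) X, forall i x, ~ X i x x &
      forall i x y, slot st2 5 i x y -> X i x y].
    have [h|h] := boolP (new (env1 3) (env1 4) (env1 5)).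
      have /and4P[_ h1 /negP h2 /negP h3] := h.
      have [X [gX iX hX nX]] := extend hsym ninv g1 i1 h1 h2 h3.
      exists X; split=> // i x y; rewrite E2 => /orP[/hX //|/andP[/and3P[/eqP -> /eqP -> /eqP ->] _]].
      exact: nX.
    exists (fun i x y => slot st1 5 i x y); split=> // i x y; rewrite E2 => /orP[//|h'].
    by move: (h'); case/andP: h' => /and3P[/eqP -> /eqP -> /eqP ->] _ h'; rewrite h' in h.
  have [c1 c2 c3 c4] := @closeP env1 st2 (leq_trans hs1 (eq_leq (esym k2.1))).
  rewrite (edge_keeps k2) // (indp_keeps k2) // (edge_keeps k1) // (indp_keeps k1) // in c3 c4.
  have {}c4 i x y : slot st3 5 i x y -> X i x y.
    by apply: c4 => //; case: gX.
  have l13 : le st1 st3 by move=> i x y h; apply: c2; rewrite E2 h.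
  split=> //.
    split.
    - by apply: keeps_trans k1 (keeps_trans k2 c1).
    - by case: c3 => c3 c3'; split=> // i x y /c4; case: gX => h _ _; apply: h.
    - by move=> i x /c4; apply: iX.
  move=> hv; have [/l13|h1] := boolP (slot st1 5 (env1 3) (env1 4) (env1 5)); first by left.
  have [/l13|h2] := boolP (slot st1 5 (env1 3) (env1 5) (env1 4)); first by right.
  by left; apply: c2; rewrite E2 /new !eqxx hv h1 h2 orbT.
have L1 := for_est 5 le_refl le_trans R_mono body.
have M1 env1 st1 st2 : le st1 st2 -> (forall v, R (eset env1 5 v) st1) -> forall v, R (eset env1 5 v) st2.
  by move=> h1 h2 v; apply: R_mono (h2 v).
have L2 := for_est 4 le_refl le_trans M1 L1.
have M2 env1 st1 st2 : le st1 st2 -> (forall v w, R (eset (eset env1 4 v) 5 w) st1) ->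
    forall v w, R (eset (eset env1 4 v) 5 w) st2.
  by move=> h1 h2 v w; apply: R_mono (h2 v w).
have L3 := for_est 3 le_refl le_trans M2 L2.
have [|[h1 h2 h3] h4 h5] := L3 env st; first by split.
by split=> // i x y; apply: (h5 i x y).
Qed.

Lemma high_anti (e : rel V) I D s t x : s <= t -> high e I D t x -> high e I D s x.
Proof.
elim: s t x => [|s IH] [|t] x //= hst /existsP[y /andP[h1 h2]]; apply/existsP; exists y; rewrite h1 //=.
exact: IH h2.
Qed.

Lemma highP (e : rel V) I D env st : 6 < size st -> (forall x y, slot st 7 x y y = par e I D x y) ->
  let st' := ssem high_stmt env st in
  keeps 6 st st' /\ forall (t x z : V), slot st' 6 t x z = high e I D t x.
Proof.
move=> hs hp /=.
pose Q k st1 := keeps 6 st st1 /\ forall (t x z : V), t < k -> slot st1 6 t x z = high e I D t x.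
suff body env1 k st1 : Q k st1 -> Q (1 + k) (ssem (SAsg 6 high_form) env1 st1).
  have [|h1 h2] := for_add 3 body env (k := 0) (st := st); first by split.
  by split=> // t x z; apply: h2; rewrite muln1 addn0.
case=> k1 h1; split; first exact: keeps_trans k1 (keeps_upd _ _ _).
have hs1 : 6 < size st1 by case: k1 => ->.
move=> t x z ht; rewrite /= slot_same //.
transitivity [exists y, slot st1 7 y x x && [forall s : V, (s < t) ==> slot st1 6 s y y]]; first by [].
have E7 : slot st1 7 = slot st 7 by case: k1 => _ ->.
have -> : high e I D t x = [exists y, par e I D y x && (if t : nat is t'.+1 then high e I D t' y else true)].
  by case: (t : nat).
apply: eq_existsb => y; rewrite E7 hp; congr andb.
apply/forallP/idP => [h|h s].
  case E : (t : nat) => [//|t'].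
  have ht' : t' < n.+1 by have := ltn_ord t; rewrite E; lia.
  by have := h (Ordinal ht'); rewrite /= E ltnSn /= h1 //=; lia.
apply/implyP => hst; rewrite h1; last by lia.
by case E : (t : nat) h => [|t'] h; [lia|apply: high_anti h; lia].
Qed.

Lemma slot_asg k f env st : k < size st -> slot (ssem (SAsg k f) env st) k =
  fun x y z => fsem f st (eset (eset (eset env 2 z) 1 y) 0 x).
Proof. exact: slot_same. Qed.

Lemma keeps_asg k f env st : keeps k st (ssem (SAsg k f) env st).
Proof. exact: keeps_upd. Qed.

Lemma ssem_seq s1 s2 env st : ssem (SSeq s1 s2) env st = ssem s2 env (ssem s1 env st).
Proof. by []. Qed.

Lemma keeps_for k s x env st : (forall env st, keeps k st (ssem s env st)) -> keeps k st (ssem (SFor x s) env st).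
Proof.
move=> h; rewrite /=; elim: (enum V) => [|v l IH]; first exact: keeps_refl.
exact: keeps_trans IH (h _ _).
Qed.

(** Whatever the guess, the final slots describe the check for the relation [D] actually computed.
    Given a diagram that matches the guess, the check succeeds. *)
Theorem attemptP env st : size st = 11 -> symmetric (edge st) -> irreflexive (edge st) ->
  let e := edge st in let I := indp st in let G := guess st in
  let st' := ssem attempt_stmt env st in
  exists D, [/\ forall x y, slot st' 8 x y y = orient e I G D x y,
    forall x y, slot st' 9 x y y = same e I G D x y,
    forall x y z, slot st' 10 x y z = cert_ok e I G D &
    forall l r : V -> nat, (forall u, l u < r u) -> injective l -> injective r ->
      (forall u v, l u <> r v) -> (forall u v, e u v = overlap l r u v) ->
      (forall i j, I i -> I j -> ~~ e i j) -> (forall u, I u \/ exists2 i, I i & e i u) ->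
      (forall i j v, fstnt e I i j v -> G i j = ~~ top l r i j v) -> cert_ok e I G D].
Proof.
move=> hs hsym hirr e I G; rewrite /attempt_stmt !ssem_seq.
set st1 := ssem (SAsg 3 ntriv_form) env st.
set st2 := ssem (SAsg 4 side_form) env st1.
set st3 := ssem (SAsg 5 forced_form) env st2.
set st4 := ssem close_stmt env st3.
set st5 := ssem decide_stmt env st4.
set st6 := ssem (SAsg 7 par_form) env st5.
set st7 := ssem high_stmt env st6.
set st8 := ssem (SAsg 8 orient_form) env st7.
set st9 := ssem (SAsg 9 same_form) env st8.
set st10 := ssem (SAsg 10 ok_form) env st9.
have k1 : keeps 3 st st1 by apply: keeps_asg.
have hs1 : size st1 = 11 by rewrite k1.1.
have S1 j : j <> 3 -> slot st1 j = slot st j by apply: k1.2.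
have N1 : slot st1 3 = ntriv e I by rewrite slot_asg ?hs.
clearbody st1.
have k2 : keeps 4 st1 st2 by apply: keeps_asg.
have hs2 : size st2 = 11 by rewrite k2.1.
have S2 j : j <> 4 -> slot st2 j = slot st1 j by apply: k2.2.
have N2 : slot st2 4 = side e I G.
  by rewrite slot_asg ?hs1 //= !N1 ?S1.
clearbody st2.
have k3 : keeps 5 st2 st3 by apply: keeps_asg.
have hs3 : size st3 = 11 by rewrite k3.1.
have S3 j : j <> 5 -> slot st3 j = slot st2 j by apply: k3.2.
have N3 : slot st3 5 = forced e I G.
  by rewrite slot_asg ?hs2 //= !N2 !S2 // !N1 !S1.
clearbody st3.
have [k4 c1 c2 c3] := @closeP env st3 (leq_trans (isT : 5 < 11) (eq_leq (esym hs3))).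
rewrite -/st4 in k4 c1 c2 c3.
have hs4 : size st4 = 11 by rewrite k4.1.
have S4 j : j <> 5 -> slot st4 j = slot st3 j by apply: k4.2.
clearbody st4.
have k5 : keeps 5 st4 st5.
  do 3!(apply: keeps_for => ? ?); rewrite ssem_seq; apply: keeps_trans (keeps_asg _ _ _ _) _.
  by do 3!(apply: keeps_for => ? ?); apply: keeps_asg.
have hs5 : size st5 = 11 by rewrite k5.1.
have S5 j : j <> 5 -> slot st5 j = slot st4 j by apply: k5.2.
have E3 : edge st3 = e by rewrite /edge S3 // S2 // S1.
have I3 : indp st3 = I by rewrite /indp S3 // S2 // S1.
have E4 : edge st4 = e by rewrite /edge S4.
have I4 : indp st4 = I by rewrite /indp S4.
rewrite E3 I3 N3 in c1 c2 c3.
have hd := @decideP env st4; rewrite -/st5 hs4 E4 I4 in hd.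
have {}hd := hd isT hsym.
clearbody st5.
pose D := slot st5 5.
have N5 j : j < 3 -> slot st5 j = slot st j.
  by case: j => [|[|[|]]] // _; rewrite S5 // S4 // S3 // S2 // S1.
have N5' : slot st5 3 = ntriv e I by rewrite S5 // S4 // S3 // S2.
have N5'' : slot st5 4 = side e I G by rewrite S5 // S4 // S3.
have k6 : keeps 7 st5 st6 by apply: keeps_asg.
have hs6 : size st6 = 11 by rewrite k6.1.
have S6 j : j <> 7 -> slot st6 j = slot st5 j by apply: k6.2.
have N6 x y z : slot st6 7 x y z = par e I D x y.
  by rewrite slot_asg ?hs5 //= !(N5 0) // !(N5 1).
clearbody st6.
have [k7 N7] := @highP e I D env st6 (leq_trans (isT : 6 < 11) (eq_leq (esym hs6))) (fun x y => N6 x y y).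
rewrite -/st7 in k7 N7.
have hs7 : size st7 = 11 by rewrite k7.1.
have S7 j : j <> 6 -> slot st7 j = slot st6 j by apply: k7.2.
clearbody st7.
have {}N7 : slot st7 6 = fun t x _ => high e I D t x.
  by do 3!apply: functional_extensionality => ?; apply: N7.
have {}N6 : slot st7 7 = fun x y _ => par e I D x y.
  by rewrite S7 //; do 3!apply: functional_extensionality => ?; apply: N6.
have {}N5 j : j < 3 -> slot st7 j = slot st j.
  by move=> hj; rewrite S7 ?S6 ?N5 //; move=> E; rewrite E in hj.
have {}N5' : slot st7 3 = ntriv e I by rewrite S7 // S6.
have {}N5'' : slot st7 4 = side e I G by rewrite S7 // S6.
have N5D : slot st7 5 = D by rewrite S7 // S6.
have k8 : keeps 8 st7 st8 by apply: keeps_asg.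
have hs8 : size st8 = 11 by rewrite k8.1.
have S8 j : j <> 8 -> slot st8 j = slot st7 j by apply: k8.2.
have N8 : slot st8 8 = fun x y _ => orient e I G D x y.
  by rewrite slot_asg ?hs7 //= !(N5 0) // !(N5 1) // !N5'' N5D.
clearbody st8.
have k9 : keeps 9 st8 st9 by apply: keeps_asg.
have hs9 : size st9 = 11 by rewrite k9.1.
have S9 j : j <> 9 -> slot st9 j = slot st8 j by apply: k9.2.
have N9 : slot st9 9 = fun x y _ => same e I G D x y.
  by rewrite slot_asg ?hs8 //= !S8 // !(N5 0) // !(N5 1) // !N5' !N5'' N7.
clearbody st9.
have k10 : keeps 10 st9 st10 by apply: keeps_asg.
have S10 j : j <> 10 -> slot st10 j = slot st9 j by apply: k10.2.
have N10 : slot st10 10 = fun _ _ _ => cert_ok e I G D.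
  by rewrite slot_asg ?hs9 //= !N9 !S9 // !N8 !S8 // !N6 !(N5 0).
clearbody st10.
exists D; split.
- by move=> x y; rewrite S10 // S9 // N8.
- by move=> x y; rewrite S10 // N9.
- by move=> x y z; rewrite N10.
move=> l r lr linj rinj l_r eE iI mI hG.
have hgood : good e I (fun i x y => horder e I l r i x y).
  split; [by move=> i u v /andP[]|exact: horder_closed|move=> i u v w; exact: horder_trans].
(* The closure of the forced pairs stays inside the order of the diagram, hence is irreflexive, as
   [decideP] requires. *)
have c4 i x y : slot st4 5 i x y -> horder e I l r i x y.
  apply: (c3 (fun i x y => horder e I l r i x y)); first by case: hgood.
  exact: (forced_horder lr linj rinj l_r eE iI hG).
have ninv i u v : varrow e I i u v -> ~ eqv e I i u v i v u.
  by apply: (@horder_noinv _ e I l r).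
have [] := hd ninv.
- by case: c2 => c2 c2'; split=> // i u v /c4/andP[].
- by move=> i x /c4; rewrite (negbTE (horder_irr _ _ _ _ _ _)).
move=> d1 d2 d3 d4.
apply: (cert_pass lr linj rinj l_r eE iI mI hG (D := D)) => //.
by move=> i x y h; apply: d1; apply: c1.
Qed.
End Program.

(** * Quantifier elimination *)

Definition tcat (x y : tree) : tree := tfold (fun h acc => Node h acc) y x.
Definition tflat (l : tree) : tree := tfold (fun h acc => tcat h acc) Leaf l.

Lemma def_tcat : def2 false tcat. Proof. by rewrite /def2 /tcat; ldefs. Qed.
#[export] Hint Resolve def_tcat : defs.
Lemma def_tflat : def false tflat. Proof. by rewrite /tflat; ldefs. Qed.
#[export] Hint Resolve def_tflat : defs.

Lemma tlist_tcat x y : tlist (tcat x y) = tlist x ++ tlist y.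
Proof. by rewrite /tcat /tfold; elim: (tlist x) => //= h s ->. Qed.

Lemma tlist_tflat l : tlist (tflat l) = flatten [seq tlist x | x <- tlist l].
Proof. by rewrite /tflat /tfold; elim: (tlist l) => //= h s IH; rewrite tlist_tcat IH. Qed.

Lemma tlist_tmap f l : tlist (tmap f l) = [seq f x | x <- tlist l].
Proof. exact: tlistK. Qed.

Lemma all_flatten (T : Type) (p : pred T) ss : all p (flatten ss) = all (all p) ss.
Proof. by elim: ss => //= s ss IH; rewrite all_cat IH. Qed.

Lemma has_flatten (T : Type) (p : pred T) ss : has p (flatten ss) = has (has p) ss.
Proof. by elim: ss => //= s ss IH; rewrite has_cat IH. Qed.

(* The value at a node is stored with the values at its two children, which gives
   [body] access to both parts of a payload [Node p q]. *)
Definition prec (body : tree -> tree -> tree -> tree -> tree) (t : tree) : tree :=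
  trec (fun t rx ry => Node (body t (tfst ry) (tfst (tsnd ry)) (tsnd (tsnd ry)))
                            (Node (tfst rx) (tfst ry))) Leaf t.

(* A formula without quantifiers is a disjunction of conjunctions of literals
   [lit a b r].  The references [a] and [b] are unary numbers: 0 is a dummy vertex
   and [k + 1] is variable [k].  Relation expressions [rnode k p] have the tags
   0 full, 1 order of the sorts, 2 orientation, 3 sort, 4 label, 5 negated
   converse, 6 restriction of the first argument, 7 composition. *)
Definition rnode (k : nat) (p : tree) : tree := Node (code_nat k) p.
Definition lit (a b r : tree) : tree := Node (Node a b) r.

Definition dand (c d : tree) : tree := tflat (tmap (fun x => tmap (fun y => tcat x y) d) c).
Definition neglit (l : tree) : tree := lit (tsnd (tfst l)) (tfst (tfst l)) (rnode 5 (tsnd l)).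
Definition dneg (d : tree) : tree :=
  tfold (fun c acc => dand (tmap (fun l => Node (neglit l) Leaf) c) acc) tt1 d.

(** Reference 1 is variable 0, the one bound by the quantifier to be removed. *)
Definition isone (a x y : tree) : tree := tif a (tif (tsnd a) y x) y.
(** Leaving the quantifier lowers every reference by one; [tsnd] does this and fixes the dummy
    reference 0. *)
Definition rest_lit (l : tree) : tree :=
  isone (tfst (tfst l)) Leaf (isone (tsnd (tfst l)) Leaf
    (Node (lit (tsnd (tfst (tfst l))) (tsnd (tsnd (tfst l))) (tsnd l)) Leaf)).
(** A monotone literal [r a z] stays true when [z] moves up in its sort, so it acts as a lower bound
    on [z]; [upp_lit] is dual. *)
Definition low_lit (l : tree) : tree :=
  isone (tfst (tfst l)) Leaf (isone (tsnd (tfst l))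
    (Node (Node (tsnd (tfst (tfst l))) (tsnd l)) Leaf) Leaf).
Definition upp_lit (l : tree) : tree :=
  isone (tfst (tfst l)) (isone (tsnd (tfst l)) Leaf
    (Node (Node (tsnd (tsnd (tfst l))) (tsnd l)) Leaf)) Leaf.
(** Literals on the quantified variable alone need not be monotone: they thin out the chain instead
    of bounding its points. *)
Definition diag_lit (l : tree) : tree :=
  isone (tfst (tfst l)) (isone (tsnd (tfst l)) (Node (tsnd l) Leaf) Leaf) Leaf.
(* A trivial bound by the dummy vertex keeps the lists of bounds nonempty. *)
Definition full_lit : tree := Node Leaf (rnode 0 Leaf).
Definition lows (c : tree) : tree := Node full_lit (tflat (tmap low_lit c)).
Definition upps (c : tree) : tree := Node full_lit (tflat (tmap upp_lit c)).
Definition diags (c : tree) : tree := tflat (tmap diag_lit c).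
Definition filt (b ds r : tree) : tree :=
  rnode 6 (Node (rnode 3 b) (tfold (fun d acc => rnode 6 (Node d acc)) r ds)).
(* By the Helly property of the chain [b], a witness exists as soon as each lower
   bound is compatible with each upper bound. *)
Definition exclause (c b : tree) : tree :=
  tcat (tflat (tmap (fun x => tmap (fun y =>
      lit (tfst x) (tfst y) (rnode 7 (Node (tsnd x) (filt b (diags c) (tsnd y))))) (upps c)) (lows c)))
    (tflat (tmap rest_lit c)).
Definition dex (bs d : tree) : tree := tflat (tmap (fun c => tmap (fun b => exclause c b) bs) d).

(** Equality becomes two inequalities and adjacency the orientation in either direction. A label
    becomes a literal with equal references, for which no monotonicity is demanded. [r], [r1], [r2]
    are the results for the payload and its two parts. *)
Definition qe_body (bs t r r1 r2 : tree) : tree :=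
  let p := tsnd t in
  let i := Node Leaf (tfst p) in
  let j := Node Leaf (tsnd p) in
  tnth (Node (Node (Node (lit i j (rnode 1 Leaf)) (Node (lit j i (rnode 1 Leaf)) Leaf)) Leaf)
   (Node (Node (Node (lit i j (rnode 2 Leaf)) Leaf) (Node (Node (lit j i (rnode 2 Leaf)) Leaf) Leaf))
   (Node (Node (Node (lit j j (rnode 4 (tfst p))) Leaf) Leaf)
   (Node (dneg r)
   (Node (dand r1 r2)
   (Node (tcat r1 r2)
   (Node (dex bs r)
   (Node (dneg (dex bs (dneg r))) Leaf)))))))) (tfst t).

Definition qe (bs t : tree) : tree := tfst (prec (qe_body bs) t).

Lemma def_code r k : def r (fun=> code_nat k).
Proof. by elim: k => [|k IH]; [exact: def_leaf|exact: (def_node (def_leaf _) IH)]. Qed.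
#[export] Hint Resolve def_code : defs.

Lemma def_rnode r k : def r (rnode k).
Proof. exact: (def_node (def_code r k) (def_id r)). Qed.
#[export] Hint Resolve def_rnode : defs.

Lemma def_lit r : def3 r lit. Proof. by rewrite /def3 /lit; ldefs. Qed.
Lemma def_isone r : def3 r isone. Proof. by rewrite /def3 /isone; ldefs. Qed.
#[export] Hint Resolve def_lit def_isone : defs.
Lemma def_dand : def2 false dand. Proof. by rewrite /def2 /dand; ldefs. Qed.
Lemma def_neglit : def false neglit. Proof. by rewrite /neglit; ldefs. Qed.
#[export] Hint Resolve def_dand def_neglit : defs.
Lemma def_dneg : def false dneg. Proof. by rewrite /dneg; ldefs. Qed.
Lemma def_rest : def false rest_lit. Proof. by rewrite /rest_lit; ldefs. Qed.
Lemma def_low : def false low_lit. Proof. by rewrite /low_lit; ldefs. Qed.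
Lemma def_upp : def false upp_lit. Proof. by rewrite /upp_lit; ldefs. Qed.
Lemma def_diag : def false diag_lit. Proof. by rewrite /diag_lit; ldefs. Qed.
Lemma def_full : def false (fun=> full_lit). Proof. by rewrite /full_lit /rnode; ldefs. Qed.
#[export] Hint Resolve def_dneg def_rest def_low def_upp def_diag def_full : defs.
Lemma def_lows : def false lows. Proof. by rewrite /lows; ldefs. Qed.
Lemma def_upps : def false upps. Proof. by rewrite /upps; ldefs. Qed.
Lemma def_diags : def false diags. Proof. by rewrite /diags; ldefs. Qed.
Lemma def_filt : def3 false filt. Proof. by rewrite /def3 /filt; ldefs. Qed.
#[export] Hint Resolve def_lows def_upps def_diags def_filt : defs.
Lemma def_exclause : def2 false exclause. Proof. by rewrite /def2 /exclause; ldefs. Qed.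
#[export] Hint Resolve def_exclause : defs.
Lemma def_dex : def2 false dex. Proof. by rewrite /def2 /dex; ldefs. Qed.
#[export] Hint Resolve def_dex : defs.
Lemma def_qe : def2 false qe. 
Proof. by rewrite /def2 /qe /prec /qe_body; ldefs. Qed.

Lemma isoneE a x y : isone a x y = if nval a == 1 then x else y.
Proof. by case: a => [|u [|v w]]. Qed.

Lemma nval_tsnd a : nval (tsnd a) = (nval a).-1. Proof. by case: a. Qed.

Arguments rnode : simpl never.

Lemma has_In (T : Type) (p : pred T) s : reflect (exists2 x, List.In x s & p x) (has p s).
Proof.
elim: s => [|x s IH] /=; first by constructor; case.
apply: (iffP orP) => [[h|/IH[y h1 h2]]|[y [<-|h1] h2]].
- by exists x => //; left.
- by exists y => //; right.
- by left.
by right; apply/IH; exists y.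
Qed.

Lemma all_In (T : Type) (p : pred T) s : reflect (forall x, List.In x s -> p x) (all p s).
Proof.
elim: s => [|x s IH] /=; first by constructor.
apply: (iffP andP) => [[h /IH h'] y [<-|/h']|h] //.
by split; [apply: h; left|apply/IH => y hy; apply: h; right].
Qed.

Lemma In_cat (T : Type) (x : T) s t : List.In x (s ++ t) <-> List.In x s \/ List.In x t.
Proof. by elim: s => /= [|y s IH]; [tauto|rewrite IH; tauto]. Qed.

Lemma In_flatten (T : Type) (x : T) ss : List.In x (flatten ss) <-> exists s, List.In s ss /\ List.In x s.
Proof.
elim: ss => /= [|s ss IH]; first by split=> // -[s []].
rewrite In_cat IH; split=> [[h|[t [h1 h2]]]|[t [[<-|h1] h2]]]; try by [left|right; exists t].
  by exists s; split=> //; left.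
by exists t; split=> //; right.
Qed.

Lemma In_map (T U : Type) (f : T -> U) y s : List.In y (map f s) <-> exists x, List.In x s /\ y = f x.
Proof.
elim: s => /= [|x s IH]; first by split=> // -[x []].
rewrite IH; split=> [[<-|[z [h1 ->]]]|[z [[->|h1] ->]]].
- by exists x; split=> //; left.
- by exists z; split=> //; right.
- by left.
by right; exists z.
Qed.

Lemma In_cons (T : Type) (x y : T) s : List.In x (y :: s) <-> y = x \/ List.In x s.
Proof. by []. Qed.

(** * Relation expressions, clauses and chains *)

Section QE.
Variable N : nat.
Variables (mLe mM mS mL : nat -> nat -> bool).

Fixpoint rsem (r : tree) (x y : nat) : bool :=
  if r is Node tag p then
    match nval tag with
    | 0 => true
    | 1 => mLe x y
    | 2 => mM x y
    | 3 => mS (nval p) x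
    | 4 => mL (nval p) x
    | 5 => ~~ rsem p y x
    | 6 => if p is Node d q then rsem d x x && rsem q x y else false
    | 7 => if p is Node q1 q2 then has (fun z => rsem q1 x z && rsem q2 z y) (iota 0 N) else false
    | _ => false
    end
  else false.

Lemma rsem_rnode k p x y : rsem (rnode k p) x y =
  match k with
  | 0 => true
  | 1 => mLe x y
  | 2 => mM x y
  | 3 => mS (nval p) x
  | 4 => mL (nval p) x
  | 5 => ~~ rsem p y x
  | 6 => if p is Node d q then rsem d x x && rsem q x y else false
  | 7 => if p is Node q1 q2 then has (fun z => rsem q1 x z && rsem q2 z y) (iota 0 N) else false
  | _ => false
  end.
Proof. by rewrite /rnode /= code_natK. Qed.

Definition vval (env : seq nat) (a : tree) : nat := nth 0 (0 :: env) (nval a).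
Definition holds (env : seq nat) (l : tree) : bool :=
  rsem (tsnd l) (vval env (tfst (tfst l))) (vval env (tsnd (tfst l))).
Lemma holds_lit env a b r : holds env (lit a b r) = rsem r (vval env a) (vval env b).
Proof. by []. Qed.

Definition clause_sat env (c : tree) : bool := all (holds env) (tlist c).
Definition dnf_sat env (d : tree) : bool := has (clause_sat env) (tlist d).

(** Antitone in the first argument and monotone in the second. Negation reverses both directions,
    and exchanging the arguments restores them. *)
Definition mono (r : tree) : Prop := forall x x' y y', x < N -> x' < N -> y < N -> y' < N ->
  mLe x' x -> mLe y y' -> rsem r x y -> rsem r x' y'.
Definition lit_ok (l : tree) : Prop := nval (tfst (tfst l)) <> nval (tsnd (tfst l)) -> mono (tsnd l).
Definition dnf_ok (d : tree) : Prop := forall c l, List.In c (tlist d) -> List.In l (tlist c) -> lit_ok l.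

Lemma dnf_sat_cat env d d' : dnf_sat env (tcat d d') = dnf_sat env d || dnf_sat env d'.
Proof. by rewrite /dnf_sat tlist_tcat has_cat. Qed.

Lemma dnf_ok_cat d d' : dnf_ok d -> dnf_ok d' -> dnf_ok (tcat d d').
Proof. by move=> h h' c l; rewrite tlist_tcat In_cat => -[/h|/h']; apply. Qed.

Lemma tlist_dand d d' : tlist (dand d d') =
  flatten [seq [seq tcat c c' | c' <- tlist d'] | c <- tlist d].
Proof.
rewrite /dand tlist_tflat tlist_tmap -map_comp; congr flatten; apply: eq_map => c /=.
exact: tlist_tmap.
Qed.

Lemma dnf_sat_and env d d' : dnf_sat env (dand d d') = dnf_sat env d && dnf_sat env d'.
Proof.
rewrite /dnf_sat tlist_dand has_flatten has_map.
elim: (tlist d) => //= c s ->; rewrite has_map.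
have -> : has (preim (fun c' => tcat c c') (clause_sat env)) (tlist d') =
   clause_sat env c && has (clause_sat env) (tlist d').
  elim: (tlist d') => /= [|c' s' ->]; first by rewrite andbF.
  by rewrite /clause_sat tlist_tcat all_cat; case: (all _ (tlist c)).
by case: (clause_sat env c); case: has; case: has.
Qed.

Lemma dnf_ok_and d d' : dnf_ok d -> dnf_ok d' -> dnf_ok (dand d d').
Proof.
move=> h h' c l; rewrite tlist_dand In_flatten => -[s [/In_map[c1 [h1 ->]] /In_map[c2 [h2 ->]]]].
by rewrite tlist_tcat In_cat => -[]; [apply: h|apply: h'].
Qed.

Lemma holds_neg env l : holds env (neglit l) = ~~ holds env l.
Proof. by rewrite /holds /neglit /lit [tsnd _]/= rsem_rnode. Qed.

Lemma lit_ok_neg l : lit_ok l -> lit_ok (neglit l).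
Proof.
move=> h /nesym/h m; rewrite /neglit /lit /= => x x' y y' hx hx' hy hy' h1 h2.
by rewrite !rsem_rnode; apply: contra; apply: m.
Qed.

Lemma dnf_sat_neg env d : dnf_sat env (dneg d) = ~~ dnf_sat env d.
Proof.
rewrite /dneg /tfold {2}/dnf_sat; elim: (tlist d) => //= c s IH.
rewrite dnf_sat_and IH negb_or; congr andb.
rewrite /dnf_sat tlist_tmap has_map /clause_sat -has_predC; apply: eq_has => l /=.
by rewrite andbT holds_neg.
Qed.

Lemma dnf_ok_neg d : dnf_ok d -> dnf_ok (dneg d).
Proof.
rewrite /dneg /tfold /dnf_ok; elim: (tlist d) => [_ c l /= [<-|//] []|c s IH h] /=.
apply: dnf_ok_and; last by apply: IH => c' l hc; apply: h; right.
move=> c' l; rewrite tlist_tmap => /In_map[l' [h1 ->]] /= [<-|//].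
by apply/lit_ok_neg/(h c) => //; left.
Qed.

Hypothesis mLe_refl : forall x, x < N -> mLe x x.

Section Chain.
Variable Z : nat -> bool.
Hypothesis Z_lt : forall z, Z z -> z < N.
Hypothesis Z_chain : forall x y, Z x -> Z y -> mLe x y || mLe y x.

Definition upset (P : nat -> bool) := forall x y, Z x -> Z y -> mLe x y -> P x -> P y.
Definition downset (P : nat -> bool) := forall x y, Z x -> Z y -> mLe x y -> P y -> P x.

(** A point of one set outside the other is comparable with every point of the chain. *)
Lemma nested (P Q : nat -> bool) : (upset P /\ upset Q) \/ (downset P /\ downset Q) ->
  (forall z, Z z -> P z -> Q z) \/ (forall z, Z z -> Q z -> P z).
Proof.
move=> h; have [/allP H|/allPn[x]] := boolP (all (fun z => Z z && P z ==> Q z) (iota 0 N)).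
  by left=> z hz hp; have := H z; rewrite mem_iota hz hp Z_lt // => /(_ isT).
rewrite negb_imply => _ /andP[/andP[zx px] qx]; right=> z hz qz.
case: h => -[hP hQ]; case/orP: (Z_chain zx hz) => l.
- exact: hP l px.
- by rewrite (hQ _ _ hz zx l qz) in qx.
- by rewrite (hQ _ _ zx hz l qz) in qx.
exact: hP l px.
Qed.

Lemma least (T : Type) (P : T -> nat -> bool) s t0 :
  (forall t, List.In t (t0 :: s) -> upset (P t)) \/ (forall t, List.In t (t0 :: s) -> downset (P t)) ->
  exists2 t, List.In t (t0 :: s) & forall z, Z z -> P t z -> all (P^~ z) (t0 :: s).
Proof.
elim: s t0 => [|t1 s IH] t0 h; first by exists t0; [left|move=> z /= _ ->].
have [|t h1 h2] := IH t1; first by case: h => h; [left|right] => t ht; apply: h; right.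
have [k|k] : (forall z, Z z -> P t0 z -> P t z) \/ (forall z, Z z -> P t z -> P t0 z).
  apply: nested; case: h => h; [left|right]; split; apply: h; by [left|right].
- exists t0; first by left.
  by move=> z hz hp; rewrite /= hp; apply: (h2 z hz); apply: k.
exists t; first by right.
by move=> z hz hp; rewrite /= (k z hz hp); apply: h2.
Qed.

(** The smallest up-set and the smallest down-set decide: a point common to these two lies in all of
    them. *)
Lemma helly (T U : Type) (P : T -> nat -> bool) (Q : U -> nat -> bool) s t0 u u0 :
  (forall t, List.In t (t0 :: s) -> upset (P t)) ->
  (forall t, List.In t (u0 :: u) -> downset (Q t)) ->
  (forall a b, List.In a (t0 :: s) -> List.In b (u0 :: u) -> exists2 z, Z z & P a z && Q b z) ->
  exists2 z, Z z & all (P^~ z) (t0 :: s) && all (Q^~ z) (u0 :: u).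
Proof.
move=> hP hQ h; have [a ha ha'] := least (or_introl hP); have [b hb hb'] := least (or_intror hQ).
have [z hz /andP[h1 h2]] := h a b ha hb; exists z => //.
by rewrite (ha' z) // (hb' z).
Qed.
End Chain.

Hypothesis S_chain : forall b x y, x < N -> y < N -> mS b x -> mS b y -> mLe x y || mLe y x.

Lemma vval_shift env z a : nval a != 1 -> vval (z :: env) a = vval env (tsnd a).
Proof. by rewrite /vval nval_tsnd; case: (nval a) => [|[|k]]. Qed.

Lemma vval_one env z a : nval a == 1 -> vval (z :: env) a = z.
Proof. by rewrite /vval => /eqP ->. Qed.

Definition lowp env (t : tree) z := rsem (tsnd t) (vval env (tfst t)) z.
Definition uppp env (t : tree) z := rsem (tsnd t) z (vval env (tfst t)).
Definition diagp (t : tree) z := rsem t z z.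

Lemma lowp_full env z : lowp env full_lit z.
Proof. by []. Qed.

Lemma uppp_full env z : uppp env full_lit z.
Proof. by []. Qed.

Lemma clause_split env z c : clause_sat (z :: env) c =
  [&& all (lowp env ^~ z) (tlist (lows c)), all (uppp env ^~ z) (tlist (upps c)),
   all (diagp ^~ z) (tlist (diags c)) & clause_sat env (tflat (tmap rest_lit c))].
Proof.
have -> : tlist (lows c) = full_lit :: tlist (tflat (tmap low_lit c)) by [].
have -> : tlist (upps c) = full_lit :: tlist (tflat (tmap upp_lit c)) by [].
have E (T : Type) (p : pred T) x s : all p (x :: s) = p x && all p s by [].
rewrite !E lowp_full uppp_full !andTb /clause_sat /diags.
rewrite !tlist_tflat !tlist_tmap !all_flatten !all_map.
rewrite -!all_predI; apply: eq_all => l /=.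
rewrite /holds /low_lit /upp_lit /diag_lit /rest_lit !isoneE.
have [a1|a1] := boolP (nval (tfst (tfst l)) == 1); have [b1|b1] := boolP (nval (tsnd (tfst l)) == 1) => /=;
  rewrite ?(vval_one _ _ a1) ?(vval_one _ _ b1) ?(vval_shift _ _ a1) ?(vval_shift _ _ b1) /= ?andbT //.
Qed.

Lemma filtP b ds r z y : rsem (filt b ds r) z y = [&& mS (nval b) z, all (diagp ^~ z) (tlist ds) & rsem r z y].
Proof.
rewrite /filt /tfold rsem_rnode rsem_rnode; congr andb.
elim: (tlist ds) => [|d s IH] //; rewrite [foldr _ _ _]/= rsem_rnode IH [all _ (_ :: _)]/= -andbA //.
Qed.

Lemma lows_ok c t : (forall l, List.In l (tlist c) -> lit_ok l) -> List.In t (tlist (lows c)) -> mono (tsnd t).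
Proof.
have -> : tlist (lows c) = full_lit :: tlist (tflat (tmap low_lit c)) by [].
move=> h /In_cons[<- //|].
rewrite tlist_tflat tlist_tmap In_flatten => -[s [/In_map[x [/In_map[l [hl ->]] ->]]]].
rewrite /low_lit !isoneE; case: eqP => // h1; case: eqP => // h2 /= [<-|//] /=.
by apply: h hl _; rewrite h2.
Qed.

Lemma upps_ok c t : (forall l, List.In l (tlist c) -> lit_ok l) -> List.In t (tlist (upps c)) -> mono (tsnd t).
Proof.
have -> : tlist (upps c) = full_lit :: tlist (tflat (tmap upp_lit c)) by [].
move=> h /In_cons[<- //|].
rewrite tlist_tflat tlist_tmap In_flatten => -[s [/In_map[x [/In_map[l [hl ->]] ->]]]].
rewrite /upp_lit !isoneE; case: eqP => // h1; case: eqP => // h2 /= [<-|//] /=.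
by apply: h hl _; rewrite h1; apply: nesym.
Qed.

Lemma exclause_sat env c b : (forall l, List.In l (tlist c) -> lit_ok l) ->
  all (fun x => x < N) env ->
  has (fun z => mS (nval b) z && clause_sat (z :: env) c) (iota 0 N) = clause_sat env (exclause c b).
Proof.
move=> hc henv.
have hv a : 0 < N -> vval env a < N.
  move=> n0; rewrite /vval; case: (nval a) => //= k; case: (ltnP k (size env)) => hk.
    by apply: (allP henv); apply: mem_nth.
  by rewrite nth_default.
have -> : clause_sat env (exclause c b) =
  all (fun t => all (fun u => has (fun z => lowp env t z && [&& mS (nval b) z,
     all (diagp ^~ z) (tlist (diags c)) & uppp env u z]) (iota 0 N)) (tlist (upps c))) (tlist (lows c))
  && clause_sat env (tflat (tmap rest_lit c)).
  rewrite {1}/clause_sat /exclause tlist_tcat all_cat; congr andb.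
  move: (lows c) (upps c) (diags c) => A B C.
  rewrite tlist_tflat tlist_tmap all_flatten !all_map; apply: eq_all => t /=.
  rewrite tlist_tmap all_map; apply: eq_all => u /=.
  rewrite holds_lit rsem_rnode; cbv iota beta; apply: eq_has => z; rewrite filtP //.
apply/hasP/andP => [[z hz /andP[h1]]|[h1 h2]].
  rewrite clause_split => /and4P[/all_In h2 /all_In h3 h4 h5]; split=> //.
  apply/all_In => t ht; apply/all_In => u hu; apply/hasP; exists z => //.
  by rewrite h2 // h1 h4 h3.
(* The chain for the Helly argument: sort [b], thinned out by the diagonal literals. *)
pose Z z := [&& z < N, mS (nval b) z & all (diagp ^~ z) (tlist (diags c))].
have ZN z : Z z -> z < N by case/and3P.
have Zc x y : Z x -> Z y -> mLe x y || mLe y x.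
  by case/and3P => a1 a2 _ /and3P[b1 b2 _]; apply: S_chain a2 b2.
have [||a a' ha ha'|z hz /andP[hl hu]] := @helly Z ZN Zc _ _ (lowp env) (uppp env)
    (tlist (tflat (tmap low_lit c))) full_lit (tlist (tflat (tmap upp_lit c))) full_lit.
- move=> t ht x y /ZN hx /ZN hy hxy; have n0 : 0 < N by lia.
  by apply: (lows_ok hc ht) => //; [exact: hv|exact: hv|apply: mLe_refl; exact: hv].
- move=> t ht x y /ZN hx /ZN hy hxy; have n0 : 0 < N by lia.
  by apply: (upps_ok hc ht) => //; [exact: hv|exact: hv|apply: mLe_refl; exact: hv].
- have /all_In/(_ _ ha)/all_In/(_ _ ha')/hasP[z] := h1.
  rewrite mem_iota => /= hz /and4P[l1 l2 l3 l4]; exists z; last by rewrite l1.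
  by rewrite /Z hz l2.
exists z; first by rewrite mem_iota ZN.
have /and3P[_ z1 z2] := hz.
by apply/andP; split=> //; rewrite clause_split h2 z2; apply/and4P; split; [exact: hl|exact: hu| |].
Qed.
(** The outer arguments of a composition inherit monotonicity; the filter concerns the middle point
    only. *)
Lemma exclause_ok c b : (forall l, List.In l (tlist c) -> lit_ok l) ->
  forall l, List.In l (tlist (exclause c b)) -> lit_ok l.
Proof.
move=> hc l; rewrite /exclause tlist_tcat In_cat => -[].
  rewrite tlist_tflat tlist_tmap In_flatten => -[s [/In_map[x [/In_map[u [hu ->]] ->]]]].
  rewrite tlist_tmap => /In_map[v [hv ->]] _.
  have mu := lows_ok hc hu; have mv := upps_ok hc hv.
  move=> x0 x' y y' hx hx' hy hy' h1 h2; rewrite [tsnd _]/= !rsem_rnode; cbv iota beta.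
  move=> /hasP[z z1]; have hz : z < N by rewrite mem_iota in z1.
  rewrite filtP => /andP[k1 /and3P[k2 k3 k4]].
  apply/hasP; exists z; first exact: z1.
  by rewrite filtP k2 k3 (mu x0 x' z z hx hx' hz hz h1 (mLe_refl hz) k1) (mv z z y y' hz hz hy hy' (mLe_refl hz) h2 k4).
rewrite tlist_tflat tlist_tmap In_flatten => -[s [/In_map[x [/In_map[u [hu ->]] ->]]]].
rewrite /rest_lit !isoneE; case: eqP => // h1; case: eqP => // h2 /In_cons[<-|//].
move=> h; apply: (hc _ hu) => E; apply: h.
exact: (etrans (nval_tsnd _) (etrans (congr1 predn E) (esym (nval_tsnd _)))).
Qed.

Lemma dex_sat bs env d : dnf_ok d -> all (fun x => x < N) env ->
  (forall z, z < N -> has (fun b => mS (nval b) z) (tlist bs)) ->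
  dnf_sat env (dex bs d) = has (fun z => dnf_sat (z :: env) d) (iota 0 N).
Proof.
move=> hd henv hbs; rewrite /dnf_sat /dex tlist_tflat tlist_tmap has_flatten !has_map.
apply/has_In/hasP => [[c hc] /=|[z hz /has_In[c hc hs]]].
  rewrite tlist_tmap has_map => /has_In[b hb] /=.
  rewrite -exclause_sat // => [|l]; last exact: hd.
  move=> /hasP[z hz /andP[h1 h2]]; exists z => //; apply/has_In; by exists c.
exists c => //=; rewrite tlist_tmap has_map; apply/has_In.
have /hbs/has_In[b hb hbz] : z < N by rewrite mem_iota in hz.
exists b => //=; rewrite -exclause_sat // => [|l]; last exact: hd.
by apply/hasP; exists z => //; rewrite hbz.
Qed.

Lemma dex_ok bs d : dnf_ok d -> dnf_ok (dex bs d).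
Proof.
move=> hd c l; rewrite /dex tlist_tflat tlist_tmap In_flatten => -[s [/In_map[x [/In_map[c' [hc ->]] ->]]]].
rewrite tlist_tmap => /In_map[b [hb ->]]; apply: exclause_ok => l'; exact: hd.
Qed.

End QE.

(** * Correctness of quantifier elimination *)

Section Main.
Variables (L n : nat) (G : lgraph L n) (mLe mM mS mL : nat -> nat -> bool) (rk : nat -> nat) (bs : tree).

Fixpoint rcode m (phi : fo L m) : tree :=
  match phi with
  | FOeq i j => rnode 0 (Node (code_nat i) (code_nat j))
  | FOadj i j => rnode 1 (Node (code_nat i) (code_nat j))
  | FOlab l i => rnode 2 (Node (code_nat (rk l)) (code_nat i))
  | FOnot p => rnode 3 (rcode p)
  | FOand p q => rnode 4 (Node (rcode p) (rcode q))
  | FOor p q => rnode 5 (Node (rcode p) (rcode q))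
  | FOex p => rnode 6 (rcode p)
  | FOall p => rnode 7 (rcode p)
  end.

Hypothesis Le_refl : forall x, x < n -> mLe x x.
Hypothesis Le_trans : forall x y z, x < n -> y < n -> z < n -> mLe x y -> mLe y z -> mLe x z.
Hypothesis Le_anti : forall x y, x < n -> y < n -> mLe x y -> mLe y x -> x = y.
Hypothesis M_mono : forall x x' y y', x < n -> x' < n -> y < n -> y' < n ->
  mLe x' x -> mLe y y' -> mM x y -> mM x' y'.
Hypothesis S_chain : forall b x y, x < n -> y < n -> mS b x -> mS b y -> mLe x y || mLe y x.
Hypothesis S_cover : forall z, z < n -> has (fun b => mS (nval b) z) (tlist bs).
Hypothesis adj_M : forall u v : 'I_n, adj G u v = mM u v || mM v u.

Fixpoint occurs (l : nat) m (phi : fo L m) : bool :=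
  match phi with
  | FOeq _ _ | FOadj _ _ => false
  | FOlab l' _ => l' == l :> nat
  | FOnot p | FOex p | FOall p => occurs l p
  | FOand p q | FOor p q => occurs l p || occurs l q
  end.

Definition lab_ok m (phi : fo L m) : Prop := forall l : 'I_L, occurs l phi ->
  forall v : 'I_n, (v \in lab G l) = mL (rk l) v.

Notation sat := (dnf_sat n mLe mM mS mL).
Notation ok := (dnf_ok n mLe mM mS mL).

Lemma tnthE d k : tnth d (code_nat k) = nth Leaf (tlist d) k.
Proof. by rewrite /tnth -[size _]/(nval _) code_natK. Qed.

Lemma qeE k p : qe bs (rnode k p) = qe_body bs (rnode k p) (qe bs p) (tfst (tsnd (prec (qe_body bs) p)))
  (tsnd (tsnd (prec (qe_body bs) p))).
Proof. by []. Qed.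

Lemma vval_var m (t : m.-tuple 'I_n) (i : 'I_m) :
  vval (map val t) (Node Leaf (code_nat i)) = val (tuple.tnth t i).
Proof.
rewrite /vval /= -[size _]/(nval _) code_natK (tnth_nth (tuple.tnth t i)) (nth_map (tuple.tnth t i)) //.
by rewrite size_tuple.
Qed.

Lemma env_lt m (t : m.-tuple 'I_n) : all (fun x => x < n) (map val t).
Proof. by rewrite all_map; apply/allP => x _ /=. Qed.

Lemma ex_iota (P : pred nat) (Q : pred 'I_n) : (forall v : 'I_n, P v = Q v) ->
  has P (iota 0 n) = [exists v, Q v].
Proof.
move=> h; apply/hasP/existsP => [[z]|[v hv]].
  by rewrite mem_iota => /= hz hp; exists (Ordinal hz); rewrite -h.
by exists (val v); rewrite ?mem_iota ?h //= ltn_ord.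
Qed.

Lemma satE env : (forall c d, sat env (Node c d) = clause_sat n mLe mM mS mL env c || sat env d) *
  (sat env Leaf = false) * (clause_sat n mLe mM mS mL env Leaf = true) *
  (forall l c, clause_sat n mLe mM mS mL env (Node l c) =
     holds n mLe mM mS mL env l && clause_sat n mLe mM mS mL env c).
Proof. by []. Qed.

Lemma ok1 l : lit_ok n mLe mM mS mL l -> ok (Node (Node l Leaf) Leaf).
Proof. by move=> h c l' [<-|//] [<-|//]. Qed.

Theorem qe_correct m (phi : fo L m) : lab_ok phi -> ok (qe bs (rcode phi)) /\
  forall t : m.-tuple 'I_n, sat (map val t) (qe bs (rcode phi)) = fo_sat G phi t.
Proof.
elim: m / phi => [m i j|m i j|m l i|m p IH|m p IHp q IHq|m p IHp q IHq|m p IH|m p IH] lk;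
  try (have [IH1 IH2] := IH lk); try (have [IHp1 IHp2] : _ := IHp (fun l h => lk l (introT orP (or_introl h))));
  try (have [IHq1 IHq2] : _ := IHq (fun l h => lk l (introT orP (or_intror h))));
  rewrite [rcode _]/= qeE /qe_body.
all: rewrite -[tfst (rnode _ _)]/(code_nat _) tnthE; lazy beta iota zeta delta [tlist nth].
- set i' := Node Leaf _; set j' := Node Leaf _.
  have mle : mono n mLe mM mS mL (rnode 1 Leaf).
    move=> x x' y y' hx hx' hy hy' h1 h2; rewrite !rsem_rnode => h3.
    by apply: (@Le_trans x' x y') => //; apply: (@Le_trans x y y').
  split; first by move=> c l [<-|//] [<-|[<-|//]].
  move=> t; rewrite !satE orbF !andbT !holds_lit !rsem_rnode !vval_var [fo_sat _ _ _]/= -val_eqE.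
  apply/andP/eqP => [[h1 h2]|->]; first exact: (Le_anti (ltn_ord _) (ltn_ord _) h1 h2).
  by split; apply: Le_refl; apply: ltn_ord.
- have mm : mono n mLe mM mS mL (rnode 2 Leaf).
    by move=> x x' y y' hx hx' hy hy' h1 h2; rewrite !rsem_rnode; apply: M_mono.
  split; first by move=> c l [<-|[<-|//]] [<-|//].
  move=> t; rewrite !satE orbF !andbT !holds_lit !rsem_rnode !vval_var [fo_sat _ _ _]/=.
  by rewrite adj_M.
- split; first by apply: ok1 => /=.
  move=> t; rewrite !satE orbF !andbT !holds_lit !rsem_rnode !vval_var [fo_sat _ _ _]/=.
  by rewrite code_natK lk //= eqxx.
- split; first exact: dnf_ok_neg.
  by move=> t; rewrite dnf_sat_neg IH2.
- split; first exact: dnf_ok_and.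
  by move=> t; rewrite dnf_sat_and IHp2 IHq2.
- split; first exact: dnf_ok_cat.
  by move=> t; rewrite dnf_sat_cat IHp2 IHq2.
- split; first exact: dex_ok.
  move=> t; rewrite dex_sat ?env_lt // [fo_sat _ _ _]/=; apply: ex_iota => v.
  by rewrite -(IH2 (cons_tuple v t)).
split; first by apply/dnf_ok_neg/dex_ok => //; apply: dnf_ok_neg.
move=> t; rewrite dnf_sat_neg dex_sat ?env_lt //; last exact: dnf_ok_neg.
rewrite (@ex_iota _ (fun v => ~~ fo_sat G p (cons_tuple v t))).
  by rewrite negb_exists [RHS]/=; apply: eq_forallb => v; rewrite negbK.
by move=> v; rewrite dnf_sat_neg -(IH2 (cons_tuple v t)).
Qed.
End Main.

(** * The algorithm *)

Definition isn (t : tree) : bool := if t is Node _ _ then true else false.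

Definition tlen (l : tree) : tree := tmap (fun=> Leaf) l.
(** The codes of [0, 1, ...], one per entry of [l]: each step increments the list built so far and
    prepends 0. The clipping shape is a square as wide as [l] is long. *)
Definition tverts (l : tree) : tree :=
  tcfold (fun _ acc => Node Leaf (tmap (fun x => Node Leaf x) acc)) (tmap (fun=> tlen l) l) Leaf l.
Lemma def_tlen : def true tlen. Proof. by rewrite /tlen; ldefs. Qed.
#[export] Hint Resolve def_tlen : defs.
Lemma def_tverts : def true tverts. Proof. by rewrite /tverts; ldefs. Qed.
#[export] Hint Resolve def_tverts : defs.

Definition tcube (b V : tree) : tree := tmap (fun=> tmap (fun=> tmap (fun=> b) V) V) V.
Lemma def_tcube : def2 true tcube. Proof. by rewrite /def2 /tcube; ldefs. Qed.
#[export] Hint Resolve def_tcube : defs.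
Fixpoint trep (k : nat) (c : tree) : tree := if k is k'.+1 then Node c (trep k' c) else Leaf.
Lemma def_trep k : def true (trep k). Proof. by elim: k => [|k IH] /=; ldefs. Qed.
#[export] Hint Resolve def_trep : defs.

Definition tfull (A : tree) : tree := trep 11 (tcube tt1 (tverts A)).
Lemma def_tfull : def true tfull. Proof. by rewrite /tfull; ldefs. Qed.
#[export] Hint Resolve def_tfull : defs.

Definition tinit (A : tree) : tree :=
  Node (tmap (fun x => tmap (fun y => tmap (fun=> tnth (tnth A x) y) (tverts A)) (tverts A)) (tverts A))
    (trep 10 (tcube Leaf (tverts A))).
Lemma def_tinit : def true tinit. Proof. by rewrite /tinit; ldefs. Qed.
#[export] Hint Resolve def_tinit : defs.

Ltac ldefs4 := repeat first [ by auto with defs | def_step4 | def_step ].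

Definition tgreedy (A : tree) : tree := stree greedy_stmt Leaf (tverts A) (tfull A) (tinit A).
Lemma def_tgreedy : def true tgreedy.
Proof. have H := def_stree greedy_stmt; rewrite /tgreedy; by ldefs4. Qed.
#[export] Hint Resolve def_tgreedy : defs.

Definition look (S x y z : tree) : tree := tnth (tnth (tnth S x) y) z.
Lemma def_look r : def4 r look. Proof. by rewrite /def4 /look; ldefs. Qed.
#[export] Hint Resolve def_look : defs.

Definition tbound (A : tree) : tree := tmap (fun=> tlen A) A.
Lemma def_tbound : def true tbound. Proof. by rewrite /tbound; ldefs. Qed.
#[export] Hint Resolve def_tbound : defs.

Definition tindp (A v : tree) : tree := look (tget 1 (tgreedy A)) v v v.
Lemma def_tindp : def2 true tindp. Proof. by rewrite /def2 /tindp; ldefs4. Qed.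
#[export] Hint Resolve def_tindp : defs.

Definition tindlist (A : tree) : tree :=
  tcfold (fun v acc => tif (tindp A v) (Node v acc) acc) (tbound A) Leaf (tverts A).
Lemma def_tindlist : def true tindlist. Proof. by rewrite /tindlist; ldefs. Qed.
#[export] Hint Resolve def_tindlist : defs.

Definition tcard (A : tree) : tree := tlen (tindlist A).
Lemma def_tcard : def true tcard. Proof. by rewrite /tcard; ldefs. Qed.
#[export] Hint Resolve def_tcard : defs.

Definition trank (A i : tree) : tree :=
  tlen (tcfold (fun w acc => tif (tif (tindp A w) (tlt w i) Leaf) (Node w acc) acc) (tbound A) Leaf (tverts A)).
Lemma def_trank : def2 true trank. Proof. by rewrite /def2 /trank; ldefs. Qed.
#[export] Hint Resolve def_trank : defs.

(** Guesses are matrices indexed by ranks in the independent set, so their number depends on its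
    size only; here they are spread over the vertices. *)
Definition tguessed (A g : tree) : tree :=
  tmap (fun i => tmap (fun j => tmap (fun=> tif (tnth (tnth g (trank A i)) (trank A j)) tt1 Leaf)
    (tverts A)) (tverts A)) (tverts A).
Lemma def_tguessed : def2 true tguessed. Proof. by rewrite /def2 /tguessed; ldefs. Qed.
#[export] Hint Resolve def_tguessed : defs.

Definition tattempt (A g : tree) : tree :=
  stree attempt_stmt Leaf (tverts A) (tfull A) (tupd 2 (tguessed A g) (tgreedy A)).
Lemma def_tattempt : def2 true tattempt.
Proof. have H := def_stree attempt_stmt; rewrite /def2 /tattempt; by ldefs4. Qed.
#[export] Hint Resolve def_tattempt : defs.

Definition tok (S : tree) : tree := look (tget 10 S) Leaf Leaf Leaf.
Lemma def_tok : def true tok. Proof. by rewrite /tok; ldefs4. Qed.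
#[export] Hint Resolve def_tok : defs.

(** The greedy state serves as default value because it has the right format. *)
Definition tsearch (A gs : tree) : tree :=
  tcfold (fun g acc => tif (tok (tattempt A g)) (tattempt A g) acc) (tfull A) (tgreedy A) gs.
Lemma def_tsearch : def2 true tsearch. Proof. by rewrite /def2 /tsearch; ldefs. Qed.
#[export] Hint Resolve def_tsearch : defs.

Definition tsame (S x y : tree) : tree := look (tget 9 S) x y y.
Definition torient (S x y : tree) : tree := look (tget 8 S) x y y.
Lemma def_tsame : def3 true tsame. Proof. by rewrite /def3 /tsame; ldefs4. Qed.
Lemma def_torient : def3 true torient. Proof. by rewrite /def3 /torient; ldefs4. Qed.
#[export] Hint Resolve def_tsame def_torient : defs.

Definition tisrep (S V v : tree) : tree :=
  tcfold (fun w acc => tif (tif (tlt w v) (tsame S w v) Leaf) Leaf acc) tt1 tt1 V.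
Lemma def_tisrep : def3 true tisrep. Proof. by rewrite /def3 /tisrep; ldefs. Qed.
#[export] Hint Resolve def_tisrep : defs.

Definition treps (A S : tree) : tree :=
  tcfold (fun v acc => tif (tisrep S (tverts A) v) (Node v acc) acc) (tbound A) Leaf (tverts A).
Lemma def_treps : def2 true treps. Proof. by rewrite /def2 /treps; ldefs. Qed.
#[export] Hint Resolve def_treps : defs.

(** The clipped form of [prec]; the shape leaves room for the stored values of both children. *)
Definition pcrec (body : tree -> tree -> tree -> tree -> tree) (c : tree -> tree) (t : tree) : tree :=
  tcrec (fun t rx ry => Node (body t (tfst ry) (tfst (tsnd ry)) (tsnd (tsnd ry)))
                            (Node (tfst rx) (tfst ry)))
    (fun t => Node (c t) (Node (c (tfst t)) (c (tsnd t)))) Leaf t.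

Definition teq (x y : tree) : tree := tif (tlt x y) Leaf (tif (tlt y x) Leaf tt1).
Lemma def_teq : def2 true teq. Proof. by rewrite /def2 /teq; ldefs. Qed.
#[export] Hint Resolve def_teq : defs.

Definition occ_body (l t r r1 r2 : tree) : tree :=
  tnth (Node Leaf (Node Leaf (Node (teq (tfst (tsnd t)) l) (Node r (Node (tif r1 tt1 r2)
    (Node (tif r1 tt1 r2) (Node r (Node r Leaf)))))))) (tfst t).
Definition toccurs (l phi : tree) : tree := tfst (pcrec (occ_body l) (fun=> tt1) phi).
Lemma def_toccurs : def2 true toccurs.
Proof. by rewrite /def2 /toccurs /pcrec /occ_body; ldefs. Qed.
#[export] Hint Resolve def_toccurs : defs.

(* Label indices are unbounded in the parameter, hence replaced by their ranks
   among the labels that occur in the formula. *)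
Definition trk (Ls phi l : tree) : tree :=
  tcfold (fun k acc => tif (tif (toccurs k phi) (tlt k l) Leaf) (Node Leaf acc) acc) l Leaf (tverts Ls).
Lemma def_trk : def3 true trk. Proof. by rewrite /def3 /trk; ldefs. Qed.
#[export] Hint Resolve def_trk : defs.

Definition tused (A Ls phi : tree) : tree :=
  tcfold (fun l acc => tif (toccurs l phi) (Node (tnth Ls l) acc) acc)
    (tmap (fun=> tmap (fun=> tt1) A) Ls) Leaf (tverts Ls).
Lemma def_tused : def3 true tused. Proof. by rewrite /def3 /tused; ldefs. Qed.
#[export] Hint Resolve def_tused : defs.

Definition rel_body (Ls phi t r r1 r2 : tree) : tree :=
  tnth (Node t (Node t (Node (Node (tfst t) (Node (trk Ls phi (tfst (tsnd t))) (tsnd (tsnd t))))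
    (Node (Node (tfst t) r) (Node (Node (tfst t) (Node r1 r2)) (Node (Node (tfst t) (Node r1 r2))
    (Node (Node (tfst t) r) (Node (Node (tfst t) r) Leaf)))))))) (tfst t).
(** Ranks do not exceed the labels they replace, so the formula itself is a sufficient clipping
    shape. *)
Definition trelabel (Ls phi : tree) : tree := tfst (pcrec (rel_body Ls phi) (fun t => t) phi).
Lemma def_trelabel : def2 true trelabel.
Proof. by rewrite /def2 /trelabel /pcrec /rel_body; ldefs. Qed.
#[export] Hint Resolve def_trelabel : defs.

Definition tmat (f : tree -> tree -> tree) (W : tree) : tree :=
  tmap (fun x => tmap (fun y => tif (f x y) tt1 Leaf) W) W.
Definition tele (m x y : tree) : tree := tnth (tnth m x) y.
Lemma def_tele r : def3 r tele. Proof. by rewrite /def3 /tele; ldefs. Qed.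
#[export] Hint Resolve def_tele : defs.

(* [c] packs the search result, the sort representatives and the used label vectors. *)
Definition eval_body (c W V t r r1 r2 : tree) : tree :=
  let S := tfst c in let R := tfst (tsnd c) in let U := tsnd (tsnd c) in
  tnth (Node (tmat (fun x y => tt1) W)
   (Node (tmat (fun x y => tif (tsame S x y) (tif (teq x y) tt1 (torient S x y)) Leaf) W)
   (Node (tmat (fun x y => torient S x y) W)
   (Node (tmat (fun x y => tif (tlt (tsnd t) (tlen R)) (tsame S (tnth R (tsnd t)) x) Leaf) W)
   (Node (tmat (fun x y => tele U (tsnd t) x) W)
   (Node (tmat (fun x y => tif (tele r y x) Leaf tt1) W)
   (Node (tmat (fun x y => tif (tele r1 x x) (tele r2 x y) Leaf) W)
   (Node (tmat (fun x y => tcfold (fun z acc => tif (tif (tele r1 x z) (tele r2 z y) Leaf) tt1 acc) tt1 Leaf V) W)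
    Leaf)))))))) (tfst t).
(* Matrices range over [0, ..., n], so that entry (0, 0) exists even if [n = 0]. *)
Definition tevalr (c A r : tree) : tree :=
  tfst (pcrec (eval_body c (tverts (Node Leaf A)) (tverts A))
     (fun=> tmat (fun x y => tt1) (tverts (Node Leaf A))) r).
Lemma def_tevalr : def3 true tevalr.
Proof. by rewrite /def3 /tevalr /pcrec /eval_body /tmat; ldefs. Qed.
#[export] Hint Resolve def_tevalr : defs.

Definition tanswer (c A d : tree) : tree :=
  tcfold (fun cl acc => tif (tcfold (fun l acc' => tif (tele (tevalr c A (tsnd l)) Leaf Leaf) acc' Leaf)
    tt1 tt1 cl) tt1 acc) tt1 Leaf d.
Lemma def_tanswer : def3 true tanswer. Proof. by rewrite /def3 /tanswer; ldefs. Qed.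
#[export] Hint Resolve def_tanswer : defs.

Definition tlists (X k : tree) : tree :=
  tfold (fun _ acc => tflat (tmap (fun x => tmap (fun s => Node x s) acc) X)) (Node Leaf Leaf) k.
Lemma def_tlists : def2 false tlists. Proof. by rewrite /def2 /tlists; ldefs. Qed.
#[export] Hint Resolve def_tlists : defs.

Definition tguesses (m : tree) : tree := tlists (tlists (Node tt1 (Node Leaf Leaf)) m) m.
Lemma def_tguesses : def false tguesses. Proof. by rewrite /tguesses /tt1; ldefs. Qed.
#[export] Hint Resolve def_tguesses : defs.

(** The stages are restricted, hence polynomial. Between them [tguesses] and [qe] run without
    clipping, on data whose size is bounded by the parameters; this separates the two factors of the
    running time. *)
Definition stage1 (a : tree) : tree := tcard (tfst (tfst a)).
Definition stage2 (p : tree) : tree :=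
  let a := tsnd p in let A := tfst (tfst a) in let Ls := tsnd (tfst a) in
  Node (tverts (treps A (tsearch A (tfst p)))) (trelabel Ls (tsnd a)).
Definition stage4 (p : tree) : tree :=
  let gs := tfst (tsnd p) in
  let a := tsnd (tsnd p) in let A := tfst (tfst a) in let Ls := tsnd (tfst a) in
  let S := tsearch A gs in
  tanswer (Node S (Node (treps A S) (tused A Ls (tsnd a)))) A (tfst p).
Lemma def_stage1 : def true stage1. Proof. by rewrite /stage1; ldefs. Qed.
Lemma def_stage2 : def true stage2. Proof. by rewrite /stage2; ldefs. Qed.
Lemma def_stage4 : def true stage4. Proof. by rewrite /stage4; ldefs. Qed.

(** * Correctness of the tree functions *)

Lemma tifE c x y : tif c x y = if isn c then x else y. Proof. by case: c. Qed.

Lemma isn_code b : isn (code_bool b) = b. Proof. by case: b. Qed.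

Lemma isn_tif c x : isn (tif c x Leaf) = isn c && isn x. Proof. by case: c. Qed.

Lemma tlenE l : tlen l = code_nat (nval l).
Proof. by rewrite /tlen /tmap /nval; elim: (tlist l) => //= x s ->. Qed.

Lemma clip_code i k : i <= k -> clip (code_nat i) (code_nat k) = code_nat i.
Proof. by elim: i k => [|i IH] [|k] //= h; rewrite IH. Qed.

Lemma clip_tcons s k b : size s <= k -> (forall x, List.In x s -> clip x b = x) ->
  clip (tcons s) (tcons (nseq k b)) = tcons s.
Proof.
elim: s k => [|x s IH] [|k] //= hs h; rewrite h; last by left.
by rewrite IH // => y hy; apply: h; right.
Qed.

Lemma tmap_const b l : tmap (fun=> b) l = tcons (nseq (nval l) b).
Proof. by rewrite /tmap /nval; elim: (tlist l) => //= x s ->. Qed.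

Lemma tmapE f s : tmap f (tcons s) = tcons [seq f x | x <- s].
Proof. by rewrite /tmap tlistK. Qed.

Lemma In_iota k i j : List.In k (iota i j) <-> i <= k < i + j.
Proof.
elim: j i => [|j IH] i /=; first by split=> //; lia.
rewrite IH; split=> [[->|h]|h]; [lia|lia|].
by case: (eqVneq i k) => h'; [left|right; lia].
Qed.

Lemma tverts_aux N (s : seq tree) : size s <= N ->
  foldr (fun _ y => clip (Node Leaf (tmap (fun x => Node Leaf x) y)) (tcons (nseq N (code_nat N)))) Leaf s =
  tcons [seq code_nat i | i <- iota 0 (size s)].
Proof.
elim: s => [//|x s IH] hs.
pose G N (_ y : tree) := clip (Node Leaf (tmap (fun x => Node Leaf x) y)) (tcons (nseq N (code_nat N))).
rewrite -[foldr _ _ _]/(G N x (foldr (G N) Leaf s)) IH ?(ltnW hs) // /G {G}.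
rewrite tmapE -map_comp.
have -> : Node Leaf (tcons [seq ((fun x => Node Leaf x) \o code_nat) i | i <- iota 0 (size s)]) =
    tcons [seq code_nat i | i <- iota 0 (size (x :: s))].
  by rewrite /= -[1]addn0 iotaDl -map_comp.
rewrite clip_tcons ?size_map ?size_iota // => y /In_map[i [/In_iota hi ->]].
by apply: clip_code; move: hs hi => /=; lia.
Qed.

Lemma tvertsE l : tverts l = tcons [seq code_nat i | i <- iota 0 (nval l)].
Proof. by rewrite /tverts tmap_const tlenE /tcfold tverts_aux. Qed.

Lemma tcfold_filter (P h : tree -> tree) b s k : size s <= k ->
  (forall x, List.In x s -> clip (h x) b = h x) ->
  tcfold (fun x acc => tif (P x) (Node (h x) acc) acc) (tcons (nseq k b)) Leaf (tcons s) =
  tcons [seq h x | x <- s & isn (P x)].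
Proof.
rewrite /tcfold tlistK; elim: s => //= x s IH hs hh; rewrite IH; [|lia|by move=> y hy; apply: hh; right].
have E : forall x, List.In x [seq h x | x <- s & isn (P x)] -> clip x b = x.
  move=> y /In_map[z [hz ->]]; apply: hh; right.
  by elim: (s) hz => //= w s' IH'; case: ifP => _ /=; tauto.
have hs' : size [seq h x | x <- s & isn (P x)] <= size s by rewrite size_map size_filter count_size.
rewrite tifE; case: ifP => _; rewrite ?map_cons -/(tcons (_ :: _)).
  have := @clip_tcons (h x :: [seq h x | x <- s & isn (P x)]) k b; apply=> /=; first by lia.
  by move=> y [<-|/E //]; apply: hh; left.
by apply: clip_tcons => //; lia.
Qed.

Lemma tcfold_any (P : tree -> tree) l :
  tcfold (fun x acc => tif (P x) tt1 acc) tt1 Leaf l = code_bool (has (fun x => isn (P x)) (tlist l)).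
Proof.
rewrite /tcfold; elim: (tlist l) => //= x s ->; rewrite tifE.
by case: isn => //=; rewrite clip_bool.
Qed.

Lemma tcfold_none (P : tree -> tree) l :
  tcfold (fun x acc => tif (P x) Leaf acc) tt1 tt1 l = code_bool (~~ has (fun x => isn (P x)) (tlist l)).
Proof.
rewrite /tcfold; elim: (tlist l) => //= x s ->; rewrite tifE.
by case: isn => //=; rewrite clip_bool.
Qed.

Lemma tcfold_all (P : tree -> tree) l :
  tcfold (fun x acc => tif (P x) acc Leaf) tt1 tt1 l = code_bool (all (fun x => isn (P x)) (tlist l)).
Proof.
rewrite /tcfold; elim: (tlist l) => //= x s ->; rewrite tifE.
by case: isn => //=; rewrite clip_bool.
Qed.

Lemma tboundE A : tbound A = tcons (nseq (nval A) (code_nat (nval A))).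
Proof. by rewrite /tbound tlenE tmap_const. Qed.

Definition fverts (A : tree) (P : tree -> tree) : seq tree :=
  [seq code_nat i | i <- iota 0 (nval A) & isn (P (code_nat i))].

Lemma tcfold_verts A P : tcfold (fun v acc => tif (P v) (Node v acc) acc) (tbound A) Leaf (tverts A) =
  tcons (fverts A P).
Proof.
rewrite tboundE tvertsE (@tcfold_filter P id); last 2 first.
- by rewrite size_map size_iota.
- by move=> x /In_map[i [/In_iota hi ->]]; apply: clip_code; lia.
by rewrite map_id filter_map.
Qed.

(** Rank and selection are inverse to each other; used both for guesses and for labels. *)
Lemma nth_filter_iota (P : pred nat) n l : l < n -> P l ->
  count P (iota 0 l) < size [seq k <- iota 0 n | P k] /\
  nth 0 [seq k <- iota 0 n | P k] (count P (iota 0 l)) = l.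
Proof.
move=> hl hp; have hn : l + (n - l.+1).+1 = n by lia.
have E : [seq k <- iota 0 n | P k] = [seq k <- iota 0 l | P k] ++ l :: [seq k <- iota l.+1 (n - l.+1) | P k].
  by rewrite -[in LHS]hn iotaD filter_cat /= hp.
rewrite E -size_filter; split; first by rewrite size_cat addnS ltnS leq_addr.
by rewrite nth_cat ltnn subnn.
Qed.

Section Prec.
Variables (body : tree -> tree -> tree -> tree -> tree) (c : tree -> tree).
Let pc t := tfst (pcrec body c t).

Lemma clipK u b : clip (clip u b) b = clip u b.
Proof. by elim: b u => [|b1 IH1 b2 IH2] [|u1 u2] //=; rewrite IH1 IH2. Qed.

(** The value of a child is clipped a second time when it is stored at the parent. *)
Lemma pc_clip t : clip (pc t) (c t) = pc t.
Proof. by rewrite /pc; case: t => [|x y] /=; [case: (c Leaf)|rewrite clipK]. Qed.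

Lemma pcE x y : pc (Node x y) = clip (body (Node x y) (pc y) (pc (tfst y)) (pc (tsnd y))) (c (Node x y)).
Proof.
rewrite {1}/pc /pcrec /tcrec /=; congr clip; congr (body _ _ _ _); case: y => //= p q.
  by rewrite -[RHS]pc_clip.
by rewrite -[RHS]pc_clip.
Qed.
End Prec.

Lemma teqE i j : teq (code_nat i) (code_nat j) = code_bool (i == j).
Proof. by rewrite /teq !tlt_code; case: ltngtP. Qed.

Section Relabel.
Variable L : nat.

Lemma toccursE l m (phi : fo L m) : toccurs (code_nat l) (code_fo phi) = code_bool (occurs l phi).
Proof.
rewrite /toccurs; elim: m / phi => [m i j|m i j|m k i|m p IH|m p IHp q IHq|m p IHp q IHq|m p IH|m p IH];
  rewrite [code_fo _]/= pcE /occ_body /=; rewrite /tnth /= ?clip_bool //.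
- by rewrite teqE clip_bool.
- by rewrite IH clip_bool.
- by rewrite IHp IHq tifE isn_code; case: occurs => //=; rewrite clip_bool.
- by rewrite IHp IHq tifE isn_code; case: occurs => //=; rewrite clip_bool.
- by rewrite IH clip_bool.
- by rewrite IH clip_bool.
Qed.

Definition lrank m (phi : fo L m) (l : nat) : nat := count (fun k => occurs k phi) (iota 0 l).

Lemma trkE Ls m (phi : fo L m) l : nval Ls = L -> l <= L ->
  trk Ls (code_fo phi) (code_nat l) = code_nat (lrank phi l).
Proof.
move=> hL hl; rewrite /trk tvertsE hL.
have E : code_nat l = tcons (nseq l Leaf) by elim: (l) => //= k ->.
have -> : lrank phi l = count (fun k => occurs k phi && (k < l)) (iota 0 L).
  have -> : iota 0 L = iota 0 l ++ iota l (L - l) by rewrite -{1}(subnKC hl) iotaD.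
  rewrite count_cat.
  rewrite [X in _ = _ + X](_ : _ = 0) ?addn0.
    apply: eq_in_count => k; rewrite mem_iota => /= h; by rewrite h andbT.
  rewrite (@eq_in_count _ _ pred0) ?count_pred0 // => k; rewrite mem_iota => /andP[h _].
  by rewrite /= ltnNge h andbF.
rewrite /tcfold tlistK foldr_map.
suff H (s : seq nat) : uniq s -> foldr (fun x z => clip (tif (tif (toccurs (code_nat x) (code_fo phi)) (tlt (code_nat x) (code_nat l)) Leaf)
     (Node Leaf z) z) (code_nat l)) Leaf s = code_nat (count (fun k => occurs k phi && (k < l)) s).
  by apply: H; apply: iota_uniq.
elim: s => //= k s IH /andP[ks us]; rewrite IH // toccursE tlt_code !tifE !isn_code.
have bnd t : uniq t -> count (fun k0 => occurs k0 phi && (k0 < l)) t <= l.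
  move=> ut; rewrite -size_filter -[X in _ <= X](size_iota 0 l); apply: uniq_leq_size.
    exact: filter_uniq.
  by move=> x; rewrite mem_filter mem_iota => /andP[/andP[_ h] _].
have := bnd (k :: s); rewrite /= ks us => /(_ isT).
case: (occurs k phi) => /=; last by move=> h; rewrite add0n clip_code.
rewrite isn_code; case: (k < l) => h; last by rewrite add0n clip_code.
by rewrite -[Node Leaf (code_nat _)]/(code_nat _.+1) clip_code.
Qed.

Lemma clip_code_self t : clip t t = t.
Proof. by elim: t => //= x -> y ->. Qed.

Lemma trelabelE Ls M (psi : fo L M) m (phi : fo L m) : nval Ls = L ->
  tfst (pcrec (rel_body Ls (code_fo psi)) (fun t => t) (code_fo phi)) = rcode (lrank psi) phi.
Proof.
move=> hL.
suff H : tfst (pcrec (rel_body Ls (code_fo psi)) (fun t => t) (code_fo phi)) = rcode (lrank psi) phi /\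
   clip (rcode (lrank psi) phi) (code_fo phi) = rcode (lrank psi) phi by case: H.
have hr l : lrank psi l <= l by rewrite -[X in _ <= X](size_iota 0 l) count_size.
elim: m / phi => [m i j|m i j|m k i|m p [IH1 IH2]|m p [IHp IHp2] q [IHq IHq2]|m p [IHp IHp2] q [IHq IHq2]
  |m p [IH1 IH2]|m p [IH1 IH2]];
  rewrite [code_fo _]/= pcE /rel_body [rcode _ _]/= /rnode /=; rewrite /tnth /=.
- by rewrite !clip_code_self.
- by rewrite !clip_code_self.
- by rewrite trkE ?(ltnW (ltn_ord k)) // clip_code ?hr // clip_code_self.
- by rewrite IH1 IH2.
- by rewrite IHp IHq IHp2 IHq2.
- by rewrite IHp IHq IHp2 IHq2.
- by rewrite IH1 IH2.
- by rewrite IH1 IH2.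
Qed.

Lemma count_orb (T : Type) (a b : pred T) s : count (fun x => a x || b x) s <= count a s + count b s.
Proof. by elim: s => //= x s IH; case: (a x); case: (b x); lia. Qed.

Lemma lrank_bound m (phi : fo L m) l : lrank phi l <= fo_size phi.
Proof.
rewrite /lrank; elim: m / phi => [m i j|m i j|m k i|m p IH|m p IHp q IHq|m p IHp q IHq|m p IH|m p IH] /=.
- by rewrite count_pred0.
- by rewrite count_pred0.
- rewrite (@eq_count _ _ (pred1 (k : nat))) => [|x]; last by rewrite /= eq_sym.
  by rewrite count_uniq_mem ?iota_uniq //; case: (_ \in _).
- by apply: leq_trans IH _; lia.
- by apply: leq_trans (count_orb _ _ _) _; apply: ltnW; rewrite ltnS leq_add.
- by apply: leq_trans (count_orb _ _ _) _; apply: ltnW; rewrite ltnS leq_add.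
- by apply: leq_trans IH _; lia.
by apply: leq_trans IH _; lia.
Qed.
End Relabel.

Lemma code_seqE (T : Type) (f : T -> tree) s : code_seq f s = tcons [seq f x | x <- s].
Proof. by elim: s => //= x s ->. Qed.

Lemma foldr_cons (T U : Type) (f : T -> U -> U) z x s : foldr f z (x :: s) = f x (foldr f z s).
Proof. by []. Qed.

Lemma nval_tcons s : nval (tcons s) = size s.
Proof. by rewrite /nval tlistK. Qed.

Lemma In_tlists X k s : size s = k -> (forall x, List.In x s -> List.In x (tlist X)) ->
  List.In (tcons s) (tlist (tlists X (code_nat k))).
Proof.
rewrite /tlists /tfold tlist_code; elim: k s => [|k IH] [|x s] // => [_ _|[hs] h]; first by left.
rewrite [foldr _ _ _]/= tlist_tflat tlist_tmap In_flatten.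
set acc := foldr _ _ _ in IH *.
exists [seq Node x y | y <- tlist acc]; split.
  apply/In_map; exists (tmap (fun y => Node x y) acc); split; last by rewrite tlist_tmap.
  by apply/In_map; exists x; split=> //; apply: h; left.
apply/In_map; exists (tcons s); split=> //; apply: IH => //.
by move=> y hy; apply: h; right.
Qed.

#[local] Opaque ssem stree.

(** * The search over guesses *)

Section Search.
Variables (n : nat) (e : rel 'I_n.+1).
Local Notation V := 'I_n.+1.
Hypothesis e_sym : symmetric e.
Hypothesis e_irr : irreflexive e.
Let A := tcons [seq tcons [seq code_bool (e x y) | y <- enum V] | x <- enum V].

Lemma nvalA : nval A = n.+1.
Proof. by rewrite nval_tcons size_map size_enum_ord. Qed.

Lemma enum_iota : [seq vcode v | v <- enum V] = [seq code_nat i | i <- iota 0 n.+1].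
Proof. by rewrite -val_enum_ord -map_comp. Qed.

Lemma tvertsA : tverts A = vlist n.
Proof. by rewrite tvertsE nvalA /vlist enum_iota. Qed.

Lemma tcubeE b : tcube (code_bool b) (vlist n) = cube (fun _ _ _ : V => b).
Proof. by rewrite /tcube !tmap_vlist. Qed.

Lemma tfullA : tfull A = fullst n 11.
Proof. by rewrite /tfull tvertsA -[tt1]/(code_bool true) tcubeE. Qed.

Definition init_st : seq (rel3 n) := (fun x y _ => e x y) :: nseq 10 (@rel0 n).

Lemma tinitA : tinit A = scode init_st.
Proof.
rewrite /tinit tvertsA -[Leaf]/(code_bool false) tcubeE /scode /=; congr Node.
rewrite tmap_vlist /cube; congr tcons; apply: eq_map => x.
rewrite tmap_vlist; congr tcons; apply: eq_map => y.
rewrite tmap_vlist; congr tcons; apply: eq_map => z.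
by rewrite !tnth_enum.
Qed.

Definition greedy_st : seq (rel3 n) := ssem greedy_stmt (@env0 n) init_st.

Lemma tgreedyA : tgreedy A = scode greedy_st.
Proof.
rewrite /tgreedy tvertsA tfullA tinitA.
exact: (stree_sem greedy_stmt init_st (@enc0 n)).
Qed.

Lemma size_greedy : size greedy_st = 11. Proof. by rewrite size_ssem. Qed.

Lemma lookE (st : seq (rel3 n)) k (x y z : V) : k < size st ->
  look (tget k (scode st)) (vcode x) (vcode y) (vcode z) = code_bool (slot st k x y z : bool).
Proof. by move=> h; rewrite /look tget_scode h /cube !tnth_enum. Qed.

Let I : pred V := indp greedy_st.

Lemma tindpA v : tindp A (vcode v) = code_bool (I v).
Proof. by rewrite /tindp tgreedyA lookE // size_greedy. Qed.

Lemma greedy_facts : [/\ keeps 1 init_st greedy_st, forall i j, I i -> I j -> ~~ e i j &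
  forall u, I u \/ exists2 i, I i & e i u].
Proof.
by have [] := @greedyP n (@env0 n) init_st isT (fun=> erefl) e_sym e_irr.
Qed.

Lemma edge_greedy : edge greedy_st = e.
Proof. by case: greedy_facts => h _ _; rewrite (edge_keeps h). Qed.

Definition indn (k : nat) : bool := isn (tindp A (code_nat k)).

Lemma indnE (v : V) : indn v = I v.
Proof. by rewrite /indn -[code_nat v]/(vcode v) tindpA isn_code. Qed.

Definition indl : seq nat := [seq k <- iota 0 n.+1 | indn k].
Definition rankn (i : nat) : nat := count indn (iota 0 i).

Lemma tcardA : tcard A = code_nat (size indl).
Proof. by rewrite /tcard /tindlist tcfold_verts tlenE nval_tcons /fverts size_map nvalA. Qed.

Lemma size_indl : size indl <= independence_number e.
Proof.
case: greedy_facts => _ hI _; apply: leq_trans (I_bound hI).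
rewrite /indl -val_enum_ord filter_map size_map cardE; apply: uniq_leq_size.
  by rewrite filter_uniq ?enum_uniq.
by move=> v; rewrite mem_filter !mem_enum !inE /= indnE => /andP[].
Qed.

Lemma trankA (i : V) : trank A (vcode i) = code_nat (rankn i).
Proof.
rewrite /trank tcfold_verts tlenE nval_tcons /fverts size_map nvalA size_filter.
congr code_nat; rewrite /rankn.
have -> : iota 0 n.+1 = iota 0 i ++ iota i (n.+1 - i).
  by rewrite -[in LHS](subnKC (ltnW (ltn_ord i))) iotaD.
rewrite count_cat.
rewrite [X in _ + X = _](_ : _ = 0) ?addn0.
  apply: eq_in_count => k; rewrite mem_iota => /= h.
  by rewrite isn_tif tlt_code isn_code h andbT.
rewrite (@eq_in_count _ _ pred0) ?count_pred0 // => k; rewrite mem_iota => /andP[h _].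
by rewrite isn_tif tlt_code isn_code ltnNge h andbF.
Qed.

Lemma nth_rank (i : V) : I i -> rankn i < size indl /\ nth 0 indl (rankn i) = i.
Proof.
by rewrite -indnE => hi; apply: (nth_filter_iota (ltn_ord i) hi).
Qed.

Lemma guess_ex (G : V -> V -> bool) : exists2 g, List.In g (tlist (tguesses (tcard A))) &
  forall i j, I i -> I j -> isn (tnth (tnth g (trank A (vcode i))) (trank A (vcode j))) = G i j.
Proof.
pose row a := tcons [seq code_bool (G (inord a) (inord b)) | b <- indl].
exists (tcons [seq row a | a <- indl]).
  rewrite tcardA /tguesses.
  have H X t : size t = size indl -> (forall x, List.In x t -> List.In x (tlist X)) ->
      List.In (tcons t) (tlist (tlists X (code_nat (size indl)))) := @In_tlists X (size indl) t.
  refine (H _ [seq row a | a <- indl] _ _); first by rewrite size_map.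
  move=> x /In_map[a [_ ->]].
  refine (H _ [seq code_bool (G (inord a) (inord b)) | b <- indl] _ _); first by rewrite size_map.
  by move=> y /In_map[b [_ ->]]; case: (G _ _) => /=; tauto.
move=> i j /nth_rank[hi ei] /nth_rank[hj ej].
rewrite !trankA (tnth_map 0) // /row (tnth_map 0) // isn_code ei ej.
by rewrite !inord_val.
Qed.

Definition guess_of (g : tree) : rel3 n := fun i j _ => isn (tnth (tnth g (trank A (vcode i))) (trank A (vcode j))).
Definition guess_st (g : tree) : seq (rel3 n) := upd 2 (guess_of g) greedy_st.
Definition attempt_st (g : tree) : seq (rel3 n) := ssem attempt_stmt (@env0 n) (guess_st g).

Lemma size_guess g : size (guess_st g) = 11. Proof. by rewrite size_upd size_greedy. Qed.
Lemma size_attempt g : size (attempt_st g) = 11. Proof. by rewrite size_ssem size_guess. Qed.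

Lemma tattemptA g : tattempt A g = scode (attempt_st g).
Proof.
rewrite /tattempt tvertsA tfullA tgreedyA.
have -> : tguessed A g = cube (guess_of g).
  rewrite /tguessed tvertsA tmap_vlist; congr tcons; apply: eq_map => x.
  rewrite tmap_vlist; congr tcons; apply: eq_map => y.
  rewrite tmap_vlist; congr tcons; apply: eq_map => z.
  by rewrite tifE /guess_of; case: isn.
rewrite tupd_scode -(size_guess g).
exact: (stree_sem attempt_stmt (guess_st g) (@enc0 n)).
Qed.

Lemma tokA (st : seq (rel3 n)) : size st = 11 -> isn (tok (scode st)) = (slot st 10 ord0 ord0 ord0 : bool) :> bool.
Proof. by move=> h; rewrite /tok -[Leaf]/(vcode (ord0 : V)) lookE ?h // isn_code. Qed.

Definition accepted (g : tree) : bool := slot (attempt_st g) 10 ord0 ord0 ord0.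

#[local] Opaque attempt_st.

(** The accepted guess that is returned may differ from the one known to be accepted. *)
Lemma tsearchA gs : exists st, [/\ tsearch A gs = scode st, size st = 11 &
  forall g, List.In g (tlist gs) -> accepted g -> exists2 g', st = attempt_st g' & accepted g'].
Proof.
rewrite /tsearch /tcfold; elim: (tlist gs) => [|g s [st [h1 h2 h3]]].
  by exists greedy_st; split; [exact: tgreedyA|exact: size_greedy|].
rewrite foldr_cons h1 tifE tattemptA tokA ?size_attempt // tfullA -/(accepted g).
have [hg|hg] := boolP (accepted g).
  exists (attempt_st g); split; [|exact: size_attempt|move=> g' _ _; exists g; [reflexivity|exact: hg]].
  by rewrite -(size_attempt g) clip_scode.
exists st; split; [by rewrite -h2 clip_scode|exact: h2|].
move=> g' /In_cons[<-|]; last exact: h3.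
by move=> acc; case/negP: hg.
Qed.

#[local] Transparent attempt_st.

Section Circle.
Variables (l r : V -> nat).
Hypothesis lr : forall u, l u < r u.
Hypothesis linj : injective l.
Hypothesis rinj : injective r.
Hypothesis l_r : forall u v, l u <> r v.
Hypothesis eE : forall u v, e u v = overlap l r u v.

Lemma guess_facts g : edge (guess_st g) = e /\ indp (guess_st g) =1 I.
Proof.
have k : keeps 2 greedy_st (guess_st g) by apply: keeps_upd.
by rewrite (edge_keeps k) // edge_greedy (indp_keeps k).
Qed.

(** The diagram yields one guess that must be accepted; the properties of the state returned come
    from its own successful check. *)
Lemma search_ok : exists G D, exists st, let I' := indp (guess_st G) in
  let G' := guess (guess_st G) in
  [/\ tsearch A (tguesses (tcard A)) = scode st, size st = 11,
    forall x y, slot st 8 x y y = orient e I' G' D x y,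
    forall x y, slot st 9 x y y = same e I' G' D x y & cert_ok e I' G' D].
Proof.
have [st [h1 h2 h3]] := tsearchA (tguesses (tcard A)).
case: greedy_facts => _ hI hM.
(* The guess read off the diagram: the arc of the first nontrivial vertex, with the sign that
   [side_top] expects. *)
pose G0 i j := [exists v, fstnt e I i j v && ~~ top l r i j v].
have [g gin hg] := guess_ex G0.
have acc : accepted g.
  have [eg ig] := guess_facts g.
  have := @attemptP n (@env0 n) (guess_st g) (size_guess g); rewrite eg => /(_ e_sym e_irr)[D [_ _ h10 hc]].
  rewrite /accepted /attempt_st h10.
  apply: (hc l r lr linj rinj l_r eE).
  - by move=> i j; rewrite !ig; apply: hI.
  - by move=> u; rewrite ig; case: (hM u) => [|[i hi hu]]; [left|right; exists i; rewrite ?ig].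
  have Ig : indp (guess_st g) = I.
    by rewrite /indp /I /indp /guess_st slot_upd.
  rewrite Ig => i j v hv; rewrite /guess /guess_st slot_same ?size_greedy // /guess_of.
  have /andP[/andP[/and4P[Ii Ij _ _] _] _] := hv.
  rewrite hg // /G0; apply/existsP/idP => [[w /andP[hw ht]]|ht]; last by exists v; rewrite hv.
  have -> : v = w; last exact: ht.
  move: hv hw => /andP[a1 /forallP a2] /andP[b1 /forallP b2].
  apply: (first_uniq a1 _ b1) => z hz; first by have := a2 z; rewrite hz.
  by have := b2 z; rewrite hz.
have [g' E acc'] := h3 g gin acc.
have [eg ig] := guess_facts g'.
have := @attemptP n (@env0 n) (guess_st g') (size_guess g'); rewrite eg.
move=> /(_ e_sym e_irr)[D [h8 h9 h10 _]].
exists g', D, (attempt_st g'); split=> //.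
- by rewrite h1 E.
- exact: size_attempt.
by rewrite -(h10 ord0 ord0 ord0).
Qed.
End Circle.
End Search.

(** * Certified orientations *)

Definition mMt (S : tree) (x y : nat) : bool := isn (torient S (code_nat x) (code_nat y)).
Definition mLet (S : tree) (x y : nat) : bool :=
  isn (tsame S (code_nat x) (code_nat y)) && ((x == y) || mMt S x y).
Definition mSt (S R : tree) (b x : nat) : bool :=
  (b < nval R) && isn (tsame S (tnth R (code_nat b)) (code_nat x)).
Definition mLt (U : tree) (b x : nat) : bool := isn (tele U (code_nat b) (code_nat x)).

(** The hypotheses of [qe_correct] about the orientation, read off the final state, and the bound on
    the number of sorts. *)
Record certified (n : nat) (e : rel 'I_n) (S R : tree) : Prop := Certified {
  c_refl : forall x, x < n -> mLet S x x;
  c_trans : forall x y z, x < n -> y < n -> z < n -> mLet S x y -> mLet S y z -> mLet S x z;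
  c_anti : forall x y, x < n -> y < n -> mLet S x y -> mLet S y x -> x = y;
  c_mono : forall x x' y y', x < n -> x' < n -> y < n -> y' < n ->
    mLet S x' x -> mLet S y y' -> mMt S x y -> mMt S x' y';
  c_chain : forall b x y, x < n -> y < n -> mSt S R b x -> mSt S R b y -> mLet S x y || mLet S y x;
  c_cover : forall z, z < n -> has (fun b => mSt S R (nval b) z) (tlist (tverts R));
  c_adj : forall u v : 'I_n, e u v = mMt S u v || mMt S v u;
  c_size : nval R <= sort_bound (independence_number e) }.

Definition code_adj n (e : rel 'I_n) : tree :=
  tcons [seq tcons [seq code_bool (e x y) | y <- enum 'I_n] | x <- enum 'I_n].

(** The semantics of loop programs presupposes a vertex, so the empty graph is treated apart. *)
Lemma certified0 (e : rel 'I_0) S : certified e S (treps (code_adj e) S).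
Proof.
split=> // [[[]] //|].
have -> : code_adj e = Leaf by rewrite /code_adj; have := size_enum_ord 0; case: (enum _).
by [].
Qed.

Section Certified.
Variables (n : nat) (e : rel 'I_n.+1).
Local Notation V := 'I_n.+1.
Hypothesis e_sym : symmetric e.
Hypothesis e_irr : irreflexive e.
Variables (l r : V -> nat).
Hypothesis lr : forall u, l u < r u.
Hypothesis linj : injective l.
Hypothesis rinj : injective r.
Hypothesis l_r : forall u v, l u <> r v.
Hypothesis eE : forall u v, e u v = overlap l r u v.
Let A := code_adj e.
Let S := tsearch A (tguesses (tcard A)).
Let R := treps A S.

Theorem search_certified : certified e S R.
Proof.
have [G [D [st []]]] := search_ok e_sym e_irr lr linj rinj l_r eE.
set I' := indp _; set G' := guess _; move=> hS hs h8 h9 hok.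
rewrite -/A -/S in hS.
pose M (u w : V) := orient e I' G' D u w; pose sm (u w : V) := same e I' G' D u w.
have MtE (u w : V) : mMt S u w = M u w.
  by rewrite /mMt hS /torient -[code_nat u]/(vcode u) -[code_nat w]/(vcode w) lookE ?hs // isn_code h8.
have StE (u w : V) : isn (tsame S (code_nat u) (code_nat w)) = sm u w.
  by rewrite hS /tsame -[code_nat u]/(vcode u) -[code_nat w]/(vcode w) lookE ?hs // isn_code h9.
have LtE (u w : V) : mLet S u w = sle e I' G' D u w by rewrite /mLet StE MtE.
have ordE x : x < n.+1 -> exists v : V, x = v by move=> h; exists (Ordinal h).
case/and4P: (hok) => /forallP ok1 /forallP ok2 /forallP ok3 ok4.
have adjM u w : e u w = M u w || M w u by have /forallP/(_ w)/eqP := ok1 u.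
have mono u w u' w' : sle e I' G' D u' u -> sle e I' G' D w w' -> M u w -> M u' w'.
  move=> a b c; have /forallP/(_ w)/forallP/(_ u')/forallP/(_ w')/implyP := ok3 u; apply.
  by rewrite a b.
have Mirr u : M u u = false.
  by apply/negP => h; have := adjM u u; rewrite e_irr h.
have sle_refl u : sle e I' G' D u u by rewrite /sle same_refl eqxx.
(* Antisymmetry and the transitivity below both come from monotonicity; here it would yield a loop
   [M u u]. *)
have anti u w : sle e I' G' D u w -> sle e I' G' D w u -> u = w.
  move=> h1 h2; apply/eqP/negPn/negP => ne.
  have h : M u w by move: h1; rewrite /sle (negbTE ne) => /andP[].
  by have := mono _ _ _ _ (sle_refl u) h2 h; rewrite Mirr.
have trans u v w : sle e I' G' D u v -> sle e I' G' D v w -> sle e I' G' D u w.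
  move=> h1 h2; have /andP[s1 o1] := h1; have /andP[s2 o2] := h2.
  rewrite /sle (same_trans s1 s2) /=; case/orP: o1 => [/eqP E|o1]; first by rewrite E o2.
  by rewrite [orient _ _ _ _ _ _](mono _ _ _ _ (sle_refl u) h2 o1) orbT.
have chain u w : sm u w -> sle e I' G' D u w || sle e I' G' D w u.
  move=> h; have [->|ne] := eqVneq u w; first by rewrite sle_refl.
  have ad : e u w by have /forallP/(_ w)/implyP := ok2 u; apply; apply/andP; split; [exact: h|exact: ne].
  rewrite /sle -!/(sm _ _) h (same_sym h : sm w u) [w == u]eq_sym (negbTE ne) /=.
  by rewrite adjM in ad.
pose rep (v : V) := ~~ [exists w : V, (w < v) && sm w v].
pose repn (k : nat) := isn (tisrep S (tverts A) (code_nat k)).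
have repE (v : V) : repn v = rep v.
  rewrite /repn /tisrep tcfold_none isn_code; congr negb.
  rewrite tvertsE tlistK has_map (nvalA e); apply/hasP/existsP => [[k]|[w /andP[h1 h2]]].
    rewrite mem_iota => /= /ordE[w ->]; rewrite isn_tif tlt_code isn_code StE => h.
    by exists w.
  by exists (w : nat); rewrite ?mem_iota ?ltn_ord //= isn_tif tlt_code isn_code StE h1.
pose rl := [seq k <- iota 0 n.+1 | repn k].
have RE : R = tcons [seq code_nat k | k <- rl].
  by rewrite /R /treps tcfold_verts /fverts (nvalA e).
have nR : nval R = size rl by rewrite RE nval_tcons size_map.
have rlP k : k < size rl -> exists v : V, nth 0 rl k = v /\ rep v.
  move=> /(mem_nth 0); rewrite mem_filter mem_iota => /andP[h1 /ordE[v hv]].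
  by exists v; split=> //; rewrite -repE -hv.
have SbE b (x : V) : b < size rl -> forall v : V, nth 0 rl b = v -> mSt S R b x = sm v x.
  by move=> hb v hv; rewrite /mSt nR hb RE (tnth_map 0) // hv StE.
split.
- by move=> x /ordE[v ->]; rewrite LtE.
- by move=> x y z /ordE[u ->] /ordE[v ->] /ordE[w ->]; rewrite !LtE; apply: trans.
- by move=> x y /ordE[u ->] /ordE[v ->]; rewrite !LtE => h1 h2; rewrite (anti _ _ h1 h2).
- move=> x x' y y' /ordE[u ->] /ordE[u' ->] /ordE[v ->] /ordE[v' ->]; rewrite !LtE !MtE; exact: mono.
- move=> b x y /ordE[u ->] /ordE[v ->] h1 h2; rewrite !LtE; apply: chain.
  have hb : b < size rl by move: h1; rewrite /mSt nR => /andP[].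
  have [w [hw _]] := rlP _ hb.
  move: h1 h2; rewrite !(SbE _ _ hb _ hw) => h1 h2; exact: same_trans (same_sym h1) h2.
- move=> z /ordE[u ->]; rewrite tvertsE tlistK has_map nR.
  have [v hv mv] := first_ex (P := fun v => sm v u) (same_refl e I' G' D u).
  have rv : rep v.
    apply/existsPn => w; apply/negP => /andP[h1 h2].
    by have := mv w h1; rewrite /sm (same_trans h2 hv).
  have vr : (v : nat) \in rl by rewrite mem_filter mem_iota repE rv ltn_ord.
  apply/hasP; exists (index (v : nat) rl); first by rewrite mem_iota index_mem.
  by rewrite /= code_natK (SbE _ _ _ v) ?index_mem // nth_index.
- by move=> u v; rewrite !MtE; apply: adjM.
rewrite nR.
case: (greedy_facts e_sym e_irr) => _ hI _.
have [_ ig] := @guess_facts n e e_sym e_irr G.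
have hI' i j : I' i -> I' j -> ~~ e i j by move=> hi hj; apply: hI; rewrite -ig.
apply: leq_trans (sorts_bound e_sym e_irr hI' hok (R := [set v | rep v]) _).
  rewrite /rl -val_enum_ord filter_map size_map cardE; apply: uniq_leq_size.
    by rewrite filter_uniq ?enum_uniq.
  by move=> v; rewrite mem_filter !mem_enum !inE /= repE => /andP[].
move=> x y; rewrite !inE => /existsPn hx /existsPn hy h; apply/val_inj.
case: (ltngtP (val x) (val y)) => // hlt.
  by have := hy x; rewrite hlt /sm h.
by have := hx y; rewrite hlt /sm (same_sym h).
Qed.
End Certified.

Lemma tnth_nval l i : tnth l i = nth Leaf (tlist l) (nval i). Proof. by []. Qed.

Lemma tnth_codeE l i : tnth l (code_nat (nval i)) = tnth l i.
Proof. by rewrite !tnth_nval code_natK. Qed.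

(** * Evaluation of relation expressions *)

Section Eval.
Variables (S R U A : tree).
Let N := nval A.
Let c := Node S (Node R U).
Let V := tverts A.
Let W := tverts (Node Leaf A).
Notation sem := (rsem N (mLet S) (mMt S) (mSt S R) (mLt U)).

Lemma WE : W = tcons [seq code_nat i | i <- iota 0 N.+1].
Proof. by rewrite /W tvertsE. Qed.

Lemma tmat_ele f x y : x <= N -> y <= N ->
  tele (tmat f W) (code_nat x) (code_nat y) = code_bool (isn (f (code_nat x) (code_nat y))).
Proof.
move=> hx hy.
have H (g : tree -> tree) z : z <= N -> tnth (tmap g W) (code_nat z) = g (code_nat z).
  by move=> hz; rewrite WE tmapE -map_comp (tnth_map 0) ?size_iota // nth_iota.
by rewrite /tele /tmat !H // tifE; case: isn.
Qed.

Lemma clip_tmat f : clip (tmat f W) (tmat (fun x y => tt1) W) = tmat f W.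
Proof.
have H (g h : tree -> tree) s : (forall x, clip (g x) (h x) = g x) ->
    clip (tcons [seq g x | x <- s]) (tcons [seq h x | x <- s]) = tcons [seq g x | x <- s].
  by move=> k; elim: s => //= x s ->; rewrite k.
apply: (H) => x; apply: (H) => y; rewrite tifE; case: isn => //.
Qed.

Definition evals (r : tree) : Prop := forall x y, x <= N -> y <= N ->
  tele (tevalr c A r) (code_nat x) (code_nat y) = code_bool (sem r x y).

Lemma rsemE tag p x y : sem (Node tag p) x y =
  match nval tag with
  | 0 => true
  | 1 => mLet S x y
  | 2 => mMt S x y
  | 3 => mSt S R (nval p) x
  | 4 => mLt U (nval p) x
  | 5 => ~~ sem p y x
  | 6 => if p is Node d q then sem d x x && sem q x y else false
  | 7 => if p is Node q1 q2 then has (fun z => sem q1 x z && sem q2 z y) (iota 0 N) else false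
  | _ => false
  end.
Proof. by []. Qed.

Lemma tele_leaf x y : tele Leaf x y = Leaf.
Proof. by rewrite /tele !tnth_nval nth_nil [tlist _]/= nth_nil. Qed.

Lemma evals_leaf : evals Leaf.
Proof. by move=> x y _ _; apply: tele_leaf. Qed.

Lemma clip_mat2 f x y b : x <= N -> y <= N -> isn (f (code_nat x) (code_nat y)) = b ->
  tele (clip (tmat f W) (tmat (fun x y => tt1) W)) (code_nat x) (code_nat y) = code_bool b.
Proof. by move=> hx hy <-; rewrite clip_tmat tmat_ele. Qed.

Lemma evals_node tag p : evals p -> evals (tfst p) -> evals (tsnd p) -> evals (Node tag p).
Proof.
move=> h h1 h2 x y hx hy; rewrite rsemE /tevalr pcE.
rewrite -/(tevalr c A p) -/(tevalr c A (tfst p)) -/(tevalr c A (tsnd p)) -/W -/V.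
rewrite /eval_body tnth_nval [tfst (Node tag p)]/= [tsnd (Node tag p)]/= [tfst c]/= [tfst (tsnd c)]/= [tsnd (tsnd c)]/=.
lazy beta iota zeta delta [tlist].
case: (nval tag) => [|[|[|[|[|[|[|[|k]]]]]]]]; lazy beta iota zeta delta [nth]; try apply: clip_mat2 => //.
- rewrite /mLet /mMt isn_tif; congr andb; rewrite tifE teqE isn_code.
  by case: eqP.
- rewrite isn_tif tlenE /mSt; congr andb.
  by rewrite /tlt -tnth_codeE -/(tlt _ _) tlt_code isn_code.
  by rewrite tnth_codeE.
- by rewrite /mLt /tele tnth_codeE.
- by rewrite h // tifE isn_code; case: (sem p y x).
- rewrite isn_tif h1 // h2 // !isn_code; by case: (p).
- rewrite tcfold_any isn_code /V tvertsE tlistK has_map -/N.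
  rewrite (@eq_in_has _ _ (fun z => sem (tfst p) x z && sem (tsnd p) z y)); last first.
    move=> z; rewrite mem_iota => hz; have hz' : z <= N by lia.
    by rewrite [LHS]isn_tif h1 // h2 // !isn_code.
  by case: (p) => //; elim: (iota 0 N).
have -> : clip (nth Leaf [::] k) (tmat (fun _ _ => tt1) W) = Leaf by rewrite nth_nil; case: (tmat _ _).
exact: tele_leaf.
Qed.

(** A node needs the values at both parts of its payload, so the induction carries them along. *)
Lemma evalsP r : evals r.
Proof.
suff : [/\ evals r, evals (tfst r) & evals (tsnd r)] by case.
elim: r => [|t [ht _ _] p [hp h1 h2]]; first by split; exact: evals_leaf.
by split=> //; apply: evals_node.
Qed.

Lemma tanswerE d : tanswer c A d = code_bool (dnf_sat N (mLet S) (mMt S) (mSt S R) (mLt U) [::] d).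
Proof.
rewrite /tanswer tcfold_any; congr code_bool; apply: eq_has => cl.
rewrite tcfold_all isn_code; apply: eq_all => l.
have h0 a : vval [::] a = 0 by rewrite /vval; case: (nval a) => //= k; rewrite nth_nil.
by rewrite -[Leaf]/(code_nat 0) evalsP // isn_code /holds !h0.
Qed.
End Eval.

Definition code_lab L n (G : lgraph L n) (l : 'I_L) : tree :=
  tcons [seq code_bool (v \in lab G l) | v <- enum 'I_n].
Definition code_labs L n (G : lgraph L n) : tree := tcons [seq code_lab G l | l <- enum 'I_L].

Lemma tnth_enum0 m (f : 'I_m -> tree) (v : 'I_m) : tnth (tcons [seq f x | x <- enum 'I_m]) (code_nat v) = f v.
Proof. by rewrite (@tnth_map _ v) ?size_enum_ord // nth_ord_enum. Qed.

Lemma used_ok L n (G : lgraph L n) m (phi : fo L m) :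
  lab_ok G (mLt (tused (code_adj (adj G)) (code_labs G) (code_fo phi))) (lrank phi) phi.
Proof.
move=> l hl v.
have hL : nval (code_labs G) = L by rewrite nval_tcons size_map size_enum_ord.
have hn : nval (code_adj (adj G)) = n by rewrite nval_tcons size_map size_enum_ord.
have labE k (hk : k < L) : tnth (code_labs G) (code_nat k) = code_lab G (Ordinal hk).
  exact: (tnth_enum0 (code_lab G) (Ordinal hk)).
have UE : tused (code_adj (adj G)) (code_labs G) (code_fo phi) =
   tcons [seq tnth (code_labs G) (code_nat k) | k <- iota 0 L & occurs k phi].
  rewrite /tused tmap_const tvertsE hL tmap_const hn (@tcfold_filter _ (tnth (code_labs G))).
  - rewrite filter_map -map_comp; congr tcons; congr map; apply: eq_filter => k /=.
    by rewrite toccursE isn_code.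
  - by rewrite size_map size_iota.
  move=> x /In_map[k [/In_iota hk ->]]; have hk' : k < L by lia.
  rewrite labE; apply: clip_tcons; first by rewrite size_map size_enum_ord.
  by move=> y /In_map[w [_ ->]]; rewrite clip_bool.
have [h1 h2] := nth_filter_iota (P := fun k => occurs k phi) (ltn_ord l) hl.
rewrite /mLt UE /tele (tnth_map 0) // h2.
by rewrite (tnth_enum0 (code_lab G) l) /code_lab (tnth_enum0 (fun v => code_bool (v \in lab G l))) isn_code.
Qed.

#[local] Opaque ssem stree tsearch tguesses tcard treps tanswer qe tused.

Lemma tcard_bound n (e : rel 'I_n) : symmetric e -> irreflexive e ->
  exists2 m, tcard (code_adj e) = code_nat m & m <= independence_number e.
Proof.
case: n e => [|n] e hs hi; last by exists (size (indl e)); [exact: tcardA|exact: size_indl].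
exists 0 => //; have -> : code_adj e = Leaf by rewrite /code_adj; have := size_enum_ord 0; case: (enum _).
by [].
Qed.

Lemma search_certified_all (R : realType) n (e : rel 'I_n) : symmetric e -> irreflexive e -> circle_graph R e ->
  let S := tsearch (code_adj e) (tguesses (tcard (code_adj e))) in certified e S (treps (code_adj e) S).
Proof.
move=> hs hi hc; have [l [r [lr linj rinj l_r eE]]] := circle_positions hi hc.
case: n e hs hi hc l r lr linj rinj l_r eE => [|n] e hs hi _ l r lr linj rinj l_r eE; first exact: certified0.
exact: (search_certified hs hi lr linj rinj l_r eE).
Qed.

Lemma code_lgraphE L n (G : lgraph L n) : code_lgraph G = Node (code_adj (adj G)) (code_labs G).
Proof.
by rewrite /code_lgraph !code_seqE; congr Node; congr tcons; apply: eq_map => x; rewrite code_seqE.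
Qed.

(** The input of [qe]: the list of sorts and the relabelled formula, both bounded by the
    parameters. *)
Definition params (a : tree) : tree :=
  stage2 (Node (tguesses (stage1 a)) a).
Definition decide (a : tree) : tree :=
  stage4 (Node (qe (tfst (params a)) (tsnd (params a))) (Node (tguesses (stage1 a)) a)).

Section Instance.
Variables (R : realType) (x : mc_instance).
Let G := mc_graph x.
Let phi := mc_sentence x.
Let k := fo_size phi.
Let al := independence_number (adj G).
Hypothesis circ : circle_graph R (adj G).
Let a := code_mc x.
Let Am := code_adj (adj G).
Let S := tsearch Am (tguesses (tcard Am)).
Let Rp := treps Am S.

Lemma paramsE : params a = Node (tverts Rp) (rcode (lrank phi) phi).
Proof.
rewrite /params /stage2 /stage1 /a /code_mc -/G code_lgraphE [tfst _]/= [tsnd _]/=.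
congr Node; rewrite /trelabel.
by apply: trelabelE; rewrite nval_tcons size_map size_enum_ord.
Qed.

Theorem decideE : decide a = code_bool (models G phi).
Proof.
have [c1 c2 c3 c4 c5 c6 c7 _] := search_certified_all (@adj_sym _ _ G) (@adj_irr _ _ G) circ.
rewrite /decide paramsE /stage4 /stage1 /a /code_mc -/G code_lgraphE.
rewrite ![tfst (Node _ _)]/= ![tsnd (Node _ _)]/= -/Am -/S -/Rp -/phi.
have hA : nval Am = mc_order x by rewrite nval_tcons size_map size_enum_ord.
rewrite tanswerE hA; congr code_bool.
have [_ h] := qe_correct (rk := lrank phi) c1 c2 c3 c4 c5 c6 c7 (@used_ok _ _ G _ phi).
exact: (h [tuple]).
Qed.
End Instance.

(** * Running time *)

Lemma tsz_code k : tsz (code_nat k) = k.*2.+1.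
Proof. by elim: k => //= k ->; lia. Qed.

Lemma tsz_tcons s b : (forall x, List.In x s -> tsz x <= b) -> tsz (tcons s) <= (size s * b.+1).+1.
Proof.
elim: s => //= x s IH h; have := h x (or_introl erefl); have := IH (fun y hy => h y (or_intror hy)).
by rewrite mulSn; lia.
Qed.

Lemma tsz_tverts l : tsz (tverts l) <= (nval l * (nval l).*2.+2).+1.
Proof.
rewrite tvertsE; apply: leq_trans (tsz_tcons (b := (nval l).*2.+1) _) _.
  by move=> x /In_map[i [/In_iota hi ->]]; rewrite tsz_code; lia.
by rewrite size_map size_iota.
Qed.

(** A symbol contributes a tag, up to two variable indices below [m] plus the number of enclosing
    quantifiers, and possibly a label rank. *)
Lemma tsz_rcode L m (rk : nat -> nat) b (phi : fo L m) : (forall l, rk l <= b) ->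
  tsz (rcode rk phi) <= fo_size phi * (20 + 4 * (m + fo_size phi) + 2 * b).
Proof.
move=> hb; elim: m / phi => [m i j|m i j|m l i|m p IH|m p IHp q IHq|m p IHp q IHq|m p IH|m p IH];
  rewrite [rcode _ _]/= /rnode [tsz _]/= ?tsz_code.
- by have := ltn_ord i; have := ltn_ord j; rewrite /=; lia.
- by have := ltn_ord i; have := ltn_ord j; rewrite /=; lia.
- by have := ltn_ord i; have := hb l; rewrite /=; lia.
- by rewrite /=; nia.
- by rewrite /=; nia.
- by rewrite /=; nia.
- by rewrite /=; nia.
by rewrite /=; nia.
Qed.

Lemma sort_bound_le a b : a <= b -> sort_bound a <= sort_bound b.
Proof. by move=> h; rewrite /sort_bound leq_add // leq_exp2l // leq_mul2l h orbT. Qed.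

Lemma leq_pow a b D : a <= b -> a ^ D <= b ^ D.
Proof. by move=> h; case: D => // D; rewrite leq_exp2r. Qed.

Lemma polyb_pow f : polyb f -> exists D, forall s T, s.+2 <= T -> f s <= T ^ D.
Proof. by move=> [D h]; exists D => s T hT; apply: leq_trans (h s) (leq_pow D hT). Qed.

(** The list of sorts is measured by [tsz_tverts], the formula by [tsz_rcode] for a sentence whose
    label ranks are at most [s]. *)
Definition input_bound (s : nat) : nat :=
  ((sort_bound s * (sort_bound s).*2.+2).+1 + s * (20 + 6 * s)).+1.

Section Bound.
Variables (eg eq : lang) (D : nat).
Let g s := sz eg s.*2.+1.
Let B s := input_bound s.
(** Sizes and times of the two unclipped computations; [s.*2.+1] is the size of the unary number
    [s], and [20] absorbs fixed overheads. *)
Definition par_bound (s : nat) : nat := g s + tm eg s.*2.+1 + tm eq (B s) + sz eq (B s) + 20.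
Definition run_bound (k l : nat) : nat := 20 * par_bound (k + l) ^ D.

Lemma run_bound_computable : computable2 run_bound.
Proof.
apply: computable2_ndef.
have hs : ndef (fun a => nval (tfst a) + nval (tsnd a)) by repeat ndef_step.
set s := fun a => _ in hs.
have hdbl c : ndef c -> ndef (fun a => (c a).*2).
  by move=> hc; apply: def_ext (ndef_add hc hc) => a; rewrite addnn.
have hb : ndef (fun a => sort_bound (s a)).
  apply: ndef_add => //.
  apply: def_ext (_ : _ =1 _) (@ndef_iter (fun a => 4 * s a) (fun=> 1) (fun _ x => x + x) _ _ _).
  - by move=> a; congr code_nat; elim: (4 * s a) => //= j ->; rewrite expnS addnn mul2n.
  - by apply: ndef_mul => //; apply: ndef_const.
  - exact: ndef_const.
  - by repeat ndef_step.
have hB : ndef (fun a => B (s a)).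
  apply: ndef_S; apply: ndef_add.
    by apply: ndef_S; apply: ndef_mul => //; do 2!apply: ndef_S; apply: hdbl.
  apply: ndef_mul => //; apply: ndef_add; first exact: ndef_const.
  by apply: ndef_mul => //; apply: ndef_const.
have hg := ndef_S (hdbl _ hs).
apply: ndef_mul; first exact: ndef_const.
apply: (@ndef_exp (fun a => par_bound (s a))).
apply: ndef_add; last exact: ndef_const.
apply: ndef_add; last exact: ndef_sz.
apply: ndef_add; last exact: ndef_tm.
by apply: ndef_add; [apply: ndef_sz|apply: ndef_tm].
Qed.
End Bound.

Theorem theorem7 (R : realType) :
  fpt2 code_mc
    (fun x => circle_graph R (adj (mc_graph x)))
    (fun x => models (mc_graph x) (mc_sentence x))
    (fun x => fo_size (mc_sentence x))
    (fun x => independence_number (adj (mc_graph x))).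
Proof.
have [e1 r1 s1] := def_stage1; have [e2 r2 s2] := def_stage2; have [e4 r4 s4] := def_stage4.
have [eg _ sg] := def_tguesses; have [eq _ sq] := def_qe.
pose X := LNode (LApp eg e1) LArg; pose Y := LApp e2 X.
pose E := LApp e4 (LNode (LApp eq Y) X).
have semE a : sem E a = decide a.
  rewrite /= s4 sq s2 sg s1 /=.
  by rewrite /decide /params.
have [P hP] := lang_program E.
have [_ /polyb_pow[D1 p1]] := restricted_poly (r1 isT).
have [_ /polyb_pow[D2 p2]] := restricted_poly (r2 isT).
have [_ /polyb_pow[D4 p4]] := restricted_poly (r4 isT).
(* The extra factor pays for the unclipped computations, whose cost is at most one [T]. *)
pose D := (D1 + D2 + D4).+1.
exists P, (run_bound eg eq D), D; split; first exact: run_bound_computable.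
move=> x hc; have [t [ht le]] := hP (code_mc x); exists t; split.
  by move: ht; rewrite semE (decideE hc).
apply: leq_trans le _; set a := code_mc x.
set k := fo_size _; set al := independence_number _; set N := tsz a.
have N0 : 0 < N by case: (a).
have [m hm mle] := tcard_bound (@adj_sym _ _ (mc_graph x)) (@adj_irr _ _ (mc_graph x)).
have m1 : sem e1 a = code_nat m.
  by rewrite s1 /stage1 /a /code_mc code_lgraphE.
pose s := k + al; rewrite /run_bound -/s; set Q := par_bound _ _ _.
have szm : tsz (sem e1 a) <= s.*2.+1 by rewrite m1 tsz_code /s; move: mle; rewrite -/al; lia.
have szg := sz_bound eg szm; have tmg := cost_bound eg szm.
have szX : tsz (sem X a) <= (sz eg s.*2.+1 + N).+1 by rewrite -[tsz _]/((tsz (sem eg (sem e1 a)) + N).+1) ltnS leq_add2r.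
have szY : tsz (sem Y a) <= input_bound s.
  have -> : sem Y a = params a by rewrite /= s2 sg s1.
  rewrite (paramsE x) /=.
  have := c_size (search_certified_all (@adj_sym _ _ (mc_graph x)) (@adj_irr _ _ (mc_graph x)) hc).
  set Rp := treps _ _ => hK.
  have hK' : nval Rp <= sort_bound s by apply: leq_trans hK _; apply: sort_bound_le; rewrite /s; lia.
  have h1 := tsz_tverts Rp.
  have h2 := tsz_rcode (mc_sentence x) (@lrank_bound _ _ (mc_sentence x)).
  have h3 : nval Rp * (nval Rp).*2.+2 <= sort_bound s * (sort_bound s).*2.+2.
    by apply: leq_mul => //; lia.
  have h4 : k * (20 + 4 * (0 + k) + 2 * k) <= s * (20 + 6 * s).
    by apply: leq_mul; rewrite /s; lia.
  rewrite /input_bound; move: h1 h2; rewrite -/k; lia.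
have szq := sz_bound eq szY; have tmq := cost_bound eq szY.
(* For positive [Q] and [N], [Q.-1 + N <= Q * N]: this turns a sum of bounds into the product
   required by [fpt2]. *)
pose T := Q.-1 + N.
have hQ : Q = sz eg s.*2.+1 + tm eg s.*2.+1 + tm eq (input_bound s) + sz eq (input_bound s) + 20 by [].
have c1 : cost e1 a <= T ^ D1.
  by apply: leq_trans (cost_bound e1 (leqnn _)) _; apply: p1; rewrite /T hQ -/N; lia.
have c2 : cost e2 (sem X a) <= T ^ D2.
  by apply: leq_trans (cost_bound e2 szX) _; apply: p2; rewrite /T hQ; lia.
have sz4 : tsz (sem (LNode (LApp eq Y) X) a) <= (sz eq (input_bound s) + (sz eg s.*2.+1 + N).+1).+1.
  by rewrite -[tsz (sem (LNode _ _) _)]/((tsz (sem eq (sem Y a)) + tsz (sem X a)).+1) ltnS leq_add.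
have c4 : cost e4 (sem (LNode (LApp eq Y) X) a) <= T ^ D4.
  by apply: leq_trans (cost_bound e4 sz4) _; apply: p4; rewrite /T hQ; lia.
have T0 : 0 < T by rewrite /T hQ; lia.
have pw i : i <= D1 + D2 + D4 -> T ^ i <= T ^ (D1 + D2 + D4) by move=> hi; rewrite leq_pexp2l.
have := pw D1 ltac:(lia); have := pw D2 ltac:(lia); have := pw D4 ltac:(lia).
set Z := T ^ (D1 + D2 + D4) => z4 z2 z1.
have hZ : 0 < Z by rewrite expn_gt0 T0.
have {}c1 := leq_trans c1 z1; have {}c2 := leq_trans c2 z2; have {}c4 := leq_trans c4 z4.
have cX : cost X a <= Z + T.
  have -> : cost X a = (((cost e1 a + cost eg (sem e1 a)).+1 + 1).+1) by []. 
  move: c1 tmg; rewrite /T hQ; lia.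
(* [X] occurs twice in [E] and is evaluated each time. *)
have total : (cost E a).+2 <= 20 * T ^ D.
  have -> : cost E a = (((cost X a + cost e2 (sem X a)).+1 + cost eq (sem Y a)).+1 + cost X a +
     1 + cost e4 (sem (LNode (LApp eq Y) X) a)).+1.
    by rewrite addn1.
  have tq : cost eq (sem Y a) <= T by move: tmq; rewrite /T hQ; lia.
  have hT : 20 <= T by rewrite /T hQ; lia.
  rewrite /D expnS -/Z.
  have : Z <= T * Z by rewrite leq_pmull.
  have : T <= T * Z by rewrite leq_pmulr.
  lia.
apply: leq_trans total _; rewrite -mulnA leq_mul2l /= -expnMn; apply: leq_pow.
rewrite /T; have : 0 < Q by rewrite hQ; lia.
by move: (Q) (N) N0 => [|q] [|N1] //= _ _; rewrite mulSn mulnS; lia.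
Qed.
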